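(* Assume that $V$ is self-adjoint with $|V(x)|\lesssim\langle x\rangle^{-\beta}$ for some $\beta>2$. The rank of $S_1$ is at most two plus the dimension of the eigenspace of $H$ at zero, i.e. of $\{\psi\in L^2: H\psi=0\}$.
   Context: Functions are $\mathbb C^2$-valued on $\mathbb R^2$ and $L^p$ means $L^p(\mathbb R^2;\mathbb C^2)$. $D_0=-i\alpha\cdot\nabla=-i(\alpha_1\partial_1+\alpha_2\partial_2)$ with $\alpha_1=\begin{pmatrix}0&1\\1&0\end{pmatrix}$, $\alpha_2=\begin{pmatrix}0&-i\\ i&0\end{pmatrix}$; $V:\mathbb R^2\to\mathbb C^{2\times2}$ is Hermitian matrix valued; $H=D_0+V$. $\langle x\rangle=(1+|x|^2)^{1/2}$, and $|V(x)|\lesssim\langle x\rangle^{-\beta}$ means every entry satisfies this bound with some constant. Diagonalize $V=B^*\,\mathrm{diag}(\zeta_1,\zeta_2)B$ pointwise with $B(x)$ unitary, $\zeta_j(x)\in\mathbb R$; put $\eta_j=|\zeta_j|^{1/2}$, $v=\mathrm{diag}(\eta_1,\eta_2)B$, $U=\mathrm{diag}(\mathrm{sign}\,\zeta_1,\mathrm{sign}\,\zeta_2)$ (with $\mathrm{sign}\,0:=1$), so $V=v^*Uv$. $\mathcal G_{0,0}$ is the integral operator with kernel $\frac{i\alpha\cdot(x-y)}{2\pi|x-y|^2}$, $T=U+v\mathcal G_{0,0}v^*$ on $L^2$, and $S_1$ is the Riesz projection onto $\ker T$. *)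

(* Defs.v *)
From HB Require Import structures.
From mathcomp Require Import all_boot all_order all_algebra.
From mathcomp Require Import all_classical all_reals all_analysis.
From mathcomp Require Import complex.

Set Implicit Arguments.
Unset Strict Implicit.
Unset Printing Implicit Defensive.

Import Order.TTheory GRing.Theory Num.Theory.
Import numFieldNormedType.Exports.

Local Open Scope classical_set_scope.
Local Open Scope ring_scope.
Local Open Scope complex_scope.
Local Open Scope sesquilinear_scope.

(* Points of the plane are pairs; the library norm on pairs is the sup norm,
   hence the explicit Euclidean norm below. *)
Notation plane R := (measurableTypeR R * measurableTypeR R)%type.

Section Plane.
Context {R : realType}.
Local Notation C := R[i].
Local Notation field := (plane R -> 'cV[C]_2).

Definition plane_measure : {measure set (plane R) -> \bar R} :=
  ((@lebesgue_measure R) \x (@lebesgue_measure R))%E.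

Definition enorm (x : R * R) : R := Num.sqrt (x.1 ^+ 2 + x.2 ^+ 2).

Definition bracket (x : R * R) : R := Num.sqrt (1 + enorm x ^+ 2).

Definition cmeasurable (f : plane R -> C) : Prop :=
  measurable_fun setT (fun x => complex.Re (f x)) /\
  measurable_fun setT (fun x => complex.Im (f x)).

Definition mxmeasurable m n (A : plane R -> 'M[C]_(m, n)) : Prop :=
  forall i j, cmeasurable (fun x => A x i j).

Definition cintegral d (T : measurableType d) (mu : {measure set T -> \bar R})
    (D : set T) (f : T -> C) : C :=
  (\int[mu]_(x in D) complex.Re (f x)) +i* (\int[mu]_(x in D) complex.Im (f x)).

Definition mxintegral m n (f : plane R -> 'M[C]_(m, n)) : 'M[C]_(m, n) :=
  \matrix_(i, j) cintegral plane_measure setT (fun x => f x i j).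

(* Elements of L^2(R^2; C^2) are represented by functions, to be compared
   almost everywhere. *)
Definition ae_eq2 (f g : field) : Prop :=
  {ae plane_measure, forall x, f x = g x}.

Definition normsq (w : 'cV[C]_2) : R :=
  \sum_i (complex.Re (w i 0) ^+ 2 + complex.Im (w i 0) ^+ 2).

Definition L2normsq (f : field) : \bar R :=
  (\int[plane_measure]_x (normsq (f x))%:E)%E.

Definition L2 : set field :=
  [set f | mxmeasurable f /\ (L2normsq f < +oo)%E].

Definition inner (f g : field) : C :=
  cintegral plane_measure setT (fun x => ((f x)^t* *m g x) 0 0).

Definition lin_indep n (phi : 'I_n -> field) : Prop :=
  forall c : 'I_n -> C,
    ae_eq2 (fun x => \sum_i c i *: phi i x) (fun=> 0) -> forall i, c i = 0.

(* The dimension, in [0, +oo], of the subspace of L^2 whose elements are the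
   classes of the members of W. *)
Definition L2dim (W : set field) : \bar R :=
  ereal_sup [set n%:R%:E | n in
    [set n : nat | exists phi : 'I_n -> field,
                     (forall i, W (phi i)) /\ lin_indep phi]].

Definition L2rank (S : field -> field) : \bar R := L2dim (S @` L2).

(* Q is the bounded inverse of A - z on L^2. *)
Definition is_resolvent (A : field -> field) (z : C) (Q : field -> field) :
    Prop :=
  [/\ forall f, L2 f -> L2 (Q f),
      exists M : R, forall f, L2 f -> (L2normsq (Q f) <= M%:E * L2normsq f)%E,
      forall f, L2 f -> ae_eq2 (fun x => A (Q f) x - z *: Q f x) f &
      forall f, L2 f -> ae_eq2 (Q (fun x => A f x - z *: f x)) f].

Definition circle_integral (rho : R) (h : C -> C) : C :=
  cintegral (@lebesgue_measure R) `[0, 2 * pi] (fun theta : measurableTypeR R =>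
    let z := rho%:C * (cos theta +i* sin theta) in h z * ('i%C * z)).

(* S = - (2 i pi)^-1 \oint (A - z)^-1 dz, the integral being taken in the weak
   sense along a circle around 0 such that the closed disk it bounds contains
   no point of the spectrum of A, except possibly 0.  The value of the integral
   is the same for all the concentric circles of smaller radius. *)
Definition riesz_projection_at0 (A S : field -> field) : Prop :=
  (forall f, L2 f -> L2 (S f)) /\
  exists2 r : R, 0 < r &
  exists Q : C -> field -> field,
    (forall z : C, 0 < `|z| <= r%:C -> is_resolvent A z (Q z)) /\
    forall rho : R, 0 < rho <= r -> forall f g, L2 f -> L2 g ->
      inner g (S f) =
      - ('i%C * (2 * pi)%:C)^-1 * circle_integral rho (fun z => inner g (Q z f)).

Definition alpha1 : 'M[C]_2 :=
  \matrix_(i, j) (if i == j then 0 else 1).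

Definition alpha2 : 'M[C]_2 :=
  \matrix_(i, j) (if i == j then 0 else if i == 0 then - 'i%C else 'i%C).

Definition alpha_dot (x : R * R) : 'M[C]_2 :=
  x.1%:C *: alpha1 + x.2%:C *: alpha2.

Definition e1 : R * R := (1, 0).
Definition e2 : R * R := (0, 1).

Definition partial (v : R * R) (f : R * R -> R) : R * R -> R :=
  fun x => 'D_v f x.

(* Smoothness: all iterated partial derivatives exist and are continuous. *)
Definition smooth (f : R * R -> R) : Prop :=
  forall s : seq bool,
    let g := foldr (fun b => partial (if b then e1 else e2)) f s in
    continuous g /\ forall x, derivable g x e1 /\ derivable g x e2.

Definition test_function (f : R * R -> R) : Prop :=
  smooth f /\ compact (closure [set x | f x != 0]).

(* The value at the test function phi of the distribution
   H psi = - i (alpha1 d_1 psi + alpha2 d_2 psi) + V psi,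
   where (d_j psi)(phi) = - \int psi d_j phi. *)
Definition H_distr (V : plane R -> 'M[C]_2) (psi : field)
    (phi : R * R -> R) : 'cV[C]_2 :=
  - 'i%C *: (alpha1 *m (- mxintegral (fun x => (partial e1 phi x)%:C *: psi x))
         + alpha2 *m (- mxintegral (fun x => (partial e2 phi x)%:C *: psi x)))
  + mxintegral (fun x => (phi x)%:C *: (V x *m psi x)).

Definition zero_eigenspace (V : plane R -> 'M[C]_2) : set field :=
  [set psi | L2 psi /\ forall phi, test_function phi -> H_distr V psi phi = 0].

Definition G00 (f : field) : field := fun x =>
  mxintegral (fun y =>
    ('i%C / (2 * pi * enorm (x - y) ^+ 2)%:C) *: (alpha_dot (x - y) *m f y)).

Definition rdiag (d : 'I_2 -> R) : 'M[C]_2 := diag_mx (\row_i (d i)%:C).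

Definition diagonalizes (V B : plane R -> 'M[C]_2)
    (zeta : plane R -> 'I_2 -> R) : Prop :=
  [/\ mxmeasurable B, forall i, measurable_fun setT (fun x => zeta x i),
      forall x, B x \is unitarymx &
      forall x, V x = (B x)^t* *m rdiag (zeta x) *m B x].

Definition vfactor (B : plane R -> 'M[C]_2) (zeta : plane R -> 'I_2 -> R)
    (x : plane R) : 'M[C]_2 :=
  rdiag (fun i => Num.sqrt `|zeta x i|) *m B x.

(* With sign 0 := 1, U is unitary. *)
Definition Usign (zeta : plane R -> 'I_2 -> R) (x : plane R) : 'M[C]_2 :=
  rdiag (fun i => if 0 <= zeta x i then 1 else -1).

Definition Top (B : plane R -> 'M[C]_2) (zeta : plane R -> 'I_2 -> R)
    (f : field) : field := fun x =>
  Usign zeta x *m f x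
  + vfactor B zeta x *m G00 (fun y => (vfactor B zeta y)^t* *m f y) x.

Definition decays (V : plane R -> 'M[C]_2) (beta : R) : Prop :=
  forall i j, exists K : R, forall x : plane R,
    `|V x i j| <= (K * bracket x `^ (- beta))%:C.

End Plane.

(* Main.v *)
Require Import Defs.
From HB Require Import structures.
From mathcomp Require Import all_boot all_order all_algebra.
From mathcomp Require Import all_classical all_reals all_analysis.
From mathcomp Require Import measurable_realfun complex.
From mathcomp Require Import ring lra.

Set Implicit Arguments.
Unset Strict Implicit.
Unset Printing Implicit Defensive.

Import Order.TTheory GRing.Theory Num.Theory.
Import numFieldNormedType.Exports.

Local Open Scope classical_set_scope.
Local Open Scope ring_scope.

(** Why the theorem holds.  Write T = U + v G v^*, where G is the convolution
with the kernel i alpha.w / (2 pi |w|^2).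

The range of S_1 consists of null vectors of T (riesz_range_kernel).  This only
uses that T is symmetric, which follows from the symmetry of the kernel of G
(BS_symmetric), and maps L^2 to L^2, which a weighted Schur test gives (L2_BS).
For a symmetric operator the resolvent grows at most like |Im z|^-1 near 0, and
on the circle |z| = rho this is compensated by the factor z^2 - |z|^2, which is
2 i z Im z; so the contour integral that defines (T^2 - rho^2) S_1 is weakly O(rho).
As rho tends to 0 it follows that T^2 S_1 = 0, and then T S_1 = 0 by symmetry.

A null vector phi of T yields the zero energy solution psi = G v^* phi.  Indeed
v psi = - U phi, so that V psi = v^* U v psi = - v^* phi, while D_0 G is the
identity in the sense of distributions (dirac_potential).  As phi = - U v psi,
no null vector is lost by passing from phi to psi (potential_eq0).

The kernel of G decays like |x|^-1 only, and psi fails to be square integrable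
by so little that one extra order of decay suffices.  This is gained when the
integral of v^* phi over the plane is zero, because then a multiple of this
integral may be subtracted from psi for free (L2_potential).  The integral is a
vector of C^2, so that the condition costs two dimensions (indep_in_kernel):
n independent vectors in the range of S_1 give n - 2 independent elements of
the zero eigenspace of H.

That D_0 G is the identity amounts to the computation of the divergence and of
the curl of the vector field w / |w|^2, which is the gradient of log |w|.  In a
square around the origin the value of the test function at the origin is
subtracted first, which makes all the derivatives integrable; the fundamental
theorem of calculus then applies on almost every line parallel to an axis, and
the subtracted constant contributes the flux of the field through the boundary
of the square, which is 2 pi. *)

(** * Fubini theorems and translations in the plane *)

Lemma ae_eq_integrable d (T : measurableType d) (R : realType)
    (mu : {measure set T -> \bar R}) (f g : T -> \bar R) :
  measurable_fun setT g -> ae_eq mu setT f g ->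
  mu.-integrable setT f -> mu.-integrable setT g.
Proof.
move=> mg fg /integrableP[mf fi]; apply/integrableP; split => //.
rewrite -(@ge0_ae_eq_integral _ _ _ mu setT (abse \o f))//.
- exact: measurableT_comp.
- exact: measurableT_comp.
- by move=> x _ /=; exact: abse_ge0.
- by apply: filterS fg => x h Ax /=; rewrite h.
Qed.

Section MeasurableSection.
Context d1 d2 (T1 : measurableType d1) (T2 : measurableType d2) (R : realType).

Lemma measurable_Rintegral_section1 (m2 : {sigma_finite_measure set T2 -> \bar R})
    (f : T1 * T2 -> R) : measurable_fun setT f ->
  measurable_fun setT (fun x => \int[m2]_y f (x, y)).
Proof.
move=> mf; have mEf : measurable_fun setT (EFin \o f) by exact/measurable_EFinP.
apply: (measurableT_comp (fine_measurable measurableT)).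
rewrite (_ : (fun x => _) = (fun x => fubini_F m2 (EFin \o f)^\+%E x -
  fubini_F m2 (EFin \o f)^\-%E x)%E); last first.
  apply/funext => x; rewrite integralE; congr (_ - _)%E; apply: eq_integral => y _;
    by rewrite ?funeposE ?funenegE.
apply: emeasurable_funB; apply: measurable_fun_fubini_tonelli_F => //.
- exact: measurable_funepos.
- exact: measurable_funeneg.
Qed.

Lemma measurable_Rintegral_section2 (m1 : {sigma_finite_measure set T1 -> \bar R})
    (f : T1 * T2 -> R) : measurable_fun setT f ->
  measurable_fun setT (fun y => \int[m1]_x f (x, y)).
Proof.
move=> mf; have mEf : measurable_fun setT (EFin \o f) by exact/measurable_EFinP.
apply: (measurableT_comp (fine_measurable measurableT)).
rewrite (_ : (fun x => _) = (fun x => fubini_G m1 (EFin \o f)^\+%E x -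
  fubini_G m1 (EFin \o f)^\-%E x)%E); last first.
  apply/funext => x; rewrite integralE; congr (_ - _)%E; apply: eq_integral => y _;
    by rewrite ?funeposE ?funenegE.
apply: emeasurable_funB; apply: measurable_fun_fubini_tonelli_G => //.
- exact: measurable_funepos.
- exact: measurable_funeneg.
Qed.

End MeasurableSection.

Section RealFubini.
Context d1 d2 (T1 : measurableType d1) (T2 : measurableType d2) (R : realType).
Variable m1 : {sigma_finite_measure set T1 -> \bar R}.
Variable m2 : {sigma_finite_measure set T2 -> \bar R}.
Variable f : T1 * T2 -> R.
Hypothesis mf : measurable_fun setT f.
Hypothesis f_fin : (\int[m1]_x \int[m2]_y `|f (x, y)|%:E < +oo)%E.

Let intf : ((m1 \x m2)%E).-integrable setT (EFin \o f).
Proof. by apply/integrable12ltyP => //; exact/measurable_EFinP. Qed.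

Lemma ae_integrable_section1 :
  {ae m1, forall x, m2.-integrable setT (fun y => (f (x, y))%:E)}.
Proof. exact: (@ae_integrable1 _ _ _ _ _ m1 m2 (EFin \o f)). Qed.

Lemma ae_integrable_section2 :
  {ae m2, forall y, m1.-integrable setT (fun x => (f (x, y))%:E)}.
Proof. exact: (@ae_integrable2 _ _ _ _ _ m1 m2 (EFin \o f)). Qed.

Let fine_ae1 : ae_eq m1 setT
  (fun x => (\int[m2]_y f (x, y))%:E) (fubini_F m2 (EFin \o f)).
Proof.
apply: filterS ae_integrable_section1 => x ix _.
by rewrite /Rintegral fineK//; exact: integrable_fin_num.
Qed.

Let fine_ae2 : ae_eq m2 setT
  (fun y => (\int[m1]_x f (x, y))%:E) (fubini_G m1 (EFin \o f)).
Proof.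
apply: filterS ae_integrable_section2 => x ix _.
by rewrite /Rintegral fineK//; exact: integrable_fin_num.
Qed.

Lemma integrable_Rintegral_section1 :
  m1.-integrable setT (fun x => (\int[m2]_y f (x, y))%:E).
Proof.
apply: (@ae_eq_integrable _ _ _ _ (fubini_F m2 (EFin \o f))) => //.
- exact/measurable_EFinP/measurable_Rintegral_section1.
- exact: ae_eq_sym.
- exact: integrable_fubini_F.
Qed.

Lemma Rintegral_fubini :
  \int[m1]_x \int[m2]_y f (x, y) = \int[m2]_y \int[m1]_x f (x, y).
Proof.
transitivity (fine (\int[m1]_x fubini_F m2 (EFin \o f) x)%E).
  congr fine; apply: ae_eq_integral => //.
  - exact/measurable_EFinP/measurable_Rintegral_section1.
  - exact: (measurable_fubini_F intf).
transitivity (fine (\int[m2]_y fubini_G m1 (EFin \o f) y)%E).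
  by congr fine; exact: Fubini.
congr fine; apply/esym/ae_eq_integral => //.
- exact/measurable_EFinP/measurable_Rintegral_section2.
- exact: (measurable_fubini_G intf).
Qed.

End RealFubini.

Section PlaneMeasure.
Context {R : realType}.
Local Notation mu1 := (@lebesgue_measure R).
Local Notation mu2 := (@plane_measure R).

Lemma plane_measure_sigma_finite : sigma_finite setT mu2.
Proof.
have /sigma_finiteP[F [TF ndF Foo]] := sigma_finiteT mu1.
exists (fun n => F n `*` F n).
  apply/seteqP; split => // -[x y] _.
  have [[n _ Fx] [k _ Fy]] : (\bigcup_i F i) x /\ (\bigcup_i F i) y by rewrite -TF.
  exists (maxn n k) => //; split => /=.
    by move: x Fx; exact/subsetPset/ndF/leq_maxl.
  by move: y Fy; exact/subsetPset/ndF/leq_maxr.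
move=> k; have [mF Fk] := Foo k; split; first exact: measurableX.
by rewrite [X in (X < _)%E]product_measure1E// lte_mul_pinfty// ge0_fin_numE.
Qed.

Let mixin := Measure_isSigmaFinite.Build _ _ _ mu2 plane_measure_sigma_finite.
Let plane_sf : {sigma_finite_measure set (plane R) -> \bar R} :=
  HB.pack (Measure.sort mu2) (Measure.class mu2) mixin.

Lemma plane_tonelli (f : plane R * plane R -> \bar R) :
  measurable_fun setT f -> (forall z, (0 <= f z)%E) ->
  (\int[mu2]_x \int[mu2]_y f (x, y) = \int[mu2]_y \int[mu2]_x f (x, y))%E.
Proof. exact: (@fubini_tonelli _ _ _ _ _ plane_sf plane_sf). Qed.

Lemma measurable_plane_tonelli1 (f : plane R * plane R -> \bar R) :
  measurable_fun setT f -> (forall z, (0 <= f z)%E) ->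
  measurable_fun setT (fun x => \int[mu2]_y f (x, y))%E.
Proof. exact: (@measurable_fun_fubini_tonelli_F _ _ _ _ _ plane_sf). Qed.

Lemma measurable_plane_tonelli2 (f : plane R * plane R -> \bar R) :
  measurable_fun setT f -> (forall z, (0 <= f z)%E) ->
  measurable_fun setT (fun y => \int[mu2]_x f (x, y))%E.
Proof. exact: (@measurable_fun_fubini_tonelli_G _ _ _ _ _ plane_sf). Qed.

Lemma ge0_integral_planeE (f : plane R -> \bar R) :
  measurable_fun setT f -> (forall z, (0 <= f z)%E) ->
  (\int[mu2]_z f z = \int[mu1]_x \int[mu1]_y f (x, y))%E.
Proof. exact: (@fubini_tonelli1 _ _ _ _ _ mu1 mu1). Qed.

Lemma plane_measurable_section1 (f : plane R * plane R -> R) :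
  measurable_fun setT f -> measurable_fun setT (fun x => \int[mu2]_y f (x, y)).
Proof. exact: (@measurable_Rintegral_section1 _ _ _ _ _ plane_sf). Qed.

Section PlaneFubini.
Variable f : plane R * plane R -> R.
Hypothesis mf : measurable_fun setT f.
Hypothesis f_fin : (\int[mu2]_x \int[mu2]_y `|f (x, y)|%:E < +oo)%E.

Lemma plane_ae_integrable1 :
  {ae mu2, forall x, mu2.-integrable setT (fun y => (f (x, y))%:E)}.
Proof. exact: (@ae_integrable_section1 _ _ _ _ _ plane_sf plane_sf). Qed.

Lemma plane_integrable_section1 :
  mu2.-integrable setT (fun x => (\int[mu2]_y f (x, y))%:E).
Proof. exact: (@integrable_Rintegral_section1 _ _ _ _ _ plane_sf plane_sf). Qed.

Lemma plane_fubini :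
  \int[mu2]_x \int[mu2]_y f (x, y) = \int[mu2]_y \int[mu2]_x f (x, y).
Proof. exact: (@Rintegral_fubini _ _ _ _ _ plane_sf plane_sf). Qed.

End PlaneFubini.

Lemma measurable_translation (a : R) :
  measurable_fun setT (fun x : measurableTypeR R => x + a : measurableTypeR R).
Proof. by apply: measurable_funD => //; exact: measurable_cst. Qed.

Lemma lebesgue_measure_translation (a : R) (A : set R) : measurable A ->
  mu1 ((fun x => x + a) @^-1` A) = mu1 A.
Proof.
pose phi (x : measurableTypeR R) : measurableTypeR R := x + a.
pose mphi : {mfun measurableTypeR R >-> measurableTypeR R} :=
  HB.pack phi (isMeasurableFun.Build _ _ _ _ phi (measurable_translation a)).
move=> mA; rewrite -[LHS]/(pushforward mu1 mphi A); apply/esym.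
apply: lebesgue_measure_unique => // _ [[x y]] _ <-.
rewrite /= /pushforward /mphi /= /phi.
rewrite (_ : _ @^-1` _ = `]x - a, y - a]%classic); last first.
  by apply/seteqP; split => z /=; rewrite !in_itv/= ltrBlDr lerBrDr.
rewrite !lebesgue_measure_itv/= !lte_fin ltrD2r.
by case: ifP => // _; rewrite -!EFinB; congr (_%:E); ring.
Qed.

Definition ptrans (a : plane R) (x : plane R) : plane R := (x.1 + a.1, x.2 + a.2).

Lemma measurable_ptrans a : measurable_fun setT (ptrans a).
Proof.
apply: measurable_fun_pair.
- exact: measurableT_comp (measurable_translation a.1) measurable_fst.
- exact: measurableT_comp (measurable_translation a.2) measurable_snd.
Qed.

Lemma plane_measure_translation a A : measurable A ->
  mu2 (ptrans a @^-1` A) = mu2 A.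
Proof.
pose mphi : {mfun plane R >-> plane R} :=
  HB.pack (ptrans a) (isMeasurableFun.Build _ _ _ _ (ptrans a) (measurable_ptrans a)).
move=> mA; rewrite -[LHS]/(pushforward mu2 mphi A); apply/esym.
apply: (@product_measure_unique _ _ _ _ _ mu1 mu1) => // B C mB mC.
change (mu2 (((fun x => x + a.1) @^-1` B) `*` ((fun x => x + a.2) @^-1` C)) =
  (mu1 B * mu1 C)%E).
have mpre (b : R) (E : set R) : measurable E -> measurable ((fun x => x + b) @^-1` E).
  by move=> mE; have := measurable_translation b measurableT mE; rewrite setTI.
rewrite [LHS]product_measure1E; [|exact: mpre|exact: mpre].
by congr (_ * _)%E; exact: lebesgue_measure_translation.
Qed.

Lemma ge0_integral_translation a (f : plane R -> \bar R) :
  measurable_fun setT f -> (forall x, (0 <= f x)%E) ->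
  (\int[mu2]_x f (ptrans a x) = \int[mu2]_x f x)%E.
Proof.
move=> mf f0; pose mphi : {mfun plane R >-> plane R} :=
  HB.pack (ptrans a) (isMeasurableFun.Build _ _ _ _ (ptrans a) (measurable_ptrans a)).
transitivity (\int[pushforward mu2 mphi]_x f x)%E.
  by apply/esym; apply: (@ge0_integral_pushforward _ _ _ _ _ _ (measurable_ptrans a) mu2 setT).
apply: eq_measure_integral => A mA _.
exact: plane_measure_translation.
Qed.

Lemma integral_translation a (f : plane R -> R) :
  measurable_fun setT f ->
  \int[mu2]_x f (ptrans a x) = \int[mu2]_x f x.
Proof.
move=> mf; rewrite /Rintegral integralE [in RHS]integralE.
have mEf : measurable_fun setT (fun x : plane R => (f x)%:E) by exact/measurable_EFinP.
congr (fine (_ - _)%E).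
- rewrite -(ge0_integral_translation a (measurable_funepos mEf)); last first.
    by move=> x; exact: funepos_ge0.
  by apply: eq_integral => x _; rewrite !funeposE.
- rewrite -(ge0_integral_translation a (measurable_funeneg mEf)); last first.
    by move=> x; exact: funeneg_ge0.
  by apply: eq_integral => x _; rewrite !funenegE.
Qed.

End PlaneMeasure.

(** * Borel functions and the integrability of weights *)

Section PlaneMeasurability.
Context {R : realType}.
Implicit Types (x y w : plane R).
Local Notation mu2 := (@plane_measure R).

(** An open set is the union of the rectangles with rational vertices that it
contains. *)
Lemma open_measurable_plane (A : set (R * R)) :
  open A -> measurable (A : set (plane R)).
Proof.
move=> oA.
pose rect (q : (rat * rat) * (rat * rat)) : set (plane R) :=
  `]ratr q.1.1, ratr q.1.2[%classic `*` `]ratr q.2.1, ratr q.2.2[%classic.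
rewrite (_ : A = \bigcup_q if `[< rect q `<=` A >] then rect q else set0).
  apply: countable_bigcupT_measurable => // q.
  by case: ifPn => // _; apply: measurableX.
apply/seteqP; split => [[p1 p2] Ap|p [q _]]; last by case: ifPn => // /asboolP; exact.
have /nbhs_ballP[e /= e0 eA] : nbhs (p1, p2) A by exact: open_nbhs_nbhs.
have ratb (u v : R) : u < v -> exists q, u < ratr q < v.
  by move=> /rat_in_itvoo[q]; rewrite in_itv/= => ?; exists q.
have [a /andP[a1 a2]] : exists q, p1 - e < ratr q < p1 by apply/ratb; rewrite gtrBl.
have [b /andP[b1 b2]] : exists q, p1 < ratr q < p1 + e by apply/ratb; rewrite ltrDl.
have [c /andP[c1 c2]] : exists q, p2 - e < ratr q < p2 by apply/ratb; rewrite gtrBl.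
have [d /andP[d1 d2]] : exists q, p2 < ratr q < p2 + e by apply/ratb; rewrite ltrDl.
exists ((a, b), (c, d)) => //; case: ifPn => [_|/asboolP[]].
  by split; rewrite /= in_itv/= ?a2 ?b1 ?c2 ?d1.
move=> [z1 z2] [] /=; rewrite !in_itv/= => /andP[az zb] /andP[cz zd].
by apply: eA; split; rewrite /ball/= ltr_norml; apply/andP; split; lra.
Qed.

Lemma continuous_measurable_plane (f : R * R -> R) :
  continuous f -> measurable_fun setT (f : plane R -> R).
Proof.
move=> /continuousP cf; apply: (measurability _ (RGenOpens.measurableE R)).
move=> _ [_ [a [b ->] <-]]; rewrite setTI; apply: open_measurable_plane.
exact/cf/interval_open.
Qed.

Lemma measurable_inv_ge0 d (T : measurableType d) (f : T -> R) :
  (forall t, 0 <= f t) -> measurable_fun setT f ->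
  measurable_fun setT (fun t => (f t)^-1).
Proof.
move=> f0 mf; under eq_fun do rewrite -powR_inv1//.
exact: measurableT_comp (measurable_powR (-1)) mf.
Qed.

Lemma measurable_sqrt_ge0 d (T : measurableType d) (f : T -> R) :
  (forall t, 0 <= f t) -> measurable_fun setT f ->
  measurable_fun setT (fun t => Num.sqrt (f t)).
Proof.
move=> f0 mf; under eq_fun do rewrite -powR12_sqrt//.
exact: measurableT_comp (measurable_powR _) mf.
Qed.

Lemma enorm_ge0 x : 0 <= enorm x. Proof. exact: sqrtr_ge0. Qed.

Lemma sqr_enorm x : enorm x ^+ 2 = x.1 ^+ 2 + x.2 ^+ 2.
Proof. by rewrite sqr_sqrtr// addr_ge0// sqr_ge0. Qed.

Lemma sqr_bracket x : bracket x ^+ 2 = 1 + (x.1 ^+ 2 + x.2 ^+ 2).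
Proof. by rewrite sqr_sqrtr sqr_enorm// !addr_ge0// sqr_ge0. Qed.

Lemma bracket_ge1 x : 1 <= bracket x.
Proof.
rewrite -(@ler_pXn2r _ 2)// ?nnegrE ?sqrtr_ge0// sqr_bracket expr1n.
by rewrite lerDl addr_ge0// sqr_ge0.
Qed.

Lemma bracket_gt0 x : 0 < bracket x.
Proof. exact: lt_le_trans (bracket_ge1 x). Qed.

Lemma measurable_fst_plane : measurable_fun setT (fun x : plane R => x.1 : R).
Proof. exact: measurable_fst. Qed.

Lemma measurable_snd_plane : measurable_fun setT (fun x : plane R => x.2 : R).
Proof. exact: measurable_snd. Qed.

Lemma measurable_enorm : measurable_fun setT (fun x : plane R => enorm x).
Proof.
apply: measurable_sqrt_ge0 => [x|]; first by rewrite addr_ge0// sqr_ge0.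
by apply: measurable_funD; apply: measurable_funX;
  [exact: measurable_fst_plane|exact: measurable_snd_plane].
Qed.

Lemma measurable_bracket : measurable_fun setT (fun x : plane R => bracket x).
Proof.
apply: measurable_sqrt_ge0 => [x|]; first by rewrite addr_ge0// sqr_ge0.
by apply: measurable_funD => //; apply: measurable_funX; exact: measurable_enorm.
Qed.

Lemma measurable_bracket_powR a :
  measurable_fun setT (fun x : plane R => bracket x `^ a).
Proof. exact: measurableT_comp (measurable_powR _) measurable_bracket. Qed.

Lemma measurable_inv_enorm : measurable_fun setT (fun x : plane R => (enorm x)^-1).
Proof. by apply: measurable_inv_ge0 => [x|]; [exact: enorm_ge0|exact: measurable_enorm]. Qed.

Lemma measurable_plane_sub :
  measurable_fun setT (fun z : plane R * plane R => (z.1 - z.2 : plane R)).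
Proof.
have m1 := @measurable_fst _ _ (plane R) (plane R).
have m2 := @measurable_snd _ _ (plane R) (plane R).
apply: measurable_fun_pair => /=; apply: measurable_funB.
- exact: measurableT_comp measurable_fst_plane m1.
- exact: measurableT_comp measurable_fst_plane m2.
- exact: measurableT_comp measurable_snd_plane m1.
- exact: measurableT_comp measurable_snd_plane m2.
Qed.

Lemma measurable_plane_subl y : measurable_fun setT (fun x : plane R => (x - y : plane R)).
Proof. exact: measurableT_comp measurable_plane_sub (pair2_measurable y). Qed.

(** The sup norm: its balls are squares, on which integrals can be iterated. *)
Definition supn (x : R * R) : R := Num.max `|x.1| `|x.2|.

Lemma measurable_supn : measurable_fun setT (fun x : plane R => supn x).
Proof.
apply: measurable_maxr; apply: measurableT_comp => //.
Qed.

Lemma supn_ge0 x : 0 <= supn x. Proof. by rewrite le_max normr_ge0. Qed.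

Lemma supn_le_enorm x : supn x <= enorm x.
Proof.
rewrite ge_max -!sqrtr_sqr !ler_sqrt ?addr_ge0 ?sqr_ge0//.
by rewrite lerDl lerDr !sqr_ge0.
Qed.

Lemma enorm_gt0 x : (0 < enorm x) = (x != 0).
Proof.
rewrite lt0r enorm_ge0 andbT -sqrf_eq0 sqr_enorm paddr_eq0 ?sqr_ge0//.
by rewrite !sqrf_eq0; case: x => a b.
Qed.

Lemma measurable_square r : measurable [set x : plane R | supn x <= r].
Proof.
rewrite (_ : mkset _ = setT `&` supn @^-1` `]-oo, r]%classic); last first.
  by rewrite setTI; apply/seteqP; split => x /=; rewrite in_itv.
exact: measurable_supn.
Qed.

Lemma plane_measure_square (r : R) : 0 <= r ->
  mu2 [set x | supn x <= r] = ((2 * r) ^+ 2)%:E.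
Proof.
move=> r0.
pose I : set R := `[- r, r]%classic.
rewrite (_ : mkset _ = I `*` I); last first.
  by apply/seteqP; split => -[a b];
    rewrite /I /= /supn ge_max !in_itv/= !ler_norml => /andP.
transitivity (@lebesgue_measure R I * @lebesgue_measure R I)%E.
  by apply: product_measure1E; exact: measurable_itv.
rewrite !lebesgue_measure_itv/= lte_fin.
have [rr|] := ltP (- r) r; first by rewrite -EFinB -EFinM; congr (_%:E); ring.
by move=> rr; have -> : r = 0 by [lra|]; rewrite mulr0 expr0n/= mule0.
Qed.

(** The function is at most the sum of the constants [a k] over the squares of
radius [r k], and the integral of this sum is at most a geometric series. *)
Lemma shell_integral_lty (f : plane R -> R) (a r : nat -> R) (C q : R) :
  measurable_fun setT f -> (forall x, 0 <= f x) ->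
  (forall k, 0 <= a k) -> (forall k, 0 <= r k) -> 0 < q < 1 ->
  (forall k, a k * (2 * r k) ^+ 2 <= C * q ^+ k) ->
  (forall x, f x != 0 -> exists2 k, supn x <= r k & f x <= a k) ->
  (\int[mu2]_x (f x)%:E < +oo)%E.
Proof.
move=> mf f0 a0 r0 /andP[q0 q1] arq shell.
have C0 : 0 <= C.
  by have := arq 0%N; rewrite expr0 mulr1; apply: le_trans; rewrite mulr_ge0// sqr_ge0.
pose g k (x : plane R) : \bar R := (a k * \1_[set x | supn x <= r k] x)%:E.
have g0 k x : (0 <= g k x)%E by rewrite lee_fin mulr_ge0.
have mg k : measurable_fun setT (g k).
  apply/measurable_EFinP; apply: measurable_funM => //.
  by apply: measurable_indic; exact: measurable_square.
apply: (@le_lt_trans _ _ (\int[mu2]_x \sum_(0 <= k <oo) g k x)%E).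
  apply: ge0_le_integral => //.
  - by move=> x _; rewrite lee_fin.
  - exact/measurable_EFinP.
  - by apply: ge0_emeasurable_sum => // k x _ _; exact: g0.
  - move=> x _; have [->|fx0] := eqVneq (f x) 0; first exact: nneseries_ge0.
    have [k xk fak] := shell _ fx0.
    apply: le_trans (nneseries_lim_ge k.+1 _) => //.
    rewrite big_nat_recr//= -[X in (X <= _)%E]add0e leeD//; first exact: sume_ge0.
    by rewrite /g indicE mem_set// mulr1 lee_fin.
rewrite integral_nneseries//.
apply: (@le_lt_trans _ _ (C / (1 - q))%:E); last exact: ltry.
apply: lime_le.
  by apply: is_cvg_nneseries => k _ _; exact: integral_ge0.
apply: nearW => n; apply: (@le_trans _ _ (series (geometric C q) n)%:E); last first.
  by rewrite lee_fin geometric_le_lim// gtr0_norm.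
rewrite /series/= -sumEFin; apply: lee_sum => k _.
rewrite /g; under eq_integral do rewrite EFinM.
rewrite ge0_integralZl//; last 2 first.
- by apply/measurable_EFinP; apply: measurable_indic; exact: measurable_square.
- by rewrite lee_fin.
rewrite integral_indic//; last exact: measurable_square.
rewrite setIT; apply: (@le_trans _ _ (a k * (2 * r k) ^+ 2)%:E); last by rewrite lee_fin.
by rewrite [X in (_ * X <= _)%E]plane_measure_square// -EFinM.
Qed.

Lemma dyadic_shell_down (N m : R) : 0 < m -> m <= N ->
  exists2 k, m <= N / 2 ^+ k & m^-1 <= 2 ^+ k.+1 / N.
Proof.
move=> m0 mN; have N0 : 0 < N by exact: lt_le_trans mN.
have p2 k : 0 < (2 : R) ^+ k by rewrite exprn_gt0.
have ex : exists k, N / 2 ^+ k.+1 < m.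
  have := archi_boundP (ltW (divr_gt0 N0 m0)); set n := Num.Def.archi_bound _ => nP.
  exists n; rewrite ltr_pdivrMr// mulrC -ltr_pdivrMr//; apply: (lt_le_trans nP).
  by rewrite -natrX ler_nat ltnW// ltnW// ltn_expl.
case: (ex_minnP ex) => k kP kmin; exists k; last first.
  by rewrite -[leRHS]invrK lef_pV2 ?posrE ?invf_div ?divr_gt0// ltW.
case: k kmin {kP} => [|k] kmin; first by rewrite expr0 divr1.
by rewrite leNgt; apply/negP => /kmin; rewrite ltnn.
Qed.

Lemma dyadic_shell_up (m : R) : 1 <= m ->
  exists2 k, m <= 2 ^+ k.+1 & 2 ^+ k <= m.
Proof.
move=> m1; have ex : exists k, m < 2 ^+ k.+1.
  have := archi_boundP (le_trans ler01 m1); set n := Num.Def.archi_bound _ => nP.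
  exists n; apply: (lt_le_trans nP).
  by rewrite -natrX ler_nat ltnW// ltnW// ltn_expl.
case: (ex_minnP ex) => k kP kmin; exists k; first exact: ltW.
case: k kmin {kP} => [|k] kmin; first by rewrite expr0.
by rewrite leNgt; apply/negP => /kmin; rewrite ltnn.
Qed.

Definition box (N : R) : set (plane R) := [set x | supn x <= N].

Definition inv_enorm_box (N : R) (w : plane R) : R := \1_(box N) w * (enorm w)^-1.

Lemma inv_enorm_box_ge0 N w : 0 <= inv_enorm_box N w.
Proof. by rewrite mulr_ge0// invr_ge0 enorm_ge0. Qed.

Lemma measurable_inv_enorm_box N : measurable_fun setT (inv_enorm_box N).
Proof.
by apply: measurable_funM; [apply: measurable_indic; exact: measurable_square|exact: measurable_inv_enorm].
Qed.

(** On the dyadic square of radius N / 2^k the function is of order 2^k, while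
the area is of order 4^-k. *)
Lemma inv_enorm_box_lty N : 0 < N ->
  (\int[mu2]_w (inv_enorm_box N w)%:E < +oo)%E.
Proof.
move=> N0.
have p2 k : 0 < (2 : R) ^+ k by rewrite exprn_gt0.
apply: (@shell_integral_lty _ (fun k => 2 ^+ k.+1 / N) (fun k => N / 2 ^+ k) (8 * N) 2^-1).
- exact: measurable_inv_enorm_box.
- by move=> w; exact: inv_enorm_box_ge0.
- by move=> k; rewrite divr_ge0// ltW.
- by move=> k; rewrite divr_ge0// ltW.
- by rewrite invr_gt0 ltr0n/= invf_lt1// ltr1n.
- move=> k; rewrite exprVn le_eqVlt; apply/orP; left; apply/eqP.
  rewrite exprS; have := p2 k; set t := _ ^+ k => t0; field.
  by rewrite !gt_eqF.
- move=> w; rewrite /inv_enorm_box indicE; case: (boolP (w \in _)); last by rewrite mul0r eqxx.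
  rewrite inE /box/= => wN; rewrite mul1r invr_eq0 => w0.
  have w00 : 0 < supn w.
    rewrite lt0r supn_ge0 andbT; apply: contra w0 => /eqP w0.
    have : supn w <= 0 by rewrite w0.
    rewrite ge_max !normr_le0 => /andP[/eqP w1 /eqP w2].
    by rewrite -sqrf_eq0 sqr_enorm w1 w2 expr0n/= addr0.
  have [k wk kw] := dyadic_shell_down w00 wN; exists k => //.
  apply: le_trans kw; rewrite lef_pV2 ?posrE ?supn_le_enorm//.
  exact: lt_le_trans (supn_le_enorm w).
Qed.

Lemma bracket_powR_lty (c : R) : 2 < c ->
  (\int[mu2]_w (bracket w `^ (- c))%:E < +oo)%E.
Proof.
move=> c2; have p2 k : 0 < (2 : R) ^+ k by rewrite exprn_gt0.
apply: (@shell_integral_lty _ (fun k => (2 ^+ k) `^ (- c)) (fun k => 2 ^+ k.+1) 16 (2 `^ (2 - c))).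
- exact: measurable_bracket_powR.
- by move=> x; exact: powR_ge0.
- by move=> x; exact: powR_ge0.
- by move=> x; exact: ltW.
- rewrite powR_gt0//= -opprB powRN invf_lt1 ?powR_gt0//.
  have c20 : 0 < c - 2 by rewrite subr_gt0.
  have := @gt0_ltr_powR _ _ c20 1 2; rewrite powR1; apply; rewrite ?nnegrE//.
  by rewrite ltr1n.
- move=> k; rewrite le_eqVlt; apply/orP; left; apply/eqP.
  have -> : (2 `^ (2 - c)) ^+ k = (2 ^+ k) ^+ 2 * (2 ^+ k) `^ (- c).
    rewrite -powR_mulrn ?powR_ge0// -powRrM mulrC powRrM powR_mulrn//.
    by rewrite powRD ?powR_mulrn ?(ltW (p2 k))// (gt_eqF (p2 k)) implybT.
  by rewrite (exprS 2 k); set t := 2 ^+ k; set u := _ `^ _; ring.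
- move=> w _; have [w1|w1] := leP 1 (supn w); last first.
    exists 0%N; first by rewrite expr1; apply: le_trans (ltW w1) _; rewrite ler1n.
    rewrite expr0 powR1 -[leRHS](powRr0 (bracket w)); apply: ler_powR; first exact: bracket_ge1.
    by lra.
  have [k wk kw] := dyadic_shell_up w1; exists k => //.
  rewrite !powRN lef_pV2 ?posrE ?powR_gt0 ?bracket_gt0//.
  apply: ge0_ler_powR; rewrite ?nnegrE ?(ltW (p2 k)) ?(ltW (bracket_gt0 w))//; first by lra.
  apply: (le_trans kw); apply: (le_trans (supn_le_enorm w)).
  rewrite -(@ler_pXn2r _ 2)// ?nnegrE ?enorm_ge0 ?(ltW (bracket_gt0 w))//.
  by rewrite sqr_enorm sqr_bracket lerDr.
Qed.

End PlaneMeasurability.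

(** * Convolutions of |x|^-1 with weights *)

Section RealNonneg.
Context d (T : measurableType d) (R : realType) (mu : {measure set T -> \bar R}).
Implicit Types f g : T -> R.

Lemma le_integral_real f g :
  measurable_fun setT f -> measurable_fun setT g ->
  (forall t, 0 <= f t) -> (forall t, f t <= g t) ->
  (\int[mu]_t (f t)%:E <= \int[mu]_t (g t)%:E)%E.
Proof.
move=> mf mg f0 fg; apply: ge0_le_integral => //.
- by move=> t _; rewrite lee_fin.
- exact/measurable_EFinP.
- exact/measurable_EFinP.
- by move=> t _; rewrite lee_fin.
Qed.

Lemma integralD_real f g :
  measurable_fun setT f -> measurable_fun setT g ->
  (forall t, 0 <= f t) -> (forall t, 0 <= g t) ->
  (\int[mu]_t (f t + g t)%:E = \int[mu]_t (f t)%:E + \int[mu]_t (g t)%:E)%E.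
Proof.
move=> mf mg f0 g0; under eq_integral do rewrite EFinD.
apply: ge0_integralD => //.
- by move=> t _; rewrite lee_fin.
- exact/measurable_EFinP.
- by move=> t _; rewrite lee_fin.
- exact/measurable_EFinP.
Qed.

Lemma integralZl_real f (k : R) : 0 <= k ->
  measurable_fun setT f -> (forall t, 0 <= f t) ->
  (\int[mu]_t (k * f t)%:E = k%:E * \int[mu]_t (f t)%:E)%E.
Proof.
move=> k0 mf f0; under eq_integral do rewrite EFinM.
apply: ge0_integralZl => //.
- exact/measurable_EFinP.
- by move=> t _; rewrite lee_fin.
Qed.

Lemma ge0_integral_real f :
  (forall t, 0 <= f t) -> (\int[mu]_t (f t)%:E < +oo)%E ->
  exists2 M : R, 0 <= M & (\int[mu]_t (f t)%:E = M%:E)%E.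
Proof.
move=> f0 flt; have i0 : (0 <= \int[mu]_t (f t)%:E)%E.
  by apply: integral_ge0 => t _; rewrite lee_fin.
exists (fine (\int[mu]_t (f t)%:E)); first exact: fine_ge0.
by rewrite fineK// ge0_fin_numE.
Qed.

(** The measurability and sign conditions of the comparison and linearity of
integrals are discharged here once and for all. *)
Lemma integral_le_combination f g1 g2 g3 (k1 k2 k3 M1 M2 M3 : R) :
  0 <= k1 -> 0 <= k2 -> 0 <= k3 ->
  measurable_fun setT f -> measurable_fun setT g1 ->
  measurable_fun setT g2 -> measurable_fun setT g3 ->
  (forall t, 0 <= f t) -> (forall t, 0 <= g1 t) ->
  (forall t, 0 <= g2 t) -> (forall t, 0 <= g3 t) ->
  (forall t, f t <= k1 * g1 t + (k2 * g2 t + k3 * g3 t)) ->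
  (\int[mu]_t (g1 t)%:E <= M1%:E)%E -> (\int[mu]_t (g2 t)%:E <= M2%:E)%E ->
  (\int[mu]_t (g3 t)%:E <= M3%:E)%E ->
  (\int[mu]_t (f t)%:E <= (k1 * M1 + (k2 * M2 + k3 * M3))%:E)%E.
Proof.
move=> k10 k20 k30 mf m1 m2 m3 f0 g10 g20 g30 fg I1 I2 I3.
have mk k g : measurable_fun setT g -> measurable_fun setT (fun t => k * g t).
  by move=> mg; exact: measurable_funM.
apply: le_trans (le_integral_real mf _ f0 fg) _.
  by apply: measurable_funD; [|apply: measurable_funD]; exact: mk.
rewrite integralD_real; last 4 first.
- exact: mk.
- by apply: measurable_funD; exact: mk.
- by move=> t; rewrite mulr_ge0.
- by move=> t; rewrite addr_ge0// mulr_ge0.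
rewrite integralD_real; last 4 first.
- exact: mk.
- exact: mk.
- by move=> t; rewrite mulr_ge0.
- by move=> t; rewrite mulr_ge0.
rewrite (EFinD (k1 * M1)) (EFinD (k2 * M2)) !integralZl_real//.
by rewrite (EFinM k1) (EFinM k2) (EFinM k3) !leeD// lee_wpmul2l// lee_fin.
Qed.

End RealNonneg.

Section Potentials.
Context {R : realType}.
Implicit Types (x y w : plane R).
Local Notation mu2 := (@plane_measure R).

(** Replacing the larger of [p] and [q] by the smaller one increases the
product. *)
Lemma powRN_mul_le (p q a b : R) : 1 <= p -> 1 <= q -> 0 <= a -> 0 <= b ->
  p `^ (- a) * q `^ (- b) <= p `^ (- (a + b)) + q `^ (- (a + b)).
Proof.
have wlg (u v c d : R) : 1 <= u -> u <= v -> 0 <= c -> 0 <= d ->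
    u `^ (- c) * v `^ (- d) <= u `^ (- (c + d)).
  move=> u1 uv c0 d0; have u0 : 0 < u by exact: lt_le_trans u1.
  have v0 : 0 < v by exact: lt_le_trans uv.
  rewrite opprD powRD ?(gt_eqF u0) ?implybT// ler_wpM2l ?powR_ge0//.
  rewrite !powRN lef_pV2 ?posrE ?powR_gt0//.
  by apply: ge0_ler_powR => //; rewrite nnegrE; exact: ltW.
move=> p1 q1 a0 b0; have [pq|qp] := leP p q.
  by apply: (le_trans (wlg _ _ _ _ p1 pq a0 b0)); rewrite lerDl powR_ge0.
rewrite mulrC addrC addrC; apply: (le_trans (wlg _ _ _ _ q1 (ltW qp) b0 a0)).
by rewrite addrC [b + a]addrC lerDl powR_ge0.
Qed.

Lemma enormN x : enorm (- x) = enorm x.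
Proof. by rewrite /enorm /= !sqrrN. Qed.

Lemma enormB x y : enorm (x - y) = enorm (y - x).
Proof. by rewrite -enormN opprB. Qed.

Lemma bracketN x : bracket (- x) = bracket x.
Proof. by rewrite /bracket enormN. Qed.

Lemma bracketD x y : bracket (x + y) <= bracket x + bracket y.
Proof.
have xy : x.1 * y.1 + x.2 * y.2 <= bracket x * bracket y.
  have [n0|p0] := leP (x.1 * y.1 + x.2 * y.2) 0.
    by rewrite (le_trans n0)// mulr_ge0// ltW// bracket_gt0.
  rewrite -(@ler_pXn2r _ 2)// ?nnegrE; last 2 first.
  - exact: ltW.
  - by rewrite mulr_ge0// ltW// bracket_gt0.
  rewrite exprMn !sqr_bracket -subr_ge0.
  set A := x.1; set B := x.2; set C := y.1; set D := y.2.
  rewrite (_ : _ - _ = 1 + A ^+ 2 + B ^+ 2 + C ^+ 2 + D ^+ 2 + (A * D - B * C) ^+ 2); last by ring.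
  by rewrite !addr_ge0// sqr_ge0.
rewrite -(@ler_pXn2r _ 2)// ?nnegrE ?addr_ge0 ?(ltW (bracket_gt0 _))//.
rewrite sqrrD !sqr_bracket /=.
move: xy; set A := x.1; set B := x.2; set C := y.1; set D := y.2.
set u := bracket x; set v := bracket y => xy.
rewrite -subr_ge0 (_ : _ - _ = 1 + 2 * (u * v - (A * C + B * D))); last by rewrite -mulr_natl; ring.
by rewrite addr_ge0// mulr_ge0// subr_ge0.
Qed.

Lemma inv_enorm_far w : 1 < supn w -> (enorm w)^-1 <= 2 * bracket w `^ (- 1).
Proof.
move=> w1; have e1 : 1 < enorm w by exact: lt_le_trans (supn_le_enorm w).
have e0 : 0 < enorm w by exact: lt_trans e1.
rewrite powR_inv1 ?(ltW (bracket_gt0 w))// ler_pdivlMr ?bracket_gt0// mulrC.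
rewrite ler_pdivrMr// -(@ler_pXn2r _ 2)// ?nnegrE ?mulr_ge0// ?(ltW e0) ?(ltW (bracket_gt0 _))//.
rewrite exprMn sqr_bracket -sqr_enorm.
have : 1 <= enorm w ^+ 2 by rewrite -(expr1n _ 2) lerXn2r// ?nnegrE ltW.
by set t := _ ^+ 2 => t1; lra.
Qed.

(** Separates the integrable singularity of |w|^-1 from its decay. *)
Lemma inv_enorm_split w :
  (enorm w)^-1 <= inv_enorm_box 1 w + 2 * bracket w `^ (- 1).
Proof.
rewrite /inv_enorm_box indicE; have [w1|w1] := leP (supn w) 1.
  by rewrite mem_set//= mul1r lerDl mulr_ge0// powR_ge0.
by rewrite memNset ?mul0r ?add0r ?inv_enorm_far//= /box/= leNgt w1.
Qed.

Lemma ge0_integral_planeB x (f : plane R -> R) :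
  measurable_fun setT f -> (forall y, 0 <= f y) ->
  (\int[mu2]_y (f (y - x))%:E = \int[mu2]_y (f y)%:E)%E.
Proof.
move=> mf f0; apply: (@ge0_integral_translation _ (- x) (fun y => (f y)%:E)).
- exact/measurable_EFinP.
- by move=> y; rewrite lee_fin.
Qed.

Lemma measurable_planeB x (f : plane R -> R) : measurable_fun setT f ->
  measurable_fun setT (fun y : plane R => f (y - x)).
Proof. by move=> mf; exact: measurableT_comp mf (measurable_plane_subl x). Qed.

Lemma bracket_powRN_le1 x a : 0 <= a -> bracket x `^ (- a) <= 1.
Proof.
by move=> a0; rewrite -(powRr0 (bracket x)); apply: ler_powR; rewrite ?bracket_ge1// oppr_le0.
Qed.

(** Away from the singularity the integrand is a product of weights in y - x and
in y of total order 1 + a > 2; by [powRN_mul_le] it is at most the sum of two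
integrable weights, whose integrals do not depend on x. *)
Lemma potential_bounded (a : R) : 1 < a -> exists2 C : R, 0 <= C & forall x,
  (\int[mu2]_y ((enorm (y - x))^-1 * bracket y `^ (- a))%:E <= C%:E)%E.
Proof.
move=> a1; have a2 : 2 < 1 + a by lra.
have [M1 M10 M1E] := ge0_integral_real (fun w => inv_enorm_box_ge0 1 w) (inv_enorm_box_lty ltr01).
have [M2 M20 M2E] := ge0_integral_real (fun w => powR_ge0 (bracket w) _) (bracket_powR_lty a2).
exists (M1 + 2 * (M2 + M2)) => [|x]; first by rewrite !(addr_ge0, mulr_ge0).
have mb := @measurable_inv_enorm_box R 1.
have mr := @measurable_bracket_powR R (- (1 + a)).
have mbx := measurable_planeB x mb.
have mrx := measurable_planeB x mr.
have b0 y := inv_enorm_box_ge0 1 y.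
have r0 y c := powR_ge0 (bracket y) c.
rewrite -[M1]mul1r mulrDr.
apply: (@integral_le_combination _ _ _ mu2 _ (fun y => inv_enorm_box 1 (y - x))
  (fun y => bracket (y - x) `^ (- (1 + a))) (fun y => bracket y `^ (- (1 + a)))).
- exact: ler01.
- exact: ler0n.
- exact: ler0n.
- apply: measurable_funM; last exact: measurable_bracket_powR.
  exact: measurable_planeB (@measurable_inv_enorm R).
- exact: mbx.
- exact: mrx.
- exact: mr.
- by move=> y; rewrite mulr_ge0// invr_ge0 enorm_ge0.
- by move=> y; exact: b0.
- by move=> y; exact: r0.
- by move=> y; exact: r0.
- move=> y; rewrite mul1r -mulrDr.
  apply: (le_trans (ler_wpM2r (r0 y _) (inv_enorm_split (y - x)))).
  rewrite mulrDl lerD//; first by rewrite ler_piMr// bracket_powRN_le1//; lra.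
  by rewrite -mulrA ler_wpM2l//; apply: powRN_mul_le; rewrite ?bracket_ge1//; lra.
- by rewrite -M1E le_eqVlt; apply/orP; left; apply/eqP; exact: ge0_integral_planeB.
- rewrite -M2E le_eqVlt; apply/orP; left; apply/eqP.
  exact: (ge0_integral_planeB x mr).
- by rewrite -M2E.
Qed.

Local Opaque powR enorm.

(** By the triangle inequality the factor <y>^s is at most of the order of
<x>^s + <x - y>^s.  The first term leaves the integrand of [potential_bounded]
with exponent 2 - s > 1; in the second one the weights have total order
3 - s > 2 away from the singularity. *)
Lemma potential_decay (s : R) : 0 < s < 1 -> exists2 C : R, 0 <= C & forall y,
  (\int[mu2]_x (bracket y `^ s * (bracket x `^ (- 2) * (enorm (x - y))^-1))%:E <= C%:E)%E.
Proof.
move=> /andP[s0 s1]; have a1 : 1 < 2 - s by lra.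
have a2 : 2 < 3 - s by lra.
have s3 : 2 + (1 - s) = 3 - s by ring.
have [M0 M00 M0E] := potential_bounded a1.
have [M1 M10 M1E] := ge0_integral_real (fun w => inv_enorm_box_ge0 1 w) (inv_enorm_box_lty ltr01).
have [M2 M20 M2E] := ge0_integral_real (fun w => powR_ge0 (bracket w) _) (bracket_powR_lty a2).
exists (2 * M0 + (4 * M1 + 4 * (M2 + M2))) => [|y]; first by rewrite !(addr_ge0, mulr_ge0).
have mb := @measurable_inv_enorm_box R 1.
have mr c := @measurable_bracket_powR R c.
have mby := measurable_planeB y mb.
have mry c := measurable_planeB y (mr c).
have mi := measurable_planeB y (@measurable_inv_enorm R).
have b0 x := inv_enorm_box_ge0 1 x.
have r0 x c := powR_ge0 (bracket x) c.
have i0 x : 0 <= (enorm x)^-1 by rewrite invr_ge0 enorm_ge0.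
pose f1 (x : plane R) := (enorm (x - y))^-1 * bracket x `^ (- (2 - s)).
pose f3 (x : plane R) := bracket x `^ (- (3 - s)) + bracket (x - y) `^ (- (3 - s)).
have mf1 : measurable_fun setT f1 by exact: measurable_funM.
have mf3 : measurable_fun setT f3 by exact: measurable_funD.
have f10 x : 0 <= f1 x by rewrite mulr_ge0.
have f30 x : 0 <= f3 x by rewrite addr_ge0.
apply: (@integral_le_combination _ _ _ mu2 _ f1
  (fun x => inv_enorm_box 1 (x - y)) f3).
- by [].
- by [].
- by [].
- by do 2 apply: measurable_funM => //.
- exact: mf1.
- exact: mby.
- exact: mf3.
- by move=> x; rewrite !mulr_ge0.
- exact: f10.
- by move=> x; exact: b0.
- exact: f30.
- move=> x; pose w := x - y.
  have tri : bracket y `^ s <= 2 * (bracket x `^ s + bracket w `^ s).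
    apply: (@le_trans _ _ ((2 * Num.max (bracket x) (bracket w)) `^ s)).
      apply: ge0_ler_powR; rewrite ?nnegrE ?(ltW s0) ?(ltW (bracket_gt0 y))//.
        by rewrite mulr_ge0// le_max (ltW (bracket_gt0 x)).
      have -> : y = x - w by rewrite /w opprB addrC subrK.
      apply: (le_trans (bracketD _ _)); rewrite bracketN mulrDl !mul1r.
      by rewrite lerD// le_max lexx ?orbT.
    rewrite powRM//; last by rewrite le_max (ltW (bracket_gt0 x)).
    have p2 : 2 `^ s <= (2 : R) by rewrite -[leRHS]powRr1//; apply: ler_powR => //; [rewrite ler1n | exact: ltW].
    apply: ler_pM => //; rewrite ?powR_ge0//.
    by case: (leP (bracket x) (bracket w)) => _; [apply: ler_wpDl|apply: ler_wpDr].
  have p0 : 0 <= bracket x `^ (- 2) * (enorm w)^-1 by rewrite mulr_ge0.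
  apply: (le_trans (ler_wpM2r p0 tri)).
  have splitE (u v p : R) : 2 * (u + v) * p = 2 * (u * p) + 2 * (v * p) by ring.
  rewrite splitE.
  have bx0 := bracket_gt0 x; have bw0 := bracket_gt0 w.
  apply: lerD.
    have bxE : bracket x `^ (- (2 - s)) = bracket x `^ s * bracket x `^ (- 2).
    by rewrite opprB addrC [LHS]powRD 1?mulrC// (gt_eqF bx0) implybT.
  have -> : f1 x = bracket x `^ s * (bracket x `^ (- 2) / enorm w).
    by rewrite /f1 bxE mulrC mulrA.
  exact: lexx.
  rewrite [X in _ <= X](_ : _ = 2 * (2 * (inv_enorm_box 1 w + f3 x))); last first.
    by rewrite /w; ring.
  rewrite ler_wpM2l//.
  have [w1|w1] := leP (supn w) 1.
    rewrite mulrDr; apply: ler_wpDr; first by apply: mulr_ge0; [exact: ler0n|exact: f30].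
    have -> : inv_enorm_box 1 w = (enorm w)^-1 by rewrite /inv_enorm_box indicE mem_set ?mul1r.
    rewrite mulrA ler_wpM2r//.
    apply: (@le_trans _ _ (bracket w `^ s)); first by rewrite ler_piMr// bracket_powRN_le1.
    apply: (le_trans (ler1_powR (bracket_ge1 w) (ltW s1))).
    rewrite -(@ler_pXn2r _ 2)// ?nnegrE ?(ltW bw0)// sqr_bracket.
    have sq1 (t : R) : `|t| <= 1 -> t ^+ 2 <= 1.
      by move=> t1; rewrite -real_normK ?num_real// exprn_ile1.
    move: w1; rewrite ge_max => /andP[/sq1 A1 /sq1 B1].
    apply: (le_trans (lerD (lexx 1) (lerD A1 B1))).
    by rewrite -natrX -[X in X + _]/(1%:R) -[X in _ + (X + _)]/(1%:R) -[X in _ + (_ + X)]/(1%:R) -!natrD ler_nat.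
  apply: (@le_trans _ _ (2 * f3 x)); last by rewrite ler_wpM2l// lerDr.
  apply: (@le_trans _ _ (bracket w `^ s * (bracket x `^ (- 2) * (2 * bracket w `^ (- 1))))).
    by rewrite !ler_wpM2l// inv_enorm_far.
  have bwE : bracket w `^ (- (1 - s)) = bracket w `^ s * bracket w `^ (- 1).
    by rewrite opprB [LHS]powRD// (gt_eqF bw0) implybT.
  have s10 : 0 <= 1 - s by rewrite subr_ge0 ltW.
  have := powRN_mul_le (bracket_ge1 x) (bracket_ge1 w) (ler0n R 2) s10.
  rewrite s3 => le3; rewrite [leLHS](_ : _ = 2 * (bracket x `^ (- 2) * bracket w `^ (- (1 - s)))).
    by apply: ler_wpM2l.
  by rewrite bwE; move: (bracket x `^ _) (bracket w `^ s) (bracket w `^ _) => u v t; ring.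
- exact: M0E.
- rewrite -M1E le_eqVlt; apply/orP; left; apply/eqP; exact: ge0_integral_planeB.
- have -> : (\int[mu2]_x (f3 x)%:E =
      \int[mu2]_x (bracket x `^ (- (3 - s)))%:E +
      \int[mu2]_x (bracket (x - y) `^ (- (3 - s)))%:E)%E.
    exact: integralD_real.
  rewrite (EFinD M2); apply: leeD; first by rewrite M2E.
  rewrite -M2E le_eqVlt; apply/orP; left; apply/eqP.
  exact: (ge0_integral_planeB y (mr _)).
Qed.

End Potentials.

(** * A weighted Schur test *)

Section WeightedSchur.
Context {R : realType}.
Local Notation mu2 := (@plane_measure R).

(** The Cauchy-Schwarz inequality in the form of a family of inequalities
between means, which makes sense for infinite integrals; it is optimal for
t = X / A. *)
Lemma sqr_le_of_amgm (X Y : \bar R) (A : R) : (0 <= X)%E -> (0 <= Y)%E -> 0 < A ->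
  (forall t : R, 0 < t -> (2%:E * X <= t%:E * A%:E + t^-1%:E * Y)%E) ->
  (X * X <= A%:E * Y)%E.
Proof.
move=> X0 Y0 A0 H; case: Y Y0 H => [y| |] // y0 H; last by rewrite gt0_muley ?leey.
case: X X0 H => [x| |] // x0 H; last by have := H 1 ltr01; rewrite gt0_muley.
rewrite -!EFinM lee_fin; move: x0 y0; rewrite !lee_fin => x0 y0.
have {}H t : 0 < t -> 2 * x <= t * A + t^-1 * y.
  by move=> /H; rewrite -!EFinM -EFinD lee_fin.
have [->|xn0] := eqVneq x 0; first by rewrite mul0r mulr_ge0// ltW.
have xp : 0 < x by rewrite lt0r xn0.
have := H _ (divr_gt0 xp A0).
rewrite divfK ?gt_eqF// invf_div mulr_natl mulr2n lerD2l mulrAC ler_pdivlMr//.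
Qed.

Variables (k : plane R * plane R -> R) (w q p : plane R -> R) (A1 A2 : R).
Hypotheses (mk : measurable_fun setT k) (k0 : forall z, 0 <= k z).
Hypotheses (mw : measurable_fun setT w) (w0 : forall y, 0 < w y).
Hypotheses (mq : measurable_fun setT q) (q0 : forall y, 0 <= q y).
Hypotheses (mp : measurable_fun setT p) (p0 : forall x, 0 < p x).
Hypothesis A10 : 0 < A1.
Hypothesis A20 : 0 <= A2.
Hypothesis rowsum : forall x,
  (\int[mu2]_y (k (x, y) * (w y)^-1)%:E <= A1%:E)%E.
Hypothesis colsum : forall y,
  (\int[mu2]_x (p x ^+ 2 * k (x, y) * (q y ^+ 2 * w y))%:E <= A2%:E)%E.
Variable phi : plane R -> R.
Hypotheses (mphi : measurable_fun setT phi) (phi0 : forall y, 0 <= phi y).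
Hypothesis phi2 : (\int[mu2]_y (phi y ^+ 2)%:E < +oo)%E.

Let X x := (\int[mu2]_y (k (x, y) * (q y * phi y))%:E)%E.

Let X0 x : (0 <= X x)%E.
Proof. by apply: integral_ge0 => y _; rewrite lee_fin !mulr_ge0. Qed.

Let m1 (f : plane R -> R) : measurable_fun setT f ->
  measurable_fun setT (fun z : plane R * plane R => f z.1).
Proof. by move=> mf; exact: measurableT_comp mf measurable_fst. Qed.

Let m2 (f : plane R -> R) : measurable_fun setT f ->
  measurable_fun setT (fun z : plane R * plane R => f z.2).
Proof. by move=> mf; exact: measurableT_comp mf measurable_snd. Qed.

Let mkx x : measurable_fun setT (fun y => k (x, y)).
Proof. exact: measurableT_comp mk (pair1_measurable x). Qed.

Let mky y : measurable_fun setT (fun x => k (x, y)).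
Proof. exact: measurableT_comp mk (pair2_measurable y). Qed.

Let mX : measurable_fun setT X.
Proof.
apply: (measurable_plane_tonelli1 (f := fun z => (k z * (q z.2 * phi z.2))%:E)).
  apply/measurable_EFinP; apply: measurable_funM => //.
  by apply: measurable_funM; exact: m2.
by move=> z; rewrite lee_fin !mulr_ge0.
Qed.

Let Y x := (\int[mu2]_y (k (x, y) * (q y ^+ 2 * w y * phi y ^+ 2))%:E)%E.

Let Y0 x : (0 <= Y x)%E.
Proof.
by apply: integral_ge0 => y _; rewrite lee_fin !mulr_ge0// ?sqr_ge0// ltW.
Qed.

Let mY : measurable_fun setT Y.
Proof.
apply: (measurable_plane_tonelli1 (f := fun z => (k z * (q z.2 ^+ 2 * w z.2 * phi z.2 ^+ 2))%:E)).
  apply/measurable_EFinP; apply: measurable_funM => //.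
  apply: (m2 (f := fun y => q y ^+ 2 * w y * phi y ^+ 2)).
  by do 2 apply: measurable_funM => //; exact: measurable_funX.
by move=> z; rewrite lee_fin !mulr_ge0// ?sqr_ge0// ltW.
Qed.

Let minv : measurable_fun setT (fun y => (w y)^-1).
Proof. by apply: measurable_inv_ge0 => // y; exact: ltW. Qed.

Let winv0 y : 0 <= (w y)^-1. Proof. by rewrite invr_ge0 ltW. Qed.

(** Cauchy-Schwarz: the integrand of [X x] is the geometric mean of [k / w] and
of the integrand of [Y x]. *)
Let XY x : (X x * X x <= A1%:E * Y x)%E.
Proof.
apply: sqr_le_of_amgm => // t t0.
have mkq : measurable_fun setT (fun y => k (x, y) * (q y * phi y)).
  by do 2 apply: measurable_funM => //.
have mkw : measurable_fun setT (fun y => k (x, y) * (w y)^-1) by exact: measurable_funM.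
have mkq2 : measurable_fun setT (fun y => k (x, y) * (q y ^+ 2 * w y * phi y ^+ 2)).
  by do 3 apply: measurable_funM => //; exact: measurable_funX.
have kq0 y : 0 <= k (x, y) * (q y * phi y) by rewrite !mulr_ge0.
have kw0 y : 0 <= k (x, y) * (w y)^-1 by rewrite !mulr_ge0.
have kq20 y : 0 <= k (x, y) * (q y ^+ 2 * w y * phi y ^+ 2).
  by rewrite !mulr_ge0// ?sqr_ge0// ltW.
have ti0 : 0 < t^-1 by rewrite invr_gt0.
rewrite -integralZl_real//.
apply: (@le_trans _ _ (\int[mu2]_y (t * (k (x, y) * (w y)^-1) +
    t^-1 * (k (x, y) * (q y ^+ 2 * w y * phi y ^+ 2)))%:E)%E).
  apply: le_integral_real.
  - exact: measurable_funM.
  - by apply: measurable_funD; exact: measurable_funM.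
  - by move=> y; rewrite mulr_ge0.
  - move=> y; have wy := w0 y; have := k0 (x, y); set K := k _ => K0.
    rewrite -subr_ge0.
    rewrite (_ : _ - _ = K * (t^-1 * (w y)^-1) * (t - w y * q y * phi y) ^+ 2); last first.
      by field; rewrite !gt_eqF.
    apply: mulr_ge0; last exact: sqr_ge0.
    by rewrite !mulr_ge0// ltW.
rewrite integralD_real//; last 4 first.
- exact: measurable_funM.
- exact: measurable_funM.
- by move=> y; rewrite mulr_ge0// ltW.
- by move=> y; rewrite mulr_ge0// ltW.
rewrite !integralZl_real//; [|exact: ltW|exact: ltW].
by apply: leeD => //; rewrite lee_wpmul2l// lee_fin ltW.
Qed.

(** Tonelli: the column sums bound the integral over [x] for fixed [y]. *)
Let pXX_le : (\int[mu2]_x ((p x ^+ 2)%:E * (X x * X x)) <=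
  (A1 * A2)%:E * \int[mu2]_y (phi y ^+ 2)%:E)%E.
Proof.
have mp2 : measurable_fun setT (fun x => (p x ^+ 2)%:E).
  by apply/measurable_EFinP; exact: measurable_funX.
apply: (@le_trans _ _ (\int[mu2]_x (A1%:E * ((p x ^+ 2)%:E * Y x)))%E).
  apply: ge0_le_integral => //.
  - by move=> x _; rewrite mule_ge0// ?lee_fin ?sqr_ge0// mule_ge0.
  - by do 2 apply: emeasurable_funM => //.
  - by apply: emeasurable_funM => //; exact: emeasurable_funM.
  - by move=> x _; rewrite [leRHS]muleCA lee_wpmul2l// lee_fin sqr_ge0.
rewrite ge0_integralZl//; last 3 first.
- exact: emeasurable_funM.
- by move=> x _; rewrite mule_ge0// lee_fin sqr_ge0.
- by rewrite lee_fin ltW.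
rewrite EFinM -muleA lee_wpmul2l ?lee_fin ?(ltW A10)//.
pose F (z : plane R * plane R) := p z.1 ^+ 2 * (k z * (q z.2 ^+ 2 * w z.2 * phi z.2 ^+ 2)).
have mF : measurable_fun setT F.
  apply: measurable_funM; first by apply: (m1 (f := fun x => p x ^+ 2)); exact: measurable_funX.
  apply: measurable_funM => //.
  apply: (m2 (f := fun y => q y ^+ 2 * w y * phi y ^+ 2)).
  by do 2 apply: measurable_funM => //; exact: measurable_funX.
have F0 z : 0 <= F z by rewrite !mulr_ge0// ?sqr_ge0// ltW.
rewrite [leLHS](_ : _ = (\int[mu2]_x \int[mu2]_y (F (x, y))%:E)%E); last first.
  apply: eq_integral => x _; rewrite /F /Y /=; apply/esym; apply: integralZl_real.
  - exact: sqr_ge0.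
  - by do 3 apply: measurable_funM => //; exact: measurable_funX.
  - by move=> y; rewrite !mulr_ge0// ?sqr_ge0// ltW.
rewrite (plane_tonelli (f := EFin \o F)) => [||z]; last 2 first.
- exact/measurable_EFinP.
- by rewrite lee_fin.
have mphi2 : measurable_fun setT (fun y => phi y ^+ 2) by exact: measurable_funX.
rewrite -integralZl_real//; last by move=> y; rewrite sqr_ge0.
apply: ge0_le_integral => //.
- by move=> y _; apply: integral_ge0 => x _; rewrite lee_fin.
- apply: (measurable_plane_tonelli2 (f := EFin \o F)) => [|z]; first exact/measurable_EFinP.
  by rewrite lee_fin.
- by apply/measurable_EFinP; exact: measurable_funM.
move=> y _; rewrite /= [leLHS](_ : _ =
    (\int[mu2]_x (phi y ^+ 2 * (p x ^+ 2 * k (x, y) * (q y ^+ 2 * w y)))%:E)%E); last first.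
  by apply: eq_integral => x _; rewrite /F /=; congr (_%:E); ring.
rewrite integralZl_real ?sqr_ge0//.
- by rewrite (mulrC A2) (EFinM (phi y ^+ 2)) lee_wpmul2l ?lee_fin ?sqr_ge0.
- by do 2 apply: measurable_funM => //; exact: measurable_funX.
- by move=> x; rewrite !mulr_ge0// ?sqr_ge0// ltW.
Qed.

Lemma schur_ae_finite : {ae mu2, forall x,
  (\int[mu2]_y (k (x, y) * (q y * phi y))%:E < +oo)%E}.
Proof.
have mpX : measurable_fun setT (fun x => (p x ^+ 2)%:E * (X x * X x))%E.
  apply: emeasurable_funM; last exact: emeasurable_funM.
  by apply/measurable_EFinP; exact: measurable_funX.
have pX0 x : (0 <= (p x ^+ 2)%:E * (X x * X x))%E.
  by rewrite mule_ge0// ?lee_fin ?sqr_ge0// mule_ge0.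
have : mu2.-integrable setT (fun x => (p x ^+ 2)%:E * (X x * X x))%E.
  apply/integrableP; split => //; under eq_integral do rewrite gee0_abs//.
  apply: (le_lt_trans pXX_le); rewrite lte_mul_pinfty// lee_fin mulr_ge0// ltW//.
move=> /integrable_ae => /(_ measurableT); apply: filterS => x /(_ I).
rewrite -/(X x) ge0_fin_numE//; case: (X x) (X0 x) => [r| |]// _; first by move=> _; exact: ltry.
by rewrite mulyy gt0_muley// lte_fin exprn_gt0.
Qed.

(** The boundedness on L^2 of the operator with kernel [p x * k (x, y) * q y].
The weight [w] distributes the kernel between the row and the column sums. *)
Lemma schur_bound :
  (\int[mu2]_x ((p x * \int[mu2]_y (k (x, y) * (q y * phi y))) ^+ 2)%:E <=
   (A1 * A2)%:E * \int[mu2]_y (phi y ^+ 2)%:E)%E.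
Proof.
apply: le_trans pXX_le; apply: ge0_le_integral => //.
- by move=> x _; rewrite lee_fin sqr_ge0.
- apply/measurable_EFinP; apply: measurable_funX; apply: measurable_funM => //.
  exact: measurableT_comp (fine_measurable measurableT) mX.
- apply: emeasurable_funM; last exact: emeasurable_funM.
  by apply/measurable_EFinP; exact: measurable_funX.
move=> x _; rewrite exprMn EFinM lee_wpmul2l ?lee_fin ?sqr_ge0//.
rewrite /Rintegral -/(X x); case: (X x) (X0 x) => [r| |]// _.
by rewrite gt0_muley// leey.
Qed.

(** From [schur_bound], as [psi * (p * X) <= psi ^+ 2 + (p * X) ^+ 2]. *)
Lemma schur_bilinear (psi : plane R -> R) :
  measurable_fun setT psi -> (forall x, 0 <= psi x) ->
  (\int[mu2]_x (psi x ^+ 2)%:E < +oo)%E ->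
  (\int[mu2]_x \int[mu2]_y
     (psi x * (p x * (k (x, y) * (q y * phi y))))%:E < +oo)%E.
Proof.
move=> mpsi psi0 psi2.
have mpsi2 : measurable_fun setT (fun x => psi x ^+ 2) by exact: measurable_funX.
have mpX : measurable_fun setT (fun x => (p x ^+ 2)%:E * (X x * X x))%E.
  apply: emeasurable_funM; last exact: emeasurable_funM.
  by apply/measurable_EFinP; exact: measurable_funX.
have pX0 x : (0 <= (p x ^+ 2)%:E * (X x * X x))%E.
  by rewrite mule_ge0// ?lee_fin ?sqr_ge0// mule_ge0.
apply: (@le_lt_trans _ _ (\int[mu2]_x ((psi x ^+ 2)%:E + (p x ^+ 2)%:E * (X x * X x)))%E).
  rewrite [leLHS](_ : _ = (\int[mu2]_x ((psi x * p x)%:E * X x))%E); last first.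
    apply: eq_integral => x _; rewrite /X -integralZl_real//.
    - by apply: eq_integral => y _; rewrite mulrA.
    - by rewrite mulr_ge0// ltW.
    - by do 2 apply: measurable_funM => //.
    - by move=> y; rewrite !mulr_ge0.
  apply: ge0_le_integral => //.
  - by move=> x _; rewrite mule_ge0// lee_fin mulr_ge0// ltW.
  - by apply: emeasurable_funM => //; apply/measurable_EFinP; exact: measurable_funM.
  - by apply: emeasurable_funD => //; exact/measurable_EFinP.
  move=> x _; case: (X x) (X0 x) => [r| |]// => [r0|_]; last first.
    have -> : ((p x ^+ 2)%:E * (+oo * +oo) = +oo)%E.
      by rewrite mulyy gt0_muley// lte_fin exprn_gt0.
    by rewrite addey// leey.
  rewrite -!EFinM -EFinD lee_fin -subr_ge0.
  have a0 := psi0 x; have b0 := ltW (p0 x); rewrite lee_fin in r0.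
  rewrite (_ : _ - _ = (psi x - p x * r) ^+ 2 + psi x * p x * r); last by ring.
  by rewrite addr_ge0 ?sqr_ge0// !mulr_ge0.
rewrite ge0_integralD//; last 2 first.
- by move=> x _; rewrite lee_fin sqr_ge0.
- exact/measurable_EFinP.
rewrite lte_add_pinfty//; apply: (le_lt_trans pXX_le).
by apply: lte_mul_pinfty => //; rewrite lee_fin mulr_ge0// (ltW A10).
Qed.

End WeightedSchur.

Local Open Scope complex_scope.
Local Open Scope sesquilinear_scope.

(** * Complex integrals *)

Section ComplexMeasurable.
Context d (T : measurableType d) (R : realType).
Local Notation C := R[i].
Implicit Types f g : T -> C.

(** Measurability is needed on the plane and on its square, hence on an
arbitrary measurable space. *)
Definition cmeas f : Prop :=
  measurable_fun setT (fun x => complex.Re (f x)) /\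
  measurable_fun setT (fun x => complex.Im (f x)).

Definition mxmeas m n (A : T -> 'M[C]_(m, n)) : Prop :=
  forall i j, cmeas (fun x => A x i j).

Lemma cReD (a b : C) : complex.Re (a + b) = complex.Re a + complex.Re b.
Proof. by case: a; case: b. Qed.
Lemma cImD (a b : C) : complex.Im (a + b) = complex.Im a + complex.Im b.
Proof. by case: a; case: b. Qed.
Lemma cReM (a b : C) : complex.Re (a * b) =
  complex.Re a * complex.Re b - complex.Im a * complex.Im b.
Proof. by case: a; case: b. Qed.
Lemma cImM (a b : C) : complex.Im (a * b) =
  complex.Re a * complex.Im b + complex.Im a * complex.Re b.
Proof. by case: a => a a'; case: b => b b'. Qed.
Lemma cReN (a : C) : complex.Re (- a) = - complex.Re a. Proof. by case: a. Qed.
Lemma cImN (a : C) : complex.Im (- a) = - complex.Im a. Proof. by case: a. Qed.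
Lemma cReJ (a : C) : complex.Re (Num.conj a) = complex.Re a. Proof. by case: a. Qed.
Lemma cImJ (a : C) : complex.Im (Num.conj a) = - complex.Im a. Proof. by case: a. Qed.

Lemma complex_eq (a b : C) : complex.Re a = complex.Re b -> complex.Im a = complex.Im b -> a = b.
Proof. by case: a; case: b => ? ? ? ? /= -> ->. Qed.

Lemma cmeas_cst c : cmeas (fun=> c).
Proof. by split. Qed.

Lemma cmeas_real (r : T -> R) : measurable_fun setT r -> cmeas (fun x => (r x)%:C).
Proof. by move=> mr; split => //=. Qed.

Lemma cmeasD f g : cmeas f -> cmeas g -> cmeas (fun x => f x + g x).
Proof.
move=> [f1 f2] [g1 g2]; split.
- by under eq_fun do rewrite cReD; exact: measurable_funD.
- by under eq_fun do rewrite cImD; exact: measurable_funD.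
Qed.

Lemma cmeasM f g : cmeas f -> cmeas g -> cmeas (fun x => f x * g x).
Proof.
move=> [f1 f2] [g1 g2]; split.
- by under eq_fun do rewrite cReM; apply: measurable_funB; exact: measurable_funM.
- by under eq_fun do rewrite cImM; apply: measurable_funD; exact: measurable_funM.
Qed.

Lemma cmeasN f : cmeas f -> cmeas (fun x => - f x).
Proof.
move=> [f1 f2]; split.
- by under eq_fun do rewrite cReN; exact: measurable_funN.
- by under eq_fun do rewrite cImN; exact: measurable_funN.
Qed.

Lemma cmeas_conj f : cmeas f -> cmeas (fun x => Num.conj (f x)).
Proof.
move=> [f1 f2]; split.
- by under eq_fun do rewrite cReJ.
- by under eq_fun do rewrite cImJ; exact: measurable_funN.
Qed.

Lemma cmeas_sum (I : Type) (s : seq I) (F : I -> T -> C) :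
  (forall i, cmeas (F i)) -> cmeas (fun x => \sum_(i <- s) F i x).
Proof.
move=> mF; elim: s => [|i s IH].
  by under eq_fun do rewrite big_nil; exact: cmeas_cst.
by under eq_fun do rewrite big_cons; exact: cmeasD.
Qed.

Lemma mxmeas_cst m n (A : 'M[C]_(m, n)) : mxmeas (fun=> A).
Proof. by move=> i j; exact: cmeas_cst. Qed.

Lemma mxmeasD m n (A B : T -> 'M[C]_(m, n)) :
  mxmeas A -> mxmeas B -> mxmeas (fun x => A x + B x).
Proof. by move=> mA mB i j; under eq_fun do rewrite mxE; exact: cmeasD. Qed.

Lemma mxmeasN m n (A : T -> 'M[C]_(m, n)) : mxmeas A -> mxmeas (fun x => - A x).
Proof. by move=> mA i j; under eq_fun do rewrite mxE; exact: cmeasN. Qed.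

Lemma mxmeasM m n p (A : T -> 'M[C]_(m, n)) (B : T -> 'M[C]_(n, p)) :
  mxmeas A -> mxmeas B -> mxmeas (fun x => A x *m B x).
Proof.
move=> mA mB i j; under eq_fun do rewrite mxE.
by apply: cmeas_sum => k; exact: cmeasM.
Qed.

Lemma mxmeasZ m n f (A : T -> 'M[C]_(m, n)) :
  cmeas f -> mxmeas A -> mxmeas (fun x => f x *: A x).
Proof. by move=> mf mA i j; under eq_fun do rewrite mxE; exact: cmeasM. Qed.

Lemma mxmeas_conj m n (A : T -> 'M[C]_(m, n)) : mxmeas A -> mxmeas (fun x => (A x)^t*).
Proof. by move=> mA i j; under eq_fun do rewrite !mxE; exact: cmeas_conj. Qed.

End ComplexMeasurable.

Lemma mxmeas_comp d d' (T : measurableType d) (T' : measurableType d') (R : realType)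
    m n (h : T -> T') (A : T' -> 'M[R[i]]_(m, n)) :
  measurable_fun setT h -> mxmeas A -> mxmeas (fun x => A (h x)).
Proof.
move=> mh mA i j; have [m1 m2] := mA i j; split.
- exact: (measurableT_comp m1 mh).
- exact: (measurableT_comp m2 mh).
Qed.

Section ComplexIntegral.
Context {R : realType}.
Local Notation C := R[i].
Local Notation mu2 := (@plane_measure R).
Local Notation cint := (cintegral mu2 setT).
Implicit Types f g : plane R -> C.

(** The modulus as an element of R: the norm of R[i] has values in R[i]. *)
Definition cmod (z : C) : R := Num.sqrt (complex.Re z ^+ 2 + complex.Im z ^+ 2).

Definition cintegrable f : Prop :=
  mu2.-integrable setT (fun x => (complex.Re (f x))%:E) /\
  mu2.-integrable setT (fun x => (complex.Im (f x))%:E).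

Lemma cmod_ge0 z : 0 <= cmod z. Proof. exact: sqrtr_ge0. Qed.

Lemma sqr_cmod z : cmod z ^+ 2 = complex.Re z ^+ 2 + complex.Im z ^+ 2.
Proof. by rewrite sqr_sqrtr// addr_ge0// sqr_ge0. Qed.

Lemma Re_le_cmod z : `|complex.Re z| <= cmod z.
Proof. by rewrite -sqrtr_sqr ler_sqrt ?addr_ge0 ?sqr_ge0// lerDl sqr_ge0. Qed.

Lemma Im_le_cmod z : `|complex.Im z| <= cmod z.
Proof. by rewrite -sqrtr_sqr ler_sqrt ?addr_ge0 ?sqr_ge0// lerDr sqr_ge0. Qed.

Lemma cmodM a b : cmod (a * b) = cmod a * cmod b.
Proof.
rewrite /cmod -sqrtrM ?addr_ge0 ?sqr_ge0//; congr Num.sqrt.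
by rewrite cReM cImM; ring.
Qed.

Lemma cmodE z : (cmod z)%:C = `|z|. Proof. by rewrite normc_def. Qed.

Lemma cmodD a b : cmod (a + b) <= cmod a + cmod b.
Proof. by rewrite -lecR rmorphD/= !cmodE ler_normD. Qed.

Lemma cmod_real (r : R) : cmod r%:C = `|r|.
Proof. by rewrite /cmod/= expr0n/= addr0 sqrtr_sqr. Qed.

Lemma cmod_conj z : cmod (Num.conj z) = cmod z.
Proof. by rewrite /cmod cReJ cImJ sqrrN. Qed.

Lemma cmod_sum n (F : 'I_n -> C) : cmod (\sum_i F i) <= \sum_i cmod (F i).
Proof.
elim/big_rec2: _ => [|i y x _ xy]; first by rewrite /cmod/= expr0n/= addr0 sqrtr0.
by apply: (le_trans (cmodD _ _)); rewrite lerD2l.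
Qed.

Lemma cintegrable_dom f (g : plane R -> R) : cmeas f ->
  mu2.-integrable setT (fun x => (g x)%:E) -> (forall x, cmod (f x) <= g x) ->
  cintegrable f.
Proof.
move=> [f1 f2] ig fg; split; apply: le_integrable ig => //=.
- exact/measurable_EFinP.
- by move=> x _; rewrite lee_fin (le_trans (Re_le_cmod _))// (le_trans (fg x))// ler_norm.
- exact/measurable_EFinP.
- by move=> x _; rewrite lee_fin (le_trans (Im_le_cmod _))// (le_trans (fg x))// ler_norm.
Qed.

Lemma cintegrable_meas f : cintegrable f -> cmeas f.
Proof. by move=> [/measurable_int/measurable_EFinP ? /measurable_int/measurable_EFinP]. Qed.

Lemma cintegrableD f g : cintegrable f -> cintegrable g ->
  cintegrable (fun x => f x + g x).
Proof.
move=> [f1 f2] [g1 g2]; split.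
- by under eq_fun do rewrite cReD EFinD; exact: integrableD.
- by under eq_fun do rewrite cImD EFinD; exact: integrableD.
Qed.

Lemma cintegrableZ c f : cintegrable f -> cintegrable (fun x => c * f x).
Proof.
move=> [f1 f2]; split.
- under eq_fun do rewrite cReM EFinB !EFinM.
  by apply: integrableB => //; exact: integrableZl.
- under eq_fun do rewrite cImM EFinD !EFinM.
  by apply: integrableD => //; exact: integrableZl.
Qed.

Lemma cintegrable0 : cintegrable (fun=> 0).
Proof. by split; exact: integrable0. Qed.

Lemma cintegralD f g : cintegrable f -> cintegrable g ->
  cint (fun x => f x + g x) = cint f + cint g.
Proof.
move=> [f1 f2] [g1 g2]; apply: complex_eq; rewrite ?cReD ?cImD /=.
- by rewrite -RintegralD//; apply: eq_Rintegral => x _; rewrite cReD.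
- by rewrite -RintegralD//; apply: eq_Rintegral => x _; rewrite cImD.
Qed.

Lemma cintegral0 : cint (fun=> 0) = 0.
Proof. by apply: complex_eq; rewrite /= /Rintegral integral0. Qed.

Lemma cintegralZ c f : cintegrable f -> cint (fun x => c * f x) = c * cint f.
Proof.
move=> [f1 f2]; have iZ (r : R) (h : plane R -> R) : mu2.-integrable setT (EFin \o h) ->
    mu2.-integrable setT (EFin \o (fun x => r * h x)).
  by move=> ih; apply: (eq_integrable _ (fun x => (r%:E * (h x)%:E)%E)) => //; exact: integrableZl.
apply: complex_eq; rewrite ?cReM ?cImM /= -!RintegralZl//.
- by rewrite -RintegralB//; [|exact: iZ|exact: iZ]; apply: eq_Rintegral => x _; rewrite cReM.
- by rewrite -RintegralD//; [|exact: iZ|exact: iZ]; apply: eq_Rintegral => x _; rewrite cImM.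
Qed.

Lemma cintegral_conj f : cintegrable f ->
  cint (fun x => Num.conj (f x)) = Num.conj (cint f).
Proof.
move=> [f1 f2]; apply: complex_eq; rewrite ?cReJ ?cImJ /=.
- by apply: eq_Rintegral => x _; rewrite cReJ.
- rewrite -[RHS]mulN1r -RintegralZl//; apply: eq_Rintegral => x _.
  by rewrite cImJ mulN1r.
Qed.

Lemma cintegral_ae f g : cmeas f -> cmeas g ->
  {ae mu2, forall x, f x = g x} -> cint f = cint g.
Proof.
move=> [f1 f2] [g1 g2] fg; apply: complex_eq => /=; congr fine; apply: ae_eq_integral => //.
- exact/measurable_EFinP.
- exact/measurable_EFinP.
- by apply: filterS fg => x ->.
- exact/measurable_EFinP.
- exact/measurable_EFinP.
- by apply: filterS fg => x ->.
Qed.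

Lemma cintegrable_ae f g : cmeas g ->
  {ae mu2, forall x, f x = g x} -> cintegrable f -> cintegrable g.
Proof.
move=> [g1 g2] fg [f1 f2]; split.
- apply: ae_eq_integrable f1; first exact/measurable_EFinP.
  by apply: filterS fg => x ->.
- apply: ae_eq_integrable f2; first exact/measurable_EFinP.
  by apply: filterS fg => x ->.
Qed.

Lemma cmod_cintegral_le f (g : plane R -> R) : cmeas f ->
  mu2.-integrable setT (fun x => (g x)%:E) -> (forall x, cmod (f x) <= g x) ->
  `|complex.Re (cint f)| <= \int[mu2]_x g x /\ `|complex.Im (cint f)| <= \int[mu2]_x g x.
Proof.
move=> mf ig fg; have [f1 f2] := cintegrable_dom mf ig fg; split => /=.
- apply: (le_trans (le_normr_Rintegral _ _)) => //; apply: le_Rintegral => //.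
  + by have := integrable_abse f1.
  + by move=> x _; rewrite (le_trans (Re_le_cmod _)).
- apply: (le_trans (le_normr_Rintegral _ _)) => //; apply: le_Rintegral => //.
  + by have := integrable_abse f2.
  + by move=> x _; rewrite (le_trans (Im_le_cmod _)).
Qed.

Lemma cmeas_section (F : plane R * plane R -> C) : cmeas F ->
  cmeas (fun x => cint (fun y => F (x, y))).
Proof. by move=> [m1 m2]; split; [exact: (plane_measurable_section1 m1)|exact: (plane_measurable_section1 m2)]. Qed.

Section Fubini.
Variables (F : plane R * plane R -> C) (g : plane R * plane R -> R).
Hypotheses (mF : cmeas F) (mg : measurable_fun setT g).
Hypothesis Fg : forall z, cmod (F z) <= g z.
Hypothesis gfin : (\int[mu2]_x \int[mu2]_y (g (x, y))%:E < +oo)%E.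

Let fin (h : plane R * plane R -> R) : measurable_fun setT h -> (forall z, `|h z| <= g z) ->
  (\int[mu2]_x \int[mu2]_y `|h (x, y)|%:E < +oo)%E.
Proof.
move=> mh hg; apply: le_lt_trans gfin.
have mah : measurable_fun setT (fun z => `|h z|) by exact: measurableT_comp.
apply: ge0_le_integral => //.
- by move=> x _; apply: integral_ge0 => y _; rewrite lee_fin.
- apply: (measurable_plane_tonelli1 (f := fun z => (`|h z|)%:E)) => [|z]; last by rewrite lee_fin.
  exact/measurable_EFinP.
- apply: (measurable_plane_tonelli1 (f := fun z => (g z)%:E)) => [|z].
    exact/measurable_EFinP.
  by rewrite lee_fin (le_trans _ (hg z)).
move=> x _; apply: le_integral_real => //.
- exact: measurableT_comp mah (pair1_measurable x).
- exact: measurableT_comp mg (pair1_measurable x).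
Qed.

Let F1 z : `|complex.Re (F z)| <= g z. Proof. exact: le_trans (Re_le_cmod _) (Fg z). Qed.
Let F2 z : `|complex.Im (F z)| <= g z. Proof. exact: le_trans (Im_le_cmod _) (Fg z). Qed.

Lemma cintegral_fubini :
  cint (fun x => cint (fun y => F (x, y))) = cint (fun y => cint (fun x => F (x, y))).
Proof.
case: mF => m1 m2; apply: complex_eq => /=.
- exact: (plane_fubini m1 (fin m1 F1)).
- exact: (plane_fubini m2 (fin m2 F2)).
Qed.

Lemma cintegrable_section : cintegrable (fun x => cint (fun y => F (x, y))).
Proof.
case: mF => m1 m2; split => /=.
- exact: (plane_integrable_section1 m1 (fin m1 F1)).
- exact: (plane_integrable_section1 m2 (fin m2 F2)).
Qed.

End Fubini.
End ComplexIntegral.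

(** * Integrals of matrix valued functions *)

Section MatrixIntegral.
Context {R : realType}.
Local Notation C := R[i].
Local Notation mu2 := (@plane_measure R).

Definition mxintegrable m n (F : plane R -> 'M[C]_(m, n)) : Prop :=
  forall i j, cintegrable (fun x => F x i j).

Lemma mxintegrable_meas m n (F : plane R -> 'M[C]_(m, n)) : mxintegrable F -> mxmeas F.
Proof. by move=> iF i j; exact: cintegrable_meas. Qed.

Lemma mxintegrableD m n (F G : plane R -> 'M[C]_(m, n)) :
  mxintegrable F -> mxintegrable G -> mxintegrable (fun x => F x + G x).
Proof.
move=> iF iG i j; under [fun x => _]eq_fun do rewrite mxE.
exact: cintegrableD.
Qed.

Lemma cintegrable_sum (I : Type) (s : seq I) (F : I -> plane R -> C) :
  (forall i, cintegrable (F i)) -> cintegrable (fun x => \sum_(i <- s) F i x).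
Proof.
move=> iF; elim: s => [|i s IH].
  by under [fun x => _]eq_fun do rewrite big_nil; exact: cintegrable0.
by under [fun x => _]eq_fun do rewrite big_cons; exact: cintegrableD.
Qed.

Lemma cintegral_sum (I : Type) (s : seq I) (F : I -> plane R -> C) :
  (forall i, cintegrable (F i)) ->
  cintegral mu2 setT (fun x => \sum_(i <- s) F i x) =
  \sum_(i <- s) cintegral mu2 setT (F i).
Proof.
move=> iF; elim: s => [|i s IH].
  by under [fun x => _]eq_fun do rewrite big_nil; rewrite big_nil; exact: cintegral0.
under [fun x => _]eq_fun do rewrite big_cons; rewrite big_cons cintegralD ?IH//.
exact: cintegrable_sum.
Qed.

Lemma mxintegrable_mull m n p (A : 'M[C]_(m, n)) (F : plane R -> 'M[C]_(n, p)) :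
  mxintegrable F -> mxintegrable (fun x => A *m F x).
Proof.
move=> iF i j; under [fun x => _]eq_fun do rewrite mxE.
by apply: cintegrable_sum => k; exact: cintegrableZ.
Qed.

Lemma mxintegrableZ m n (c : C) (F : plane R -> 'M[C]_(m, n)) :
  mxintegrable F -> mxintegrable (fun x => c *: F x).
Proof.
move=> iF i j; under [fun x => _]eq_fun do rewrite mxE.
exact: cintegrableZ.
Qed.

Lemma mxintegralD m n (F G : plane R -> 'M[C]_(m, n)) :
  mxintegrable F -> mxintegrable G ->
  mxintegral (fun x => F x + G x) = mxintegral F + mxintegral G.
Proof.
move=> iF iG; apply/matrixP => i j; rewrite !mxE.
under [fun x => _]eq_fun do rewrite mxE.
exact: cintegralD.
Qed.

Lemma mxintegralZ m n (c : C) (F : plane R -> 'M[C]_(m, n)) :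
  mxintegrable F -> mxintegral (fun x => c *: F x) = c *: mxintegral F.
Proof.
move=> iF; apply/matrixP => i j; rewrite !mxE.
under [fun x => _]eq_fun do rewrite mxE.
exact: cintegralZ.
Qed.

Lemma mxintegralN m n (F : plane R -> 'M[C]_(m, n)) :
  mxintegrable F -> mxintegral (fun x => - F x) = - mxintegral F.
Proof.
move=> iF; under [fun x => _]eq_fun do rewrite -scaleN1r.
by rewrite mxintegralZ// scaleN1r.
Qed.

Lemma mxintegral_sum m n (I : Type) (s : seq I) (F : I -> plane R -> 'M[C]_(m, n)) :
  (forall i, mxintegrable (F i)) ->
  mxintegral (fun x => \sum_(i <- s) F i x) = \sum_(i <- s) mxintegral (F i).
Proof.
move=> iF; apply/matrixP => i j; rewrite summxE !mxE.
under [fun x => _]eq_fun do rewrite summxE.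
rewrite cintegral_sum; last by move=> k; exact: iF.
by apply: eq_bigr => k _; rewrite mxE.
Qed.

Lemma mxintegral_mull m n p (A : 'M[C]_(m, n)) (F : plane R -> 'M[C]_(n, p)) :
  mxintegrable F -> mxintegral (fun x => A *m F x) = A *m mxintegral F.
Proof.
move=> iF; apply/matrixP => i j; rewrite !mxE.
under [fun x => _]eq_fun do rewrite mxE.
rewrite cintegral_sum; last by move=> k; exact: cintegrableZ.
by apply: eq_bigr => k _; rewrite cintegralZ// mxE.
Qed.

Lemma mxintegral_mulr m n p (A : 'M[C]_(n, p)) (F : plane R -> 'M[C]_(m, n)) :
  mxintegrable F -> mxintegral (fun x => F x *m A) = mxintegral F *m A.
Proof.
move=> iF; apply/matrixP => i j; rewrite !mxE.
under [fun x => _]eq_fun do rewrite mxE.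
have iFA k : cintegrable (fun x => F x i k * A k j).
  by under [fun x => _]eq_fun do rewrite mulrC; exact: cintegrableZ.
rewrite cintegral_sum//; apply: eq_bigr => k _; rewrite mxE mulrC -cintegralZ//.
by congr cintegral; apply/funext => x; rewrite mulrC.
Qed.

Lemma mxintegral_conj m n (F : plane R -> 'M[C]_(m, n)) : mxintegrable F ->
  mxintegral (fun x => (F x)^t*) = (mxintegral F)^t*.
Proof.
move=> iF; apply/matrixP => i j; rewrite !mxE.
under [fun x => _]eq_fun do rewrite !mxE.
exact: cintegral_conj.
Qed.

Lemma mxintegrable_conj m n (F : plane R -> 'M[C]_(m, n)) : mxintegrable F ->
  mxintegrable (fun x => (F x)^t*).
Proof.
move=> iF i j; under [fun x => _]eq_fun do rewrite !mxE.
have [h1 h2] := iF j i; split.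
- by under [fun x => _]eq_fun do rewrite cReJ.
- by under [fun x => _]eq_fun do rewrite cImJ EFinN; exact: integrableN.
Qed.

Lemma mxintegral_ae m n (F G : plane R -> 'M[C]_(m, n)) : mxmeas F -> mxmeas G ->
  {ae mu2, forall x, F x = G x} -> mxintegral F = mxintegral G.
Proof.
move=> mF mG FG; apply/matrixP => i j; rewrite !mxE.
by apply: cintegral_ae => //; apply: filterS FG => x ->.
Qed.

Lemma mxintegrable_dom m n (F : plane R -> 'M[C]_(m, n)) (g : plane R -> R) :
  mxmeas F -> mu2.-integrable setT (fun x => (g x)%:E) ->
  (forall x i j, cmod (F x i j) <= g x) -> mxintegrable F.
Proof. by move=> mF ig Fg i j; apply: cintegrable_dom (mF i j) ig _. Qed.

Lemma integrable_ge0 d (T : measurableType d) (mu : {measure set T -> \bar R})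
    (g : T -> R) : measurable_fun setT g ->
  (forall x, 0 <= g x) -> (\int[mu]_x (g x)%:E < +oo)%E ->
  mu.-integrable setT (fun x => (g x)%:E).
Proof.
move=> mg g0 gfin; apply/integrableP; split; first exact/measurable_EFinP.
rewrite (eq_integral (fun x => (g x)%:E))// => x _.
by rewrite gee0_abs// lee_fin.
Qed.

Lemma mxmeas_section m n (F : plane R * plane R -> 'M[C]_(m, n)) : mxmeas F ->
  mxmeas (fun x => mxintegral (fun y => F (x, y))).
Proof.
move=> mF i j; under [fun x => _]eq_fun do rewrite mxE.
exact: cmeas_section (mF i j).
Qed.

Section Fubini.
Variables (m n : nat) (F : plane R * plane R -> 'M[C]_(m, n)) (g : plane R * plane R -> R).
Hypotheses (mF : mxmeas F) (mg : measurable_fun setT g).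
Hypothesis Fg : forall z i j, cmod (F z i j) <= g z.
Hypothesis gfin : (\int[mu2]_x \int[mu2]_y (g (x, y))%:E < +oo)%E.

Lemma mxintegral_fubini :
  mxintegral (fun x => mxintegral (fun y => F (x, y))) =
  mxintegral (fun y => mxintegral (fun x => F (x, y))).
Proof.
apply/matrixP => i j; rewrite !mxE.
under [fun x => _]eq_fun do rewrite mxE.
under [X in _ = cintegral _ _ X]eq_fun do rewrite mxE.
exact: (cintegral_fubini (mF i j) mg (fun z => Fg z i j) gfin).
Qed.

Lemma mxintegrable_section : mxintegrable (fun x => mxintegral (fun y => F (x, y))).
Proof.
move=> i j; under [fun x => _]eq_fun do rewrite mxE.
exact: (cintegrable_section (mF i j) mg (fun z => Fg z i j) gfin).
Qed.

End Fubini.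

Definition len (u : 'cV[C]_2) : R := Num.sqrt (normsq u).

Lemma normsqE (u : 'cV[C]_2) : normsq u = \sum_(i < 2) cmod (u i 0) ^+ 2.
Proof. by apply: eq_bigr => i _; rewrite sqr_cmod. Qed.

Lemma normsq_ge0 (u : 'cV[C]_2) : 0 <= normsq u.
Proof. by rewrite normsqE sumr_ge0// => i _; rewrite sqr_ge0. Qed.

Lemma sqr_len u : len u ^+ 2 = normsq u.
Proof. by rewrite sqr_sqrtr// normsq_ge0. Qed.

Lemma len_ge0 u : 0 <= len u. Proof. exact: sqrtr_ge0. Qed.

Lemma cmod_le_len (u : 'cV[C]_2) i : cmod (u i 0) <= len u.
Proof.
rewrite -(@ler_pXn2r _ 2)// ?nnegrE ?cmod_ge0 ?len_ge0// sqr_len normsqE.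
by rewrite (bigD1 i)//= lerDl sumr_ge0// => j _; rewrite sqr_ge0.
Qed.

Lemma normsqZ (c : C) u : normsq (c *: u) = cmod c ^+ 2 * normsq u.
Proof. by rewrite !normsqE mulr_sumr; apply: eq_bigr => i _; rewrite mxE cmodM exprMn. Qed.

Lemma lenZ (c : C) u : len (c *: u) = cmod c * len u.
Proof. by rewrite /len normsqZ sqrtrM ?sqr_ge0// sqrtr_sqr ger0_norm ?cmod_ge0. Qed.

Lemma normsqD (u w : 'cV[C]_2) : normsq (u + w) <= 2 * (normsq u + normsq w).
Proof.
rewrite !normsqE -big_split mulr_sumr; apply: ler_sum => i _ /=; rewrite mxE.
apply: (@le_trans _ _ ((cmod (u i 0) + cmod (w i 0)) ^+ 2)).
  by rewrite ler_pXn2r// ?nnegrE ?addr_ge0 ?cmod_ge0// cmodD.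
rewrite -subr_ge0; set a := cmod _; set b := cmod _.
by rewrite (_ : _ - _ = (a - b) ^+ 2) ?sqr_ge0//; ring.
Qed.

Lemma normsq_eq0 (u : 'cV[C]_2) : (normsq u == 0) = (u == 0).
Proof.
apply/idP/eqP => [|->]; last first.
  by rewrite normsqE big1// => i _; rewrite mxE /cmod/= expr0n/= addr0 sqrtr0 expr0n.
rewrite /normsq psumr_eq0; last by move=> i _; rewrite addr_ge0// sqr_ge0.
move=> /allP u0; apply/matrixP => i j; rewrite mxE (ord1 j).
have := u0 i (mem_index_enum i); rewrite paddr_eq0 ?sqr_ge0// !sqrf_eq0.
move=> /andP[/eqP a /eqP b].
by move: a b; case: (u i 0) => p q /= -> ->.
Qed.

Lemma normsq_unitary (B : 'M[C]_2) u : B \is unitarymx -> normsq (B *m u) = normsq u.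
Proof.
have nE (w : 'cV[C]_2) : (normsq w)%:C = (w^t* *m w) 0 0.
  rewrite !mxE /normsq rmorph_sum; apply: eq_bigr => i _; rewrite !mxE.
  by apply: complex_eq; rewrite ?cReM ?cImM cReJ cImJ/=; ring.
move=> Bu; apply: complexI; rewrite !nE trmx_mul map_mxM mulmxA.
by rewrite mulmxKtV.
Qed.

Lemma measurable_normsq d (T : measurableType d) (f : T -> 'cV[C]_2) : mxmeas f ->
  measurable_fun setT (fun x => normsq (f x)).
Proof.
move=> mf; rewrite /normsq; apply: measurable_sum => i.
by have [? ?] := mf i 0; apply: measurable_funD; exact: measurable_funX.
Qed.

Lemma measurable_len d (T : measurableType d) (f : T -> 'cV[C]_2) : mxmeas f ->
  measurable_fun setT (fun x => len (f x)).
Proof.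
move=> mf; apply: measurable_sqrt_ge0 => [t|]; first exact: normsq_ge0.
exact: measurable_normsq.
Qed.

(** The factor 4 counts the real and imaginary parts of the two entries. *)
Lemma normsq_mxintegral (f : plane R -> 'cV[C]_2) (g : plane R -> R) : mxmeas f ->
  mu2.-integrable setT (fun x => (g x)%:E) -> (forall x, len (f x) <= g x) ->
  normsq (mxintegral f) <= 4 * (\int[mu2]_x g x) ^+ 2.
Proof.
move=> mf ig fg; rewrite /normsq.
apply: (@le_trans _ _ (\sum_(i < 2) (2 * (\int[mu2]_x g x) ^+ 2))).
  apply: ler_sum => i _; rewrite mxE.
  have [] := cmod_cintegral_le (mf i 0) ig (fun x => le_trans (cmod_le_len (f x) i) (fg x)).
  have sqle (a b : R) : `|a| <= b -> a ^+ 2 <= b ^+ 2.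
    move=> ab; rewrite -real_normK ?num_real//.
    by rewrite ler_pXn2r// nnegrE (le_trans _ ab).
  by move=> /sqle h1 /sqle h2; rewrite mulr_natl mulr2n lerD.
by rewrite big_ord_recl big_ord1; set t := _ ^+ 2; rewrite le_eqVlt; apply/orP; left; apply/eqP; ring.
Qed.

End MatrixIntegral.

(** * The kernel of the free Dirac operator at zero energy *)

Section DiracKernel.
Context {R : realType}.
Local Notation C := R[i].
Local Notation mu2 := (@plane_measure R).

(** The gradient of log |w|. *)
Definition kvec (w : R * R) : R * R := (w.1 / enorm w ^+ 2, w.2 / enorm w ^+ 2).

(** The kernel of G00 is [dsym (kvec (x - y))], see [G00E]. *)
Definition dsym (k : R * R) : 'M[C]_2 := ('i%C / (2 * pi)%:C) *: alpha_dot k.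

Lemma alpha_dotB (k l : R * R) : alpha_dot (k - l) = alpha_dot k - alpha_dot l.
Proof. by rewrite /alpha_dot /= !rmorphB/= !scalerBl opprD addrACA. Qed.

Lemma alpha_dotZ (c : R) (k : R * R) : alpha_dot (c * k.1, c * k.2) = c%:C *: alpha_dot k.
Proof. by rewrite /alpha_dot /= !rmorphM/= scalerDr !scalerA. Qed.

Lemma dsymB (k l : R * R) : dsym (k - l) = dsym k - dsym l.
Proof. by rewrite /dsym alpha_dotB scalerBr. Qed.

Lemma alpha_dotE (k : R * R) i j : alpha_dot k i j =
  if i == j then 0 else if i == 0 then k.1 +i* (- k.2) else k.1 +i* k.2.
Proof.
rewrite !mxE; case: eqP => [_|_]; first by rewrite !mulr0 addr0.
by case: eqP => _; apply: complex_eq; rewrite /= ?(mul0r, mulr0, mulr1, subr0, addr0, add0r, sub0r, mulrN, mulrN1, oppr0).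
Qed.

Lemma alpha_dot_conj (k : R * R) : (alpha_dot k)^t* = alpha_dot k.
Proof.
apply/matrixP => i j; rewrite [LHS]mxE [in LHS]mxE !alpha_dotE eq_sym.
case: i j => [[|[|//]] hi] [[|[|//]] hj] //=; apply: complex_eq; rewrite /= ?opprK ?oppr0//.
Qed.

(** The matrix alpha.k is Hermitian with square |k|^2. *)
Lemma sqr_alpha_dot_mul (k : R * R) (u : 'cV[C]_2) :
  normsq (alpha_dot k *m u) = enorm k ^+ 2 * normsq u.
Proof.
rewrite sqr_enorm /normsq !big_ord_recl !big_ord0 !mxE !big_ord_recl !big_ord0 !alpha_dotE /=.
rewrite !cReD !cImD !cReM !cImM /=.
set a := complex.Re (u 0 0). set b := complex.Im (u 0 0).
set c := complex.Re (u (lift 0 0) 0); set e := complex.Im (u (lift 0 0) 0).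
by ring.
Qed.

Lemma len_dsym (k : R * R) (u : 'cV[C]_2) : len (dsym k *m u) <= enorm k * len u.
Proof.
rewrite /dsym -scalemxAl lenZ.
have -> : len (alpha_dot k *m u) = enorm k * len u.
  by rewrite /len sqr_alpha_dot_mul sqrtrM ?sqr_ge0// sqrtr_sqr ger0_norm// enorm_ge0.
rewrite ler_piMl//; first by rewrite mulr_ge0// ?enorm_ge0 ?len_ge0.
rewrite cmodM; have -> : cmod 'i%C = 1 :> R by rewrite /cmod/= expr0n expr1n add0r sqrtr1.
rewrite mul1r -rmorphV/= ?cmod_real ?unitfE ?mulf_neq0 ?gt_eqF ?pi_gt0//.
rewrite ger0_norm ?invr_ge0 ?mulr_ge0 ?pi_ge0// invf_le1 ?mulr_gt0 ?pi_gt0//.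
by have := pi_ge2 R; lra.
Qed.

Lemma enorm_kvec w : enorm (kvec w) = (enorm w)^-1.
Proof.
have [w0|w0] := eqVneq (enorm w) 0.
  have -> : kvec w = (0, 0) by rewrite /kvec w0 expr0n/= invr0 !mulr0.
  by rewrite w0 invr0 /enorm /= expr0n/= addr0 sqrtr0.
apply/eqP; rewrite -(@eqrXn2 _ 2)// ?enorm_ge0 ?invr_ge0 ?enorm_ge0//; apply/eqP.
by rewrite sqr_enorm /= !exprMn -mulrDl -sqr_enorm; field.
Qed.

Lemma kvecN w : kvec (- w) = - kvec w.
Proof. by rewrite /kvec enormN /= !mulNr. Qed.

Lemma dsym_conj k : (dsym k)^t* = dsym (- k).
Proof.
have -> : - k = ((-1) * k.1, (-1) * k.2) by case: k => a b; rewrite !mulN1r.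
rewrite /dsym alpha_dotZ linearZ/= map_mxZ alpha_dot_conj scalerA; congr (_ *: _).
rewrite rmorphM/= fmorphV/=.
have -> : Num.conj ('i%C : C) = - 'i%C by apply: complex_eq; rewrite /= ?oppr0.
have -> : Num.conj ((2 * pi)%:C : C) = (2 * pi)%:C by apply: complex_eq; rewrite /= ?oppr0.
by rewrite rmorphN/= mulNr mulrN mulr1.
Qed.

Lemma G00E (f : plane R -> 'cV[C]_2) x :
  G00 f x = mxintegral (fun y => dsym (kvec (x - y)) *m f y).
Proof.
congr mxintegral; apply/funext => y; set w := x - y.
have -> : kvec w = ((enorm w ^+ 2)^-1 * w.1, (enorm w ^+ 2)^-1 * w.2).
  by rewrite /kvec ![_^-1 * _]mulrC.
rewrite /dsym alpha_dotZ scalerA -scalemxAl; congr (_ *: _).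
by rewrite rmorphM invfM mulrA fmorphV.
Qed.

Lemma measurable_kvec1 : measurable_fun setT (fun w : plane R => (kvec w).1).
Proof.
apply: measurable_funM; first exact: measurable_fst_plane.
apply: measurable_inv_ge0 => [t|]; first exact: sqr_ge0.
by apply: measurable_funX; exact: measurable_enorm.
Qed.

Lemma measurable_kvec2 : measurable_fun setT (fun w : plane R => (kvec w).2).
Proof.
apply: measurable_funM; first exact: measurable_snd_plane.
apply: measurable_inv_ge0 => [t|]; first exact: sqr_ge0.
by apply: measurable_funX; exact: measurable_enorm.
Qed.

Lemma mxmeas_dsym d (T : measurableType d) (k : T -> R * R) :
  measurable_fun setT (fun t => (k t).1) -> measurable_fun setT (fun t => (k t).2) ->
  mxmeas (fun t => dsym (k t)).
Proof.
move=> m1 m2; apply: mxmeasZ; first exact: cmeas_cst.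
by apply: mxmeasD; apply: mxmeasZ; rewrite ?mxmeas_cst//; try exact: cmeas_real; exact: mxmeas_cst.
Qed.

Lemma mxmeas_kernel : mxmeas (fun z : plane R * plane R => dsym (kvec (z.1 - z.2))).
Proof.
apply: (mxmeas_comp (A := fun w : plane R => dsym (kvec w)) measurable_plane_sub).
by apply: mxmeas_dsym; [exact: measurable_kvec1|exact: measurable_kvec2].
Qed.

(** A regular substitute for [kvec x], with the same behavior at infinity. *)
Definition kreg (x : R * R) : R * R := (x.1 / bracket x ^+ 2, x.2 / bracket x ^+ 2).

(** The difference between the squares of the two sides is <x>^-4. *)
Lemma enorm_kvec_kreg (x y : plane R) :
  x != y -> enorm (kvec (x - y) - kreg x) <= (bracket x)^-1 * ((enorm (x - y))^-1 * bracket y).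
Proof.
move=> xy; have w0 : 0 < enorm (x - y) by rewrite enorm_gt0 subr_eq0.
have bx := bracket_gt0 x; have by0 := bracket_gt0 y.
rewrite -(@ler_pXn2r _ 2)// ?nnegrE ?enorm_ge0 ?mulr_ge0 ?invr_ge0 ?enorm_ge0 ?(ltW bx) ?(ltW by0)//.
rewrite sqr_enorm /kreg /kvec !exprMn !exprVn !sqr_bracket !sqr_enorm /=.
have := exprn_gt0 2 w0; rewrite sqr_enorm /=.
set a := x.1; set b := x.2; set c := y.1; set e := y.2 => W.
have X : 0 < 1 + (a ^+ 2 + b ^+ 2) by rewrite ltr_pwDl// addr_ge0// sqr_ge0.
set X0 := 1 + _ in X *; set W0 := _ + _ in W *.
rewrite -subr_ge0 (_ : _ - _ = (X0 ^+ 2)^-1); first by rewrite invr_ge0 sqr_ge0.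
by rewrite /X0 /W0; field; rewrite !gt_eqF.
Qed.

Lemma plane_measure_set1 (x : plane R) : mu2 [set x] = 0%E.
Proof.
rewrite (_ : [set x] = [set x.1] `*` [set x.2]); last first.
  by apply/seteqP; split => [_ ->|[a b] [/= -> ->]] //; case: x.
transitivity (@lebesgue_measure R [set x.1] * @lebesgue_measure R [set x.2])%E.
  by apply: product_measure1E; exact: measurable_set1.
by rewrite [X in (X * _)%E]lebesgue_measure_set1 mul0e.
Qed.

Lemma ae_neq (x : plane R) : {ae mu2, forall y, x != y}.
Proof.
exists [set x]; split; last by move=> y /= /negP; rewrite negbK => /eqP.
- rewrite (_ : [set x] = [set x.1] `*` [set x.2]); last first.
    by apply/seteqP; split => [_ ->|[a b] [/= -> ->]] //; case: x.
  by apply: measurableX; exact: measurable_set1.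
- exact: plane_measure_set1.
Qed.

End DiracKernel.

(** * Square integrable fields *)

Section L2fields.
Context {R : realType}.
Local Notation C := R[i].
Local Notation mu2 := (@plane_measure R).
Implicit Types f g : plane R -> 'cV[C]_2.

Lemma L2normsqE f : L2normsq f = (\int[mu2]_x (len (f x) ^+ 2)%:E)%E.
Proof. by apply: eq_integral => x _; rewrite sqr_len. Qed.

Lemma L2_meas f : L2 f -> mxmeas f. Proof. by case. Qed.

Lemma L2_lty f : L2 f -> (\int[mu2]_x (len (f x) ^+ 2)%:E < +oo)%E.
Proof. by case=> _; rewrite L2normsqE. Qed.

Lemma L2normsq_ge0 f : (0 <= L2normsq f)%E.
Proof. by apply: integral_ge0 => x _; rewrite lee_fin normsq_ge0. Qed.

Lemma L2_dom f (h : plane R -> R) (c : R) : 0 <= c -> mxmeas f -> measurable_fun setT h ->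
  (forall x, 0 <= h x) -> (\int[mu2]_x (h x)%:E < +oo)%E ->
  {ae mu2, forall x, normsq (f x) <= c * h x} -> L2 f.
Proof.
move=> c0 mf mh h0 hfin fh; split => //.
apply: (@le_lt_trans _ _ (\int[mu2]_x (c * h x)%:E)%E).
  apply: ae_ge0_le_integral => //.
  - by move=> x _; rewrite lee_fin normsq_ge0.
  - by apply/measurable_EFinP; exact: measurable_normsq.
  - by move=> x _; rewrite lee_fin mulr_ge0.
  - by apply/measurable_EFinP; exact: measurable_funM.
  - by apply: filterS fh => x fhx _; rewrite lee_fin.
by rewrite integralZl_real// lte_mul_pinfty// lee_fin.
Qed.

Lemma L2D f g : L2 f -> L2 g -> L2 (fun x => f x + g x).
Proof.
move=> Lf Lg; have mf := L2_meas Lf; have mg := L2_meas Lg.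
apply: (@L2_dom _ (fun x => normsq (f x) + normsq (g x)) 2) => //.
- exact: mxmeasD.
- by apply: measurable_funD; exact: measurable_normsq.
- by move=> x; rewrite addr_ge0// normsq_ge0.
- rewrite integralD_real; [|exact: measurable_normsq|exact: measurable_normsq|..];
    try by move=> x; rewrite normsq_ge0.
  by rewrite lte_add_pinfty//; [case: Lf|case: Lg].
- by apply: aeW => x; exact: normsqD.
Qed.

Lemma L2Z (c : C) f : L2 f -> L2 (fun x => c *: f x).
Proof.
move=> Lf; have mf := L2_meas Lf.
apply: (@L2_dom _ (fun x => normsq (f x)) (cmod c ^+ 2)) => //.
- exact: sqr_ge0.
- by apply: mxmeasZ => //; exact: cmeas_cst.
- exact: measurable_normsq.
- by move=> x; rewrite normsq_ge0.
- by case: Lf.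
- by apply: aeW => x; rewrite normsqZ.
Qed.

Lemma L2N f : L2 f -> L2 (fun x => - f x).
Proof. by move=> /(L2Z (-1)); under [fun x => _ *: _]eq_fun do rewrite scaleN1r. Qed.

Lemma L2_0 : L2 (fun=> 0 : 'cV[C]_2).
Proof.
split; first by apply: mxmeas_cst.
rewrite /L2normsq; under eq_integral do rewrite (eqP (_ : normsq 0 == 0)) ?normsq_eq0//.
by rewrite integral0 ltry.
Qed.

Lemma L2_sum n (c : 'I_n -> C) (phi : 'I_n -> plane R -> 'cV[C]_2) :
  (forall i, L2 (phi i)) -> L2 (fun x => \sum_i c i *: phi i x).
Proof.
move=> Lphi; elim: (index_enum _) => [|i s IH].
  by under [fun x => _]eq_fun do rewrite big_nil; exact: L2_0.
under [fun x => _]eq_fun do rewrite big_cons.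
by apply: L2D => //; exact: L2Z.
Qed.

Lemma integrable_len_mul f g : L2 f -> L2 g ->
  mu2.-integrable setT (fun x => (len (f x) * len (g x))%:E).
Proof.
move=> Lf Lg; have mf := L2_meas Lf; have mg := L2_meas Lg.
have mlf := measurable_len mf; have mlg := measurable_len mg.
apply: integrable_ge0 => [|x|]; first exact: measurable_funM.
  by rewrite mulr_ge0// len_ge0.
apply: (@le_lt_trans _ _ (\int[mu2]_x (len (f x) ^+ 2 + len (g x) ^+ 2)%:E)%E).
  apply: le_integral_real.
  - exact: measurable_funM.
  - by apply: measurable_funD; exact: measurable_funX.
  - by move=> x; rewrite mulr_ge0// len_ge0.
  - move=> x; rewrite -subr_ge0; have := len_ge0 (f x); have := len_ge0 (g x).
    set a := len (f x); set b := len (g x) => b0 a0.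
    rewrite (_ : _ - _ = (a - b) ^+ 2 + a * b); last by ring.
    by rewrite addr_ge0 ?sqr_ge0// mulr_ge0.
rewrite integralD_real//; last 4 first.
- exact: measurable_funX.
- exact: measurable_funX.
- by move=> x; exact: sqr_ge0.
- by move=> x; exact: sqr_ge0.
by rewrite lte_add_pinfty//; exact: L2_lty.
Qed.

Lemma cmod_dot (u w : 'cV[C]_2) i j : cmod ((u^t* *m w) i j) <= 2 * (len u * len w).
Proof.
rewrite mxE; apply: (le_trans (cmod_sum _)).
apply: (@le_trans _ _ (\sum_(k < 2) (len u * len w))); last first.
  by rewrite sumr_const card_ord mulr_natl.
apply: ler_sum => k _; rewrite cmodM !mxE cmod_conj (ord1 j) (ord1 i).
by rewrite ler_pM ?cmod_ge0// cmod_le_len.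
Qed.

Lemma mxintegrable_dot f g : L2 f -> L2 g -> mxintegrable (fun x => (f x)^t* *m g x).
Proof.
move=> Lf Lg; apply: (mxintegrable_dom (g := fun x => 2 * (len (f x) * len (g x)))).
- by apply: mxmeasM; [apply: mxmeas_conj; exact: L2_meas|exact: L2_meas].
- by under [fun x => _]eq_fun do rewrite EFinM; apply: integrableZl => //; exact: integrable_len_mul.
- by move=> x i j; exact: cmod_dot.
Qed.

Lemma innerE f g : inner f g = mxintegral (fun x => (f x)^t* *m g x) 0 0.
Proof. by rewrite mxE. Qed.

Lemma innerD f g h : L2 f -> L2 g -> L2 h ->
  inner f (fun x => g x + h x) = inner f g + inner f h.
Proof.
move=> Lf Lg Lh; rewrite !innerE; under [fun x => _ *m _]eq_fun do rewrite mulmxDr.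
by rewrite mxintegralD ?mxE//; exact: mxintegrable_dot.
Qed.

Lemma innerZ (c : C) f g : L2 f -> L2 g ->
  inner f (fun x => c *: g x) = c * inner f g.
Proof.
move=> Lf Lg; rewrite !innerE; under [fun x => _ *m _]eq_fun do rewrite -scalemxAr.
by rewrite mxintegralZ ?mxE//; exact: mxintegrable_dot.
Qed.

Lemma inner_conj f g : L2 f -> L2 g -> inner g f = Num.conj (inner f g).
Proof.
move=> Lf Lg; have := mxintegral_conj (mxintegrable_dot Lf Lg).
move=> /(congr1 (fun M : 'M[C]_1 => M 0 0)).
rewrite [RHS]mxE [in RHS]mxE -innerE => <-; rewrite innerE; congr (mxintegral _ 0 0).
by apply/funext => x; rewrite trmx_mul map_mxM/= trmxCK.
Qed.

Lemma inner_ae f g h : L2 f -> L2 g -> L2 h ->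
  {ae mu2, forall x, g x = h x} -> inner f g = inner f h.
Proof.
move=> Lf Lg Lh gh; rewrite !innerE.
suff -> : mxintegral (fun x => (f x)^t* *m g x) = mxintegral (fun x => (f x)^t* *m h x) by [].
apply: mxintegral_ae.
- exact/mxintegrable_meas/mxintegrable_dot.
- exact/mxintegrable_meas/mxintegrable_dot.
- by apply: filterS gh => x ->.
Qed.

Definition L2norm2 f : R := fine (L2normsq f).

Lemma L2norm2_ge0 f : 0 <= L2norm2 f.
Proof. by rewrite fine_ge0// L2normsq_ge0. Qed.

Lemma L2norm2K f : L2 f -> (L2norm2 f)%:E = L2normsq f.
Proof. by case=> _ f2; rewrite /L2norm2 fineK// ge0_fin_numE// L2normsq_ge0. Qed.

Lemma dot_self (u : 'cV[C]_2) : (u^t* *m u) 0 0 = (normsq u)%:C.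
Proof.
rewrite !mxE /normsq rmorph_sum; apply: eq_bigr => i _; rewrite !mxE.
by apply: complex_eq; rewrite ?cReM ?cImM cReJ cImJ/=; ring.
Qed.

Lemma inner_self f : inner f f = (L2norm2 f)%:C.
Proof.
rewrite /inner; under [fun x => _]eq_fun do rewrite dot_self.
by apply: complex_eq => //=; rewrite /Rintegral integral0.
Qed.

Lemma L2norm2_eq0 f : L2 f -> L2norm2 f = 0 -> {ae mu2, forall x, f x = 0}.
Proof.
move=> Lf f0; have mf := L2_meas Lf.
have i0 : (\int[mu2]_x `|(normsq (f x))%:E| = 0)%E.
  rewrite -[RHS]/(0%:E) -f0 L2norm2K//; apply: eq_integral => x _.
  by rewrite gee0_abs// lee_fin normsq_ge0.
have mn : measurable_fun setT (fun x => (normsq (f x))%:E).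
  by apply/measurable_EFinP; exact: measurable_normsq.
have /(ae_eq_integral_abs mu2 measurableT mn).1 := i0.
apply: filterS => x /(_ I) [] /eqP; by rewrite normsq_eq0 => /eqP.
Qed.

Lemma L2norm2Z (c : C) f : L2 f -> L2norm2 (fun x => c *: f x) = cmod c ^+ 2 * L2norm2 f.
Proof.
move=> Lf; have mf := L2_meas Lf; apply: EFin_inj.
rewrite EFinM !L2norm2K//; last exact: L2Z.
rewrite /L2normsq -integralZl_real ?sqr_ge0//.
- by apply: eq_integral => x _; rewrite normsqZ.
- exact: measurable_normsq.
- by move=> x; rewrite normsq_ge0.
Qed.

(** A crude form of the Cauchy-Schwarz inequality, from 2 a b <= a^2 + b^2. *)
Lemma cmod_inner_le f g : L2 f -> L2 g ->
  cmod (inner f g) <= 2 * (L2norm2 f + L2norm2 g).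
Proof.
move=> Lf Lg; have mf := L2_meas Lf; have mg := L2_meas Lg.
have ifg := integrable_len_mul Lf Lg.
have i2fg : mu2.-integrable setT (fun x => (2 * (len (f x) * len (g x)))%:E).
  by under [fun x => _]eq_fun do rewrite EFinM; exact: integrableZl.
have mm : mxmeas (fun x => (f x)^t* *m g x) by exact/mxintegrable_meas/mxintegrable_dot.
have [h1 h2] := cmod_cintegral_le (mm 0 0) i2fg (fun x => cmod_dot (f x) (g x) 0 0).
have : \int[mu2]_x (2 * (len (f x) * len (g x))) <= L2norm2 f + L2norm2 g.
  rewrite -lee_fin EFinD !L2norm2K// /Rintegral fineK; last exact: integrable_fin_num i2fg.
  rewrite /L2normsq -integralD_real; last 4 first.
  - exact: measurable_normsq.
  - exact: measurable_normsq.
  - by move=> x; rewrite normsq_ge0.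
  - by move=> x; rewrite normsq_ge0.
  apply: le_integral_real.
  - by do 2 apply: measurable_funM => //; exact: measurable_len.
  - by apply: measurable_funD; exact: measurable_normsq.
  - by move=> x; rewrite !mulr_ge0// len_ge0.
  - move=> x; rewrite -!sqr_len -subr_ge0; set a := len _; set b := len _.
    by rewrite (_ : _ - _ = (a - b) ^+ 2) ?sqr_ge0//; ring.
move=> le; rewrite [inner _ _]complexE; apply: (le_trans (cmodD _ _)).
rewrite cmodM !cmod_real mulr_natl mulr2n.
have -> : cmod 'i%C = 1 :> R by rewrite /cmod/= expr0n expr1n add0r sqrtr1.
by rewrite mul1r lerD//; [exact: le_trans h1 le|exact: le_trans h2 le].
Qed.

End L2fields.

(** * The Birman-Schwinger operator *)

Lemma plane_ae_imply (R : realType) (P Q : plane R -> Prop) :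
  {ae (@plane_measure R), forall x, P x} -> (forall x, P x -> Q x) ->
  {ae (@plane_measure R), forall x, Q x}.
Proof. by move=> aeP PQ; apply: filterS aeP. Qed.

Lemma plane_ae_imply2 (R : realType) (P P' Q : plane R -> Prop) :
  {ae (@plane_measure R), forall x, P x} -> {ae (@plane_measure R), forall x, P' x} ->
  (forall x, P x -> P' x -> Q x) -> {ae (@plane_measure R), forall x, Q x}.
Proof. by move=> aeP aeP' PQ; apply: filterS2 aeP aeP'. Qed.

Section BirmanSchwinger.
Context {R : realType}.
Local Notation C := R[i].
Local Notation mu2 := (@plane_measure R).
Variables (v U : plane R -> 'M[C]_2) (b K : R).
Hypotheses (mv : mxmeas v) (mU : mxmeas U).
Hypotheses (b2 : 2 < b) (K0 : 0 <= K).
Hypothesis len_v : forall x u, len (v x *m u) <= K * bracket x `^ (- (b / 2)) * len u.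
Hypothesis len_vC : forall x u, len ((v x)^t* *m u) <= K * bracket x `^ (- (b / 2)) * len u.
Hypothesis len_U : forall x u, len (U x *m u) = len u.
Hypothesis U_herm : forall x, (U x)^t* = U x.
Hypothesis U_sqr : forall x, U x *m U x = 1%:M.

Implicit Types f g : plane R -> 'cV[C]_2.

Let src f (y : plane R) : 'cV[C]_2 := (v y)^t* *m f y.

(** The operator T.  Only the decay of [v] and of its adjoint, and algebraic
properties of [U], matter for its analysis. *)
Definition BS f : plane R -> 'cV[C]_2 := fun x => U x *m f x + v x *m G00 (src f) x.

Let pb (x : plane R) : R := bracket x `^ (- (b / 2)).

Let kern (z : plane R * plane R) : R := (enorm (z.1 - z.2))^-1.

Let kern0 z : 0 <= kern z. Proof. by rewrite invr_ge0 enorm_ge0. Qed.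

Let mkern : measurable_fun setT kern.
Proof. exact: measurableT_comp (@measurable_inv_enorm R) measurable_plane_sub. Qed.

Let pb0 x : 0 < pb x. Proof. exact/powR_gt0/bracket_gt0. Qed.
Let pbge0 x : 0 <= pb x. Proof. exact/ltW/pb0. Qed.
Let mpb : measurable_fun setT pb. Proof. exact: measurable_bracket_powR. Qed.

Let wb (x : plane R) : R := bracket x `^ (b / 2).
Let wb0 x : 0 < wb x. Proof. exact/powR_gt0/bracket_gt0. Qed.
Let mwb : measurable_fun setT wb. Proof. exact: measurable_bracket_powR. Qed.

Let b21 : 1 < b / 2. Proof. by rewrite ltr_pdivlMr// mul1r. Qed.

(** The weight [wb] is the inverse of [pb], so that the row sums and the column
sums of the Schur test are both bounded by this integral. *)
Let bounded : exists2 A : R, 0 < A & forall x,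
  (\int[mu2]_y ((enorm (y - x))^-1 * pb y)%:E <= A%:E)%E.
Proof.
have [A A0 AE] := potential_bounded b21; exists (A + 1) => [|x].
  by rewrite ltr_pwDr.
by apply: (le_trans (AE x)); rewrite lee_fin lerDl.
Qed.

Let rowsum (A : R) :
  (forall x, (\int[mu2]_y ((enorm (y - x))^-1 * pb y)%:E <= A%:E)%E) ->
  forall x, (\int[mu2]_y (kern (x, y) * (wb y)^-1)%:E <= A%:E)%E.
Proof.
move=> AE x; rewrite [leLHS](_ : _ = (\int[mu2]_y ((enorm (y - x))^-1 * pb y)%:E)%E)//.
by apply: eq_integral => y _; rewrite /kern /= enormB /wb /pb powRN.
Qed.

Let colsum (A : R) :
  (forall x, (\int[mu2]_y ((enorm (y - x))^-1 * pb y)%:E <= A%:E)%E) ->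
  forall y, (\int[mu2]_x (pb x ^+ 2 * kern (x, y) * (pb y ^+ 2 * wb y))%:E <= A%:E)%E.
Proof.
move=> AE y; apply: le_trans (AE y).
have pb1 x : pb x <= 1 by apply: bracket_powRN_le1; rewrite divr_ge0// ltW// (lt_trans _ b2).
apply: le_integral_real.
- apply: measurable_funM => //; apply: measurable_funM; first exact: measurable_funX.
  exact: measurableT_comp mkern (pair2_measurable y).
- by apply: measurable_funM => //; exact: measurable_planeB (@measurable_inv_enorm R).
- by move=> x; rewrite !mulr_ge0// ?sqr_ge0// ltW.
- move=> x; have wpE : pb y ^+ 2 * wb y = pb y.
    have -> : wb y = (pb y)^-1 by rewrite /pb powRN invrK.
    by rewrite expr2 mulfK// gt_eqF.
  rewrite [X in _ * X <= _]wpE.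
  rewrite /kern /= [leRHS]mulrC -[leRHS]mulr1 ler_pM//.
  + by rewrite !mulr_ge0// ?invr_ge0 ?enorm_ge0// ltW.
  + by rewrite ler_wpM2r ?invr_ge0 ?enorm_ge0// expr2 ler_piMl// ltW.
Qed.

Let mlen f : L2 f -> measurable_fun setT (fun y => len (f y)).
Proof. by move=> Lf; apply: measurable_len; exact: L2_meas. Qed.

Let msrc f : L2 f -> mxmeas (src f).
Proof. by move=> Lf; apply: mxmeasM; [exact: mxmeas_conj|exact: L2_meas]. Qed.

Let Fk f (z : plane R * plane R) : 'cV[C]_2 := dsym (kvec (z.1 - z.2)) *m src f z.2.

Let mFk f : L2 f -> mxmeas (Fk f).
Proof.
move=> Lf; apply: mxmeasM; first exact: mxmeas_kernel.
exact: (mxmeas_comp measurable_snd (msrc Lf)).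
Qed.

Let len_Fk f z : len (Fk f z) <= K * (kern z * (pb z.2 * len (f z.2))).
Proof.
apply: (le_trans (len_dsym _ _)); rewrite enorm_kvec -/(kern z).
by rewrite mulrCA ler_wpM2l// mulrA len_vC.
Qed.

(** Absolute convergence of the bilinear form of v G v^*, for Fubini. *)
Lemma BS_bilinear f g : L2 f -> L2 g ->
  (\int[mu2]_x \int[mu2]_y
    (len (g x) * (pb x * (kern (x, y) * (pb y * len (f y)))))%:E < +oo)%E.
Proof.
move=> Lf Lg; have [A A0 AE] := bounded.
apply: (schur_bilinear mkern kern0 mwb wb0 mpb pbge0 mpb pb0 A0 (ltW A0) (rowsum AE) (colsum AE)).
- exact: mlen.
- by move=> y; exact: len_ge0.
- exact: L2_lty.
- exact: mlen.
- by move=> y; exact: len_ge0.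
- exact: L2_lty.
Qed.

Lemma mxmeas_potential f : L2 f -> mxmeas (G00 (src f)).
Proof.
move=> Lf; have := mxmeas_section (mFk Lf).
by rewrite (_ : (fun x => _) = G00 (src f))//; apply/funext => x; rewrite G00E.
Qed.

Let weighted_sqr_lty f : L2 f ->
  (\int[mu2]_x ((pb x * \int[mu2]_y (kern (x, y) * (pb y * len (f y)))) ^+ 2)%:E < +oo)%E.
Proof.
move=> Lf; have [A A0 AE] := bounded.
have := schur_bound mkern kern0 mwb wb0 mpb pbge0 mpb pb0 A0 (ltW A0)
  (rowsum AE) (colsum AE) (mlen Lf) (fun y => len_ge0 (f y)).
move=> /le_lt_trans; apply.
by rewrite lte_mul_pinfty// ?L2_lty// lee_fin mulr_ge0// ltW.
Qed.

Let potential_finite f : L2 f -> {ae mu2, forall x,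
  (\int[mu2]_y (kern (x, y) * (pb y * len (f y)))%:E < +oo)%E}.
Proof.
move=> Lf; have [A A0 AE] := bounded.
exact: (schur_ae_finite mkern kern0 mwb wb0 mpb pbge0 mpb pb0 A0 (ltW A0)
  (rowsum AE) (colsum AE) (mlen Lf) (fun y => len_ge0 (f y)) (L2_lty Lf)).
Qed.

Let mrow f x : L2 f -> measurable_fun setT (fun y => kern (x, y) * (pb y * len (f y))).
Proof.
move=> Lf; apply: measurable_funM; first exact: (measurableT_comp mkern (pair1_measurable x)).
by apply: measurable_funM => //; exact: mlen.
Qed.

Let normsq_potential f : L2 f -> {ae mu2, forall x, normsq (G00 (src f) x) <=
  4 * (K * \int[mu2]_y (kern (x, y) * (pb y * len (f y)))) ^+ 2}.
Proof.
move=> Lf; apply: filterS (potential_finite Lf) => x xfin.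
have row0 y : 0 <= kern (x, y) * (pb y * len (f y)) by rewrite !mulr_ge0 ?len_ge0// ltW.
have irow := integrable_ge0 (mrow x Lf) row0 xfin.
rewrite G00E -RintegralZl//.
apply: normsq_mxintegral => [||y].
- exact: (mxmeas_comp (pair1_measurable x) (mFk Lf)).
- by under [fun y => _]eq_fun do rewrite EFinM; exact: integrableZl.
- exact: (len_Fk f (x, y)).
Qed.

Lemma L2_BS f : L2 f -> L2 (BS f).
Proof.
move=> Lf; apply: L2D.
  split; first by apply: mxmeasM => //; exact: L2_meas.
  rewrite /L2normsq (eq_integral (fun x => (normsq (f x))%:E)); first by case: Lf.
  by move=> x _; rewrite -!sqr_len len_U.
apply: (@L2_dom _ _ (fun x => (pb x * \int[mu2]_y (kern (x, y) * (pb y * len (f y)))) ^+ 2) (4 * K ^+ 4)).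
- by rewrite mulr_ge0// exprn_ge0.
- by apply: mxmeasM => //; exact: mxmeas_potential.
- apply: measurable_funX; apply: measurable_funM => //.
  apply: (plane_measurable_section1 (f := fun z => kern z * (pb z.2 * len (f z.2)))).
  apply: measurable_funM => //.
  apply: measurable_funM; first by apply: (measurableT_comp mpb); exact: measurable_snd.
  by apply: (measurableT_comp (mlen Lf)); exact: measurable_snd.
- by move=> x; exact: sqr_ge0.
- exact: weighted_sqr_lty.
apply: filterS (normsq_potential Lf) => x; set X := \int[mu2]_y _ => GX.
have := len_v x (G00 (src f) x); rewrite -/(pb x) => lv.
apply: (@le_trans _ _ ((K * pb x) ^+ 2 * normsq (G00 (src f) x))).
  rewrite -!sqr_len -exprMn ler_pXn2r// ?nnegrE ?mulr_ge0 ?len_ge0//.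
apply: (le_trans (ler_wpM2l (sqr_ge0 _) GX)).
have ringE (k p t : R) : (k * p) ^+ 2 * (4 * (k * t) ^+ 2) = 4 * k ^+ 4 * (p * t) ^+ 2 by ring.
by rewrite ringE.
Qed.

Let Fdot g f (z : plane R * plane R) : 'M[C]_1 := (src g z.1)^t* *m Fk f z.

Let gdot g f (z : plane R * plane R) : R :=
  2 * K ^+ 2 * (len (g z.1) * (pb z.1 * (kern z * (pb z.2 * len (f z.2))))).

Let mFdot g f : L2 g -> L2 f -> mxmeas (Fdot g f).
Proof.
move=> Lg Lf; apply: mxmeasM; last exact: mFk.
by apply: mxmeas_conj; exact: (mxmeas_comp measurable_fst (msrc Lg)).
Qed.

Let mbil g f : L2 g -> L2 f -> measurable_fun setT (fun z : plane R * plane R =>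
  len (g z.1) * (pb z.1 * (kern z * (pb z.2 * len (f z.2))))).
Proof.
move=> Lg Lf; apply: measurable_funM.
  by apply: (measurableT_comp (mlen Lg)); exact: measurable_fst.
apply: measurable_funM; first by apply: (measurableT_comp mpb); exact: measurable_fst.
apply: measurable_funM => //.
apply: measurable_funM; first by apply: (measurableT_comp mpb); exact: measurable_snd.
by apply: (measurableT_comp (mlen Lf)); exact: measurable_snd.
Qed.

Let Fdot_dom g f z i j : cmod (Fdot g f z i j) <= gdot g f z.
Proof.
apply: (le_trans (cmod_dot _ _ _ _)).
rewrite /gdot -mulrA ler_wpM2l//.
have h1 : len (src g z.1) <= K * pb z.1 * len (g z.1) by exact: len_vC.
have h2 := len_Fk f z.
apply: (le_trans (ler_pM (len_ge0 _) (len_ge0 _) h1 h2)).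
have ringE (k p l q : R) : k * p * l * (k * q) = k ^+ 2 * (l * (p * q)) by ring.
by rewrite ringE.
Qed.

Let gdot_fin g f : L2 g -> L2 f -> (\int[mu2]_x \int[mu2]_y (gdot g f (x, y))%:E < +oo)%E.
Proof.
move=> Lg Lf; have hfin := BS_bilinear Lf Lg.
have K20 : 0 <= 2 * K ^+ 2 by rewrite mulr_ge0// sqr_ge0.
have h0 x y : 0 <= len (g x) * (pb x * (kern (x, y) * (pb y * len (f y)))).
  by rewrite !mulr_ge0// ?len_ge0// ltW.
have mh := mbil Lg Lf.
have mhx x := measurableT_comp mh (pair1_measurable x).
rewrite (eq_integral (fun x => (2 * K ^+ 2)%:E *
    \int[mu2]_y (len (g x) * (pb x * (kern (x, y) * (pb y * len (f y)))))%:E)%E); last first.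
  by move=> x _; rewrite -integralZl_real//; exact: mhx.
rewrite ge0_integralZl//.
- by apply: lte_mul_pinfty.
- apply: (measurable_plane_tonelli1 (f := fun z =>
    (len (g z.1) * (pb z.1 * (kern z * (pb z.2 * len (f z.2)))))%:E)) => [|z].
    exact/measurable_EFinP.
  by rewrite lee_fin; have := h0 z.1 z.2; rewrite -surjective_pairing.
- by move=> x _; apply: integral_ge0 => y _; rewrite lee_fin.
Qed.

Lemma ae_integrable_potential f : L2 f ->
  {ae mu2, forall x, mxintegrable (fun y => dsym (kvec (x - y)) *m src f y)}.
Proof.
move=> Lf; apply: filterS (potential_finite Lf) => x xfin.
have row0 y : 0 <= kern (x, y) * (pb y * len (f y)) by rewrite !mulr_ge0 ?len_ge0// ltW.
have irow := integrable_ge0 (mrow x Lf) row0 xfin.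
apply: (mxintegrable_dom (g := fun y => K * (kern (x, y) * (pb y * len (f y))))).
- exact: (mxmeas_comp (pair1_measurable x) (mFk Lf)).
- by under [fun y => _]eq_fun do rewrite EFinM; exact: integrableZl.
- by move=> y i j; rewrite (ord1 j) (le_trans (cmod_le_len _ _))// (len_Fk f (x, y)).
Qed.

(** The kernel is Hermitian: [kvec] is odd, and the adjoint of [dsym k] is
[dsym (- k)]. *)
Lemma potential_symmetric f g : L2 f -> L2 g ->
  mxintegral (fun x => (src g x)^t* *m G00 (src f) x) =
  mxintegral (fun x => (G00 (src g) x)^t* *m src f x).
Proof.
move=> Lf Lg.
have aef := ae_integrable_potential Lf; have aeg := ae_integrable_potential Lg.
transitivity (mxintegral (fun x => mxintegral (fun y => Fdot g f (x, y)))).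
  apply: mxintegral_ae.
  - by apply: mxmeasM; [apply: mxmeas_conj; exact: msrc|exact: mxmeas_potential].
  - exact: mxmeas_section (mFdot Lg Lf).
  - by apply: (plane_ae_imply aef) => x ix; rewrite G00E -mxintegral_mull.
have mg : measurable_fun setT (gdot g f).
  by apply: measurable_funM => //; exact: mbil.
rewrite (mxintegral_fubini (mFdot Lg Lf) mg (Fdot_dom g f) (gdot_fin Lg Lf)).
apply: mxintegral_ae.
- have mswap : mxmeas (fun z : plane R * plane R => Fdot g f (z.2, z.1)).
    apply: (mxmeas_comp (h := fun z : plane R * plane R => (z.2, z.1)) _ (mFdot Lg Lf)).
    by apply: measurable_fun_pair; [exact: measurable_snd|exact: measurable_fst].
  exact: mxmeas_section mswap.
- by apply: mxmeasM; [apply: mxmeas_conj; exact: mxmeas_potential|exact: msrc].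
- apply: (plane_ae_imply aeg) => y iy; rewrite G00E -mxintegral_conj// -mxintegral_mulr; last first.
    exact: mxintegrable_conj.
  congr mxintegral; apply/funext => x; rewrite /Fdot /Fk /=.
  rewrite [(dsym _ *m _)^T]trmx_mul map_mxM/= dsym_conj -kvecN opprB mulmxA//.
Qed.

Let L2_U f : L2 f -> L2 (fun x => U x *m f x).
Proof.
move=> Lf; split; first by apply: mxmeasM => //; exact: L2_meas.
rewrite /L2normsq (eq_integral (fun x => (normsq (f x))%:E)); first by case: Lf.
by move=> x _; rewrite -!sqr_len len_U.
Qed.

Let L2_vGv f : L2 f -> L2 (fun x => v x *m G00 (src f) x).
Proof.
move=> Lf; have := L2D (L2_BS Lf) (L2N (L2_U Lf)).
by under [fun x => _]eq_fun do rewrite /BS addrC addKr.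
Qed.

Lemma BS_symmetric f g : L2 f -> L2 g -> inner g (BS f) = inner (BS g) f.
Proof.
move=> Lf Lg.
have conjD (w z : C) : Num.conj (w + z) = Num.conj w + Num.conj z by exact: rmorphD.
have UE : inner g (fun x => U x *m f x) = inner (fun x => U x *m g x) f.
  rewrite !innerE; congr (mxintegral _ 0 0); apply/funext => x.
  by rewrite trmx_mul map_mxM/= U_herm mulmxA.
have srcE (h k : plane R -> 'cV[C]_2) x : (h x)^t* *m (v x *m k x) = (src h x)^t* *m k x.
  by rewrite /src trmx_mul map_mxM/= trmxCK mulmxA.
have VE : inner g (fun x => v x *m G00 (src f) x) = inner (fun x => v x *m G00 (src g) x) f.
  rewrite !innerE.
  transitivity (mxintegral (fun x => (src g x)^t* *m G00 (src f) x) 0 0).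
    by congr (mxintegral _ 0 0); apply/funext => x; rewrite srcE.
  rewrite potential_symmetric//; congr (mxintegral _ 0 0); apply/funext => x.
  by rewrite [(v x *m _)^T]trmx_mul map_mxM/= mulmxA.
transitivity (inner g (fun x => U x *m f x) + inner g (fun x => v x *m G00 (src f) x)).
  by apply: innerD => //; [exact: L2_U|exact: L2_vGv].
apply/esym; apply: (etrans (inner_conj Lf (L2_BS Lg))).
transitivity (Num.conj (inner f (fun x => U x *m g x) + inner f (fun x => v x *m G00 (src g) x))).
  by congr Num.conj; apply: innerD => //; [exact: L2_U|exact: L2_vGv].
rewrite conjD; congr (_ + _).
- by apply/esym; apply: (etrans UE); exact: (inner_conj Lf (L2_U Lg)).
- by apply/esym; apply: (etrans VE); exact: (inner_conj Lf (L2_vGv Lg)).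
Qed.

(** Both |v| and |f| are square integrable, as b > 2. *)
Lemma len_src_lty f : L2 f -> (\int[mu2]_x (len (src f x))%:E < +oo)%E.
Proof.
move=> Lf; have LW : (\int[mu2]_x (pb x ^+ 2)%:E < +oo)%E.
  have := bracket_powR_lty b2.
  rewrite [X in (X < _)%E -> _](eq_integral (fun x : plane R => (pb x ^+ 2)%:E))// => x _.
  rewrite /pb -powR_mulrn ?powR_ge0// -powRrM; congr (_ `^ _)%:E.
  by rewrite mulNr divfK.
have iW : mu2.-integrable setT (fun x => (pb x ^+ 2)%:E).
  by apply: integrable_ge0 => //; [exact: measurable_funX|move=> x; exact: sqr_ge0].
have iL : mu2.-integrable setT (fun x => (len (f x) ^+ 2)%:E).
  apply: integrable_ge0; last exact: L2_lty.
  - by apply: measurable_funX; exact: mlen.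
  - by move=> x; exact: sqr_ge0.
have iS : mu2.-integrable setT (fun x => (K * (pb x ^+ 2 + len (f x) ^+ 2))%:E).
  under [fun x => _]eq_fun do rewrite EFinM EFinD.
  by apply: integrableZl => //; exact: integrableD.
have ml := measurable_len (msrc Lf).
apply: (@le_lt_trans _ _ (\int[mu2]_x (K * (pb x ^+ 2 + len (f x) ^+ 2))%:E)%E); last first.
  exact: integral_fune_lt_pinfty.
apply: le_integral_real => [//||x|x]; [|exact: len_ge0|].
  by have /measurable_EFinP := measurable_int _ iS.
apply: (le_trans (len_vC _ _)); rewrite -/(pb x) -mulrA ler_wpM2l// -subr_ge0.
have := len_ge0 (f x); have := pbge0 x; set p := pb x; set l := len _ => p0 l0.
rewrite (_ : _ - _ = (p - l) ^+ 2 + p * l); last by ring.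
by rewrite addr_ge0 ?sqr_ge0// mulr_ge0.
Qed.

Lemma mxintegrable_src f : L2 f -> mxintegrable (src f).
Proof.
move=> Lf; have ms := msrc Lf.
apply: (mxintegrable_dom ms (g := fun x => len (src f x))).
- apply: integrable_ge0; [exact: measurable_len|by move=> x; exact: len_ge0|exact: len_src_lty].
- by move=> x i j; rewrite (ord1 j) cmod_le_len.
Qed.

Lemma BS_sum n (c : 'I_n -> C) (phi : 'I_n -> plane R -> 'cV[C]_2) :
  (forall i, L2 (phi i)) -> (forall i, {ae mu2, forall x, BS (phi i) x = 0}) ->
  {ae mu2, forall x, BS (fun y => \sum_i c i *: phi i y) x = 0}.
Proof.
move=> Lphi BS0.
have h1 : {ae mu2, forall x, forall i, BS (phi i) x = 0} by apply: filter_forall.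
have h2 : {ae mu2, forall x, forall i, mxintegrable (fun y => dsym (kvec (x - y)) *m src (phi i) y)}.
  by apply: filter_forall => i; exact: ae_integrable_potential.
apply: filterS2 h1 h2 => x e1 e2; rewrite /BS.
have -> : G00 (src (fun y => \sum_i c i *: phi i y)) x = \sum_i c i *: G00 (src (phi i)) x.
  under eq_bigr do rewrite G00E -mxintegralZ//.
  rewrite -mxintegral_sum; last by move=> i; exact: mxintegrableZ.
  rewrite G00E; congr mxintegral; apply/funext => y.
  rewrite /src !mulmx_sumr; apply: eq_bigr => i _.
  by rewrite -!scalemxAr.
rewrite !mulmx_sumr -big_split big1//= => i _.
by rewrite -!scalemxAr -scalerDr; have := e1 i; rewrite /BS => ->; rewrite scaler0.
Qed.

Lemma mxintegral_src_sum n (c : 'I_n -> C) (phi : 'I_n -> plane R -> 'cV[C]_2) :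
  (forall i, L2 (phi i)) ->
  mxintegral (fun y => (v y)^t* *m (\sum_i c i *: phi i y)) =
  \sum_i c i *: mxintegral (src (phi i)).
Proof.
move=> Lphi; have isrc i := mxintegrable_src (Lphi i).
transitivity (mxintegral (fun y => \sum_i c i *: src (phi i) y)).
  congr mxintegral; apply/funext => y; rewrite mulmx_sumr; apply: eq_bigr => i _.
  by rewrite -scalemxAr.
rewrite mxintegral_sum; last by move=> i; exact: mxintegrableZ.
by apply: eq_bigr => i _; exact: mxintegralZ.
Qed.

End BirmanSchwinger.

(** * Potentials of sources of mean zero *)

Section PotentialDecay.
Context {R : realType}.
Local Notation C := R[i].
Local Notation mu2 := (@plane_measure R).
Variables (v : plane R -> 'M[C]_2) (b K : R).
Hypotheses (mv : mxmeas v) (b2 : 2 < b) (b3 : b <= 3) (K0 : 0 <= K).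
Hypothesis len_vC : forall x u, len ((v x)^t* *m u) <= K * bracket x `^ (- (b / 2)) * len u.
Variable f : plane R -> 'cV[C]_2.
Hypothesis Lf : L2 f.
Hypothesis f_mean0 : mxintegral (fun y => (v y)^t* *m f y) = 0.

Let src (y : plane R) : 'cV[C]_2 := (v y)^t* *m f y.
Let kern (z : plane R * plane R) : R := (enorm (z.1 - z.2))^-1.
Let pd (x : plane R) : R := (bracket x)^-1.
Let qd (y : plane R) : R := bracket y * bracket y `^ (- (b / 2)).
Let wd (y : plane R) : R := bracket y `^ (b / 2).

Let kern0 z : 0 <= kern z. Proof. by rewrite invr_ge0 enorm_ge0. Qed.
Let mkern : measurable_fun setT kern.
Proof. exact: measurableT_comp (@measurable_inv_enorm R) measurable_plane_sub. Qed.
Let pd0 x : 0 < pd x. Proof. by rewrite invr_gt0 bracket_gt0. Qed.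
Let mpd : measurable_fun setT pd.
Proof. by apply: measurable_inv_ge0 => [t|]; [exact/ltW/bracket_gt0|exact: measurable_bracket]. Qed.
Let qd0 y : 0 <= qd y. Proof. by apply: mulr_ge0; [exact/ltW/bracket_gt0|exact: powR_ge0]. Qed.
Let mqd : measurable_fun setT qd.
Proof. by apply: measurable_funM; [exact: measurable_bracket|exact: measurable_bracket_powR]. Qed.
Let wd0 y : 0 < wd y. Proof. exact/powR_gt0/bracket_gt0. Qed.
Let mwd : measurable_fun setT wd. Proof. exact: measurable_bracket_powR. Qed.

Let rowsum : exists2 A : R, 0 < A & forall x, (\int[mu2]_y (kern (x, y) * (wd y)^-1)%:E <= A%:E)%E.
Proof.
have b21 : 1 < b / 2 by rewrite ltr_pdivlMr// mul1r.
have [A A0 AE] := potential_bounded b21; exists (A + 1) => [|x].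
  by rewrite ltr_pwDr.
apply: (@le_trans _ _ A%:E); last by rewrite lee_fin lerDl.
apply: le_trans (AE x); rewrite le_eqVlt; apply/orP; left; apply/eqP.
by apply: eq_integral => y _; rewrite /kern /= enormB /wd powRN.
Qed.

(** The weights combine to <y>^(2 - b/2), and 2 < b <= 3 puts the exponent in
the range of [potential_decay]. *)
Let colsum : exists2 A : R, 0 <= A & forall y,
  (\int[mu2]_x (pd x ^+ 2 * kern (x, y) * (qd y ^+ 2 * wd y))%:E <= A%:E)%E.
Proof.
have s01 : 0 < 2 - b / 2 < 1.
  by apply/andP; split; [rewrite subr_gt0 ltr_pdivrMr//|rewrite ltrBlDr -ltrBlDl ltr_pdivlMr//]; move: b2 b3; lra.
have [A A0 AE] := potential_decay s01; exists A => // y.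
apply: le_trans (AE y); rewrite le_eqVlt; apply/orP; left; apply/eqP.
apply: eq_integral => x _; congr (_%:E).
have bx := bracket_gt0 x; have by0 := bracket_gt0 y.
have -> : pd x ^+ 2 = bracket x `^ (- 2).
  by rewrite /pd exprVn powRN powR_mulrn// ltW.
have -> : qd y ^+ 2 * wd y = bracket y `^ (2 - b / 2).
  rewrite powRD; last by rewrite (gt_eqF by0) implybT.
  rewrite powR_mulrn ?(ltW by0)// /qd exprMn -mulrA; congr (_ * _).
  have -> : wd y = (bracket y `^ (- (b / 2)))^-1 by rewrite powRN invrK.
  by rewrite expr2 mulfK// gt_eqF// powR_gt0.
by rewrite mulrC.
Qed.

Let mlen : measurable_fun setT (fun y => len (f y)).
Proof. by apply: measurable_len; exact: L2_meas. Qed.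

Let msrc : mxmeas src.
Proof. by apply: mxmeasM; [exact: mxmeas_conj|exact: L2_meas]. Qed.

Let X (x : plane R) : R := \int[mu2]_y (kern (x, y) * (qd y * len (f y))).

Let X_sqr_lty : (\int[mu2]_x ((pd x * X x) ^+ 2)%:E < +oo)%E.
Proof.
have [A A0 AE] := rowsum; have [A' A'0 A'E] := colsum.
have := schur_bound mkern kern0 mwd wd0 mqd qd0 mpd pd0 A0 A'0 AE A'E mlen (fun y => len_ge0 (f y)).
by move=> /le_lt_trans; apply; rewrite lte_mul_pinfty// ?L2_lty// lee_fin mulr_ge0// ltW.
Qed.

Let X_finite : {ae mu2, forall x, (\int[mu2]_y (kern (x, y) * (qd y * len (f y)))%:E < +oo)%E}.
Proof.
have [A A0 AE] := rowsum; have [A' A'0 A'E] := colsum.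
exact: (schur_ae_finite mkern kern0 mwd wd0 mqd qd0 mpd pd0 A0 A'0 AE A'E mlen
  (fun y => len_ge0 (f y)) (L2_lty Lf)).
Qed.

Let mX : measurable_fun setT (fun x => (pd x * X x) ^+ 2).
Proof.
apply: measurable_funX; apply: measurable_funM => //.
apply: (plane_measurable_section1 (f := fun z => kern z * (qd z.2 * len (f z.2)))).
apply: measurable_funM => //.
apply: measurable_funM; first by apply: (measurableT_comp mqd); exact: measurable_snd.
by apply: (measurableT_comp mlen); exact: measurable_snd.
Qed.

(** As the source has mean zero, [dsym (kreg x)] times its integral may be
subtracted from the potential.  By [enorm_kvec_kreg] what remains has a kernel
of size <x>^-1 |x - y|^-1 <y>, to which the Schur test applies. *)
Lemma L2_potential : L2 (G00 src).
Proof.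
apply: (@L2_dom _ _ (fun x => (pd x * X x) ^+ 2) (4 * K ^+ 2)).
- by rewrite mulr_ge0// sqr_ge0.
- exact: (mxmeas_potential mv Lf).
- exact: mX.
- by move=> x; exact: sqr_ge0.
- exact: X_sqr_lty.
have aei := ae_integrable_potential mv b2 len_vC Lf.
apply: (plane_ae_imply2 aei X_finite) => x ix xfin.
have row0 y : 0 <= kern (x, y) * (qd y * len (f y)).
  by apply: mulr_ge0 => //; apply: mulr_ge0 => //; exact: len_ge0.
have mrow : measurable_fun setT (fun y => kern (x, y) * (qd y * len (f y))).
  apply: measurable_funM; first exact: (measurableT_comp mkern (pair1_measurable x)).
  exact: measurable_funM.
have irow := integrable_ge0 mrow row0 xfin.
have isrc : mxintegrable src by exact: (mxintegrable_src mv b2 K0 len_vC Lf).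
have iD : mxintegrable (fun y => dsym (kvec (x - y)) *m src y + (- dsym (kreg x)) *m src y).
  by apply: mxintegrableD => //; exact: mxintegrable_mull.
have mcs : measurable_fun setT (fun y : plane R => \1_[set~ x] y : R).
  apply: measurable_indic; apply: measurableC.
  rewrite (_ : [set x] = [set x.1] `*` [set x.2]); last first.
    by apply/seteqP; split => [_ ->|[c e] [/= -> ->]] //; case: x {ix xfin row0 mrow irow iD}.
  by apply: measurableX; exact: measurable_set1.
(* the estimate of the kernel fails on the diagonal, as [kvec 0 = 0] *)
pose F y : 'cV[C]_2 := (\1_[set~ x] y : R)%:C *: (dsym (kvec (x - y)) *m src y + (- dsym (kreg x)) *m src y).
have mF : mxmeas F.
  by apply: mxmeasZ; [exact: cmeas_real|exact: mxintegrable_meas].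
have -> : G00 src x = mxintegral F.
  rewrite G00E -[LHS]addr0 -(mulmx0 _ (- dsym (kreg x))) -[X in _ *m X]f_mean0.
  rewrite -mxintegral_mull// -mxintegralD//; last exact: mxintegrable_mull.
  apply: mxintegral_ae => //; first exact: mxintegrable_meas.
  apply: (plane_ae_imply (ae_neq x)) => y xy; rewrite /F indicE mem_set ?scale1r//=.
  by move=> yx; rewrite yx eqxx in xy.
have K20 : 0 <= K * pd x by rewrite mulr_ge0// ltW.
have i2 : mu2.-integrable setT (fun y => (K * pd x * (kern (x, y) * (qd y * len (f y))))%:E).
  by under [fun y => _]eq_fun do rewrite EFinM; exact: integrableZl.
apply: (le_trans (normsq_mxintegral mF i2 _)) => [y|].
  have rhs0 : 0 <= K * pd x * (kern (x, y) * (qd y * len (f y))) by exact: mulr_ge0.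
  rewrite /F lenZ cmod_real indicE; have [xy|xy] := eqVneq x y.
    by rewrite memNset ?normr0 ?mul0r//= => h; apply: h.
  rewrite mem_set ?normr1 ?mul1r; last by move=> /= yx; rewrite yx eqxx in xy.
  rewrite mulNmx -mulmxBl -dsymB; apply: (le_trans (len_dsym _ _)).
  apply: (le_trans (ler_pM (enorm_ge0 _) (len_ge0 _) (enorm_kvec_kreg xy) (len_vC _ _))).
  rewrite -/(pd x) -/(kern (x, y)).
  have ringE (p k c q l : R) : p * (k * c) * (K * q * l) = K * p * (k * (c * q * l)) by ring.
  by rewrite ringE.
rewrite RintegralZl// -/(X x).
have ringE (p t : R) : 4 * (K * p * t) ^+ 2 = 4 * K ^+ 2 * (p * t) ^+ 2 by ring.
by rewrite ringE.
Qed.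

End PotentialDecay.

(** * Riesz projections of symmetric operators *)

Section BoundedIntegral.
Context d (T : measurableType d) (R : realType) (mu : {measure set T -> \bar R}).
Import HBNNSimple.

(** [f] need not be measurable: the integral is a supremum over simple functions.
This matters for contour integrals, since nothing is known about the dependence
of a resolvent on its parameter. *)
Lemma integral_le_cst_mul (D : set T) (f : T -> \bar R) (M : R) : measurable D ->
  0 <= M -> (forall x, (0 <= f x)%E) -> (forall x, D x -> (f x <= M%:E)%E) ->
  (\int[mu]_(x in D) f x <= M%:E * mu D)%E.
Proof.
move=> mD M0 f0 fM; rewrite integral_mkcond ge0_integralTE; last first.
  by move=> x; rewrite patchE; case: ifP.
apply: ge_ereal_sup => _ [h hf <-].
rewrite -integralT_nnsfun -integral_cst// [leRHS]integral_mkcond.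
apply: ge0_le_integral => //.
- by move=> x _; rewrite lee_fin.
- exact/measurable_EFinP.
- by apply/(measurable_restrictT _ mD).
move=> x _; apply: (le_trans (hf x)); rewrite !patchE; case: ifPn => // /set_mem.
exact: fM.
Qed.

Lemma normr_Rintegral_le (D : set T) (u : T -> R) (M m : R) : measurable D ->
  mu D = m%:E -> 0 <= M -> (forall x, D x -> `|u x| <= M) ->
  `|\int[mu]_(x in D) u x| <= M * m.
Proof.
move=> mD Dm M0 uM; rewrite /Rintegral integralE.
have Mm (f : T -> \bar R) : (forall x, (0 <= f x)%E) -> (forall x, D x -> (f x <= M%:E)%E) ->
    exists2 r : R, 0 <= r <= M * m & (\int[mu]_(x in D) f x = r%:E)%E.
  move=> f0 fM; have := integral_le_cst_mul mD M0 f0 fM; rewrite Dm -EFinM.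
  have : (0 <= \int[mu]_(x in D) f x)%E by exact: integral_ge0.
  case: (\int[mu]_(x in D) f x)%E => [r| |]// r0 rM; exists r => //.
  by rewrite -!lee_fin r0 rM.
have [||p /andP[p0 pM] ->] := Mm ((EFin \o u)^\+%E).
- by move=> x; exact: funepos_ge0.
- move=> x Dx; rewrite funeposE /= -EFin_max lee_fin ge_max M0 andbT.
  exact: le_trans (ler_norm _) (uM x Dx).
have [||q /andP[q0 qM] ->] := Mm ((EFin \o u)^\-%E).
- by move=> x; exact: funeneg_ge0.
- move=> x Dx; rewrite funenegE /= -EFin_max lee_fin ge_max M0 andbT.
  by rewrite (le_trans _ (uM x Dx))// -normrN ler_norm.
by rewrite /= ler_norml; apply/andP; split; lra.
Qed.

End BoundedIntegral.

Section RieszProjection.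
Context {R : realType}.
Local Notation C := R[i].
Local Notation mu2 := (@plane_measure R).
Local Notation field := (plane R -> 'cV[C]_2).
Variables (A S : field -> field).
Hypothesis L2A : forall f, L2 f -> L2 (A f).
Hypothesis symA : forall f g, L2 f -> L2 g -> inner g (A f) = inner (A g) f.

Lemma cmod_circle_integral (rho M : R) (h : C -> C) : 0 <= rho -> 0 <= M ->
  (forall z, cmod z = rho -> cmod (h z) <= M) ->
  cmod (circle_integral rho h) <= 2 * (rho * M * (2 * pi)).
Proof.
move=> rho0 M0 hM.
have mI : @lebesgue_measure R `[0, 2 * pi]%classic = (2 * pi)%:E.
  rewrite lebesgue_measure_itv/= lte_fin mulr_gt0 ?pi_gt0//.
  by rewrite -EFinB subr0.
have zc (t : R) : cmod (rho%:C * (cos t +i* sin t)) = rho.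
  by rewrite cmodM cmod_real ger0_norm// /cmod/= cos2Dsin2 sqrtr1 mulr1.
have ic : cmod 'i%C = 1 :> R by rewrite /cmod/= expr0n expr1n add0r sqrtr1.
have bnd (t : R) : cmod (h (rho%:C * (cos t +i* sin t)) * ('i%C * (rho%:C * (cos t +i* sin t))))
    <= rho * M.
  by rewrite cmodM cmodM zc ic mul1r mulrC ler_wpM2l// hM.
have rM : 0 <= rho * M by exact: mulr_ge0.
rewrite [circle_integral _ _]complexE; apply: (le_trans (cmodD _ _)).
rewrite cmodM !cmod_real ic mul1r mulr_natl mulr2n; apply: lerD.
- apply: normr_Rintegral_le => // t _; apply: le_trans (bnd t).
  exact: Re_le_cmod.
- apply: normr_Rintegral_le => // t _; apply: le_trans (bnd t).
  exact: Im_le_cmod.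
Qed.

Lemma innerDl (f g h : field) : L2 f -> L2 g -> L2 h ->
  inner (fun x => f x + g x) h = inner f h + inner g h.
Proof.
move=> Lf Lg Lh; rewrite (inner_conj Lh (L2D Lf Lg)) innerD//.
by rewrite [LHS]rmorphD/= -!inner_conj.
Qed.

Lemma innerZl (c : C) (f h : field) : L2 f -> L2 h ->
  inner (fun x => c *: f x) h = Num.conj c * inner f h.
Proof.
move=> Lf Lh; rewrite (inner_conj Lh (L2Z c Lf)) innerZ//.
by rewrite [LHS]rmorphM/= -inner_conj.
Qed.

(** The inner product of [q] with [A q] is real, so that the imaginary part of
that of [q] with [f] is - Im z |q|^2. *)
Lemma resolvent_bound (z : C) (q f : field) : L2 q -> L2 f ->
  ae_eq2 (fun x => A q x - z *: q x) f ->
  complex.Im z ^+ 2 * L2norm2 q <= 16 * L2norm2 f.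
Proof.
move=> Lq Lf qf; set y := complex.Im z.
have LAq : L2 (fun x => A q x - z *: q x) by apply: L2D; [exact: L2A|exact/L2N/L2Z].
have qfE : inner q f = inner q (A q) - z * inner q q.
  rewrite -(inner_ae Lq LAq Lf qf) (innerD Lq (L2A Lq) (L2N (L2Z z Lq))).
  congr (_ + _); rewrite -mulNr -(innerZ (- z) Lq Lq).
  by under [fun x => - _]eq_fun do rewrite -scaleNr.
have im0 : complex.Im (inner q (A q)) = 0.
  have := cImJ (inner q (A q)); rewrite -(inner_conj Lq (L2A Lq)) -symA// => e.
  by move: e; set t := complex.Im _ => e; lra.
have imE : complex.Im (inner q f) = - (y * L2norm2 q).
  by rewrite qfE cImD im0 cImN cImM inner_self /= mulr0 add0r -/y add0r.
have Nq := L2norm2_ge0 q; have Nf := L2norm2_ge0 f.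
have le1 := @cmod_inner_le R (fun x => (y / 4)%:C *: q x) f (L2Z _ Lq) Lf.
rewrite (innerZl _ Lq Lf) cmodM cmod_conj (L2norm2Z _ Lq) cmod_real in le1.
have le2 : `|y| * L2norm2 q <= cmod (inner q f).
  by apply: le_trans (Im_le_cmod _); rewrite imE normrN normrM (ger0_norm Nq).
have le3 := ler_wpM2l (normr_ge0 (y / 4)) le2.
have := le_trans le3 le1.
have -> : `|y / 4| = `|y| / 4 by rewrite normrM [`|4^-1|]ger0_norm.
rewrite -[y ^+ 2]real_normK ?num_real//.
move: Nq Nf; move: (L2norm2 q) (L2norm2 f) (`|y|) => n m a n0 m0.
rewrite (_ : a / 4 * (a * n) = a ^+ 2 * n / 4); last by ring.
rewrite (_ : (a / 4) ^+ 2 * n = a ^+ 2 * n / 16); last by field.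
by set t := a ^+ 2 * n; lra.
Qed.

Variables (z : C) (q f : field).
Hypotheses (Lq : L2 q) (Lf : L2 f) (qf : ae_eq2 (fun x => A q x - z *: q x) f).

Lemma inner_shift (g : field) : L2 g -> inner (A g) q = inner g f + z * inner g q.
Proof.
move=> Lg; rewrite -symA//.
have LAq : L2 (fun x => A q x - z *: q x) by apply: L2D; [exact: L2A|exact/L2N/L2Z].
rewrite -(inner_ae Lg LAq Lf qf) (innerD Lg (L2A Lq) (L2N (L2Z z Lq))).
rewrite -(innerZ z Lg Lq) -addrA -(innerD Lg (L2N (L2Z z Lq)) (L2Z z Lq)).
have -> : (fun x => - (z *: q x) + z *: q x) = (fun x => 0 *: q x).
  by apply/funext => x; rewrite addNr scale0r.
by rewrite (innerZ 0 Lg Lq) mul0r addr0.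
Qed.

(** Commuting A^2 - |z|^2 with the resolvent [q] of [f] leaves
(z^2 - |z|^2) <g, q> and bounded terms, and z^2 - |z|^2 = 2 i z Im z compensates
the growth of [q] given by [resolvent_bound]. *)
Lemma cmod_inner_resolvent (rho : R) (g : field) : L2 g -> cmod z = rho -> rho <= 1 ->
  cmod (inner (fun x => A (A g) x + (- (rho ^+ 2)%:C) *: g x) q) <=
  6 * L2norm2 g + 68 * L2norm2 f + 2 * L2norm2 (A g).
Proof.
move=> Lg zr r1; have r0 : 0 <= rho by rewrite -zr cmod_ge0.
have LAg := L2A Lg; have LAAg := L2A LAg.
set y := complex.Im z.
have zz : z * z - (rho ^+ 2)%:C = (2 * y)%:C * ('i%C * z).
  rewrite -zr sqr_cmod /y; case: (z) => a e /=.
  by apply: complex_eq => /=; ring.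
have -> : inner (fun x => A (A g) x + (- (rho ^+ 2)%:C) *: g x) q =
    2%:C * ('i%C * z) * inner g (fun x => y%:C *: q x) + (z * inner g f + inner (A g) f).
  rewrite (innerDl LAAg (L2Z _ Lg) Lq) (innerZl _ Lg Lq) (inner_shift LAg) (inner_shift Lg).
  rewrite (innerZ _ Lg Lq).
  have -> : Num.conj (- (rho ^+ 2)%:C : C) = - (rho ^+ 2)%:C.
    by apply: complex_eq => /=; rewrite ?oppr0.
  have -> : z * (inner g f + z * inner g q) = z * z * inner g q + z * inner g f by ring.
  have -> : z * z = (2 * y)%:C * ('i%C * z) + (rho ^+ 2)%:C by rewrite -zz subrK.
  have -> : (2 * y)%:C = 2%:C * y%:C :> C by rewrite rmorphM.
  move: (inner g q) (inner g f) (inner _ f) (2%:C : C) (y%:C : C) ('i%C * z : C) (rho ^+ 2)%:C.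
  by move=> a1 a2 a3 a4 a5 a6 a7; ring.
have ic : cmod 'i%C = 1 :> R by rewrite /cmod/= expr0n expr1n add0r sqrtr1.
apply: (le_trans (cmodD _ _)).
have b1 : cmod (inner g (fun x => y%:C *: q x)) <= 2 * (L2norm2 g + 16 * L2norm2 f).
  apply: (le_trans (cmod_inner_le Lg (L2Z _ Lq))); rewrite ler_wpM2l// lerD2l.
  rewrite (L2norm2Z _ Lq) cmod_real real_normK ?num_real//.
  exact: resolvent_bound.
have b2 := cmod_inner_le Lg Lf.
have b3 := cmod_inner_le LAg Lf.
have N1 := L2norm2_ge0 g; have N2 := L2norm2_ge0 f; have N3 := L2norm2_ge0 (A g).
have c1 : cmod (2%:C * ('i%C * z) * inner g (fun x => y%:C *: q x)) <=
    2 * (2 * (L2norm2 g + 16 * L2norm2 f)).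
  rewrite !cmodM zr ic mul1r cmod_real ger0_norm// -mulrA ler_wpM2l//.
  by apply: le_trans b1; rewrite ler_piMl// cmod_ge0.
have c2 : cmod (z * inner g f + inner (A g) f) <=
    2 * (L2norm2 g + L2norm2 f) + 2 * (L2norm2 (A g) + L2norm2 f).
  apply: (le_trans (cmodD _ _)); apply: lerD => //.
  by rewrite cmodM zr; apply: le_trans b2; rewrite ler_piMl// cmod_ge0.
apply: (le_trans (lerD c1 c2)).
move: N1 N2 N3; move: (L2norm2 g) (L2norm2 f) (L2norm2 (A g)) => a c e.
by clear b1 b2 b3 c1 c2 zz ic => N1 N2 N3; lra.
Qed.

End RieszProjection.

Section RieszRange.
Context {R : realType}.
Local Notation C := R[i].
Local Notation mu2 := (@plane_measure R).
Local Notation field := (plane R -> 'cV[C]_2).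
Variables (A S : field -> field).
Hypothesis L2A : forall f, L2 f -> L2 (A f).
Hypothesis symA : forall f g, L2 f -> L2 g -> inner g (A f) = inner (A g) f.
Hypothesis SA : riesz_projection_at0 A S.

(** By [cmod_inner_resolvent] the integrand for (A^2 - rho^2) g is bounded
uniformly in rho, hence its integral over the circle of radius rho is O(rho); so
is the correction rho^2 <g, S f>. *)
Lemma riesz_sqr_zero (f g : field) : L2 f -> L2 g -> inner (A (A g)) (S f) = 0.
Proof.
move=> Lf Lg; have [L2S [r r0 [Q [resQ Sint]]]] := SA.
have LSf := L2S _ Lf.
have LAAg : L2 (A (A g)) by do 2 apply: L2A.
pose C0 := 6 * L2norm2 g + 68 * L2norm2 f + 2 * L2norm2 (A g).
have C00 : 0 <= C0.
  by rewrite !addr_ge0// mulr_ge0// L2norm2_ge0.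
pose D0 := cmod (inner g (S f)).
have D00 : 0 <= D0 by exact: cmod_ge0.
have small (rho : R) : 0 < rho -> rho <= r -> rho <= 1 ->
    cmod (inner (A (A g)) (S f)) <= (2 * C0 + D0) * rho.
  move=> rho0 rhor rho1.
  pose g' : field := fun x => A (A g) x + (- (rho ^+ 2)%:C) *: g x.
  have Lg' : L2 g' by apply: L2D => //; exact: L2Z.
  have rhoI : 0 < rho <= r by rewrite rho0 rhor.
  have SfE := Sint rho rhoI f g' Lf Lg'.
  have ci : cmod (circle_integral rho (fun z => inner g' (Q z f))) <= 2 * (rho * C0 * (2 * pi)).
    apply: cmod_circle_integral => [||z zrho]; [exact: ltW|exact: C00|].
    have z0r : 0 < `|z| <= r%:C by rewrite -cmodE ltcR lecR zrho.
    have [LQ _ eqQ _] := resQ z z0r.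
    exact: (cmod_inner_resolvent L2A symA (LQ _ Lf) Lf (eqQ _ Lf) Lg zrho rho1).
  have ic : cmod 'i%C = 1 :> R by rewrite /cmod/= expr0n expr1n add0r sqrtr1.
  have pi2 : 0 < 2 * pi :> R by rewrite mulr_gt0// pi_gt0.
  have cinv : cmod (- ('i%C * (2 * pi)%:C)^-1) = (2 * pi)^-1 :> R.
    apply: (@mulIf _ (2 * pi)); first by rewrite gt_eqF.
    rewrite mulVf ?gt_eqF//.
    have {2}-> : 2 * pi = cmod (- ('i%C * (2 * pi)%:C)) :> R.
      by rewrite -mulN1r !cmodM ic cmod_real ger0_norm ?(ltW pi2)// mul1r
        (_ : cmod (-1) = 1) ?mul1r// /cmod/= sqrrN expr1n oppr0 expr0n/= addr0 sqrtr1.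
    rewrite -cmodM mulrNN mulVf; first by rewrite /cmod/= expr1n expr0n/= addr0 sqrtr1.
    by rewrite mulf_neq0// ?eq_complex/= ?eqxx ?oner_eq0 ?andbF// (gt_eqF pi2).
  have g'S : cmod (inner g' (S f)) <= 2 * C0 * rho.
    rewrite SfE cmodM cinv mulrC ler_pdivrMr//; apply: (le_trans ci).
    by rewrite le_eqVlt; apply/orP; left; apply/eqP; ring.
  have -> : inner (A (A g)) (S f) = inner g' (S f) + (rho ^+ 2)%:C * inner g (S f).
    rewrite /g' (innerDl LAAg (L2Z _ Lg) LSf) (innerZl _ Lg LSf).
    have -> : Num.conj (- (rho ^+ 2)%:C : C) = - (rho ^+ 2)%:C.
      by apply: complex_eq => /=; rewrite ?oppr0.
    by rewrite mulNr subrK.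
  apply: (le_trans (cmodD _ _)); rewrite mulrDl; apply: lerD => //.
  rewrite cmodM cmod_real ger0_norm ?sqr_ge0// mulrC -/D0 ler_wpM2l//.
  by rewrite expr2 ler_piMl// ltW.
set E0 := 2 * C0 + D0 in small.
have E00 : 0 <= E0 by rewrite addr_ge0// mulr_ge0.
set t := cmod _ in small.
have t0 : t = 0.
  apply/eqP; rewrite eq_le cmod_ge0 andbT leNgt; apply/negP => tpos.
  (* so small that [small] gives a bound less than [t] *)
  pose rho := Num.min (Num.min r 1) (t / (2 * (E0 + 1))).
  have E1 : 0 < 2 * (E0 + 1) by rewrite mulr_gt0// ltr_wpDl.
  have rho0 : 0 < rho by rewrite !lt_min r0 ltr01 divr_gt0.
  have rr : rho <= r by rewrite !ge_min lexx.
  have r1 : rho <= 1 by rewrite !ge_min lexx orbT.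
  have := small rho rho0 rr r1.
  apply/negP; rewrite -ltNge; apply: (@le_lt_trans _ _ (E0 * (t / (2 * (E0 + 1))))).
    by rewrite ler_wpM2l// ge_min lexx orbT.
  rewrite mulrA ltr_pdivrMr// mulrC ltr_pM2l//; lra.
have := t0; rewrite /t /cmod => /eqP; rewrite sqrtr_eq0 => h.
have : complex.Re (inner (A (A g)) (S f)) ^+ 2 + complex.Im (inner (A (A g)) (S f)) ^+ 2 == 0.
  by rewrite eq_le h addr_ge0// sqr_ge0.
rewrite paddr_eq0 ?sqr_ge0// !sqrf_eq0 => /andP[/eqP a /eqP e].
exact: complex_eq.
Qed.

(** The square of the norm of A S f is <A^2 S f, S f>. *)
Lemma riesz_range_kernel (f : field) : L2 f -> {ae mu2, forall x, A (S f) x = 0}.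
Proof.
move=> Lf; have [L2S _] := SA; have LSf := L2S _ Lf; have LASf := L2A LSf.
apply: L2norm2_eq0 => //; apply: complexI; rewrite -inner_self.
by rewrite (symA LSf LASf) riesz_sqr_zero.
Qed.

End RieszRange.

(** * The fundamental theorem of calculus on a square *)

Section BoxIntegral.
Context {R : realType}.
Local Notation mu1 := (@lebesgue_measure R).
Local Notation mu2 := (@plane_measure R).

Section Iterated.
Variable f : plane R -> R.
Hypothesis mf : measurable_fun setT f.
Hypothesis f_fin : (\int[mu2]_z `|f z|%:E < +oo)%E.

Let f_fin1 : (\int[mu1]_x \int[mu1]_y `|f (x, y)|%:E < +oo)%E.
Proof.
move: f_fin; rewrite (@ge0_integral_planeE _ (fun z => `|f z|%:E))//.
by apply/measurable_EFinP; exact: measurableT_comp.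
Qed.

Lemma plane_Rintegral1 : \int[mu2]_z f z = \int[mu1]_x \int[mu1]_y f (x, y).
Proof.
have intf : ((mu1 \x mu1)%E).-integrable setT (EFin \o f).
  by apply/integrable12ltyP => //; exact/measurable_EFinP.
congr fine; rewrite -[LHS]/(\int[(mu1 \x mu1)%E]_z (EFin \o f) z)%E.
rewrite -(integral12_prod_meas1 intf); apply: ae_eq_integral => //.
- exact: (measurable_fubini_F intf).
- exact/measurable_EFinP/(@measurable_Rintegral_section1 _ _ _ _ _ mu1).
apply: filterS (@ae_integrable_section1 _ _ _ _ _ mu1 mu1 f mf f_fin1) => x ix _.
by rewrite /Rintegral fineK//; exact: integrable_fin_num.
Qed.

Lemma plane_Rintegral2 : \int[mu2]_z f z = \int[mu1]_y \int[mu1]_x f (x, y).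
Proof. by rewrite plane_Rintegral1; exact: Rintegral_fubini. Qed.

End Iterated.

Lemma Rintegral_FTC (N : R) (F F1 : R -> R) : 0 < N ->
  (forall t : R, is_derive t 1 F (F1 t)) -> continuous F1 ->
  \int[mu1]_(t in `[- N, N]) F1 t = F N - F (- N).
Proof.
move=> N0 dF cF1; rewrite /Rintegral (@continuous_FTC2 _ F1 F)//; first lra.
- exact: continuous_subspaceT.
- have cF : continuous F.
    by move=> t; apply: differentiable_continuous; apply/derivable1_diffP; have [] := dF t.
  split.
  + by move=> t _; have [] := dF t.
  + by apply: cvg_at_right_filter; exact: cF.
  + by apply: cvg_at_left_filter; exact: cF.
- by move=> t _; rewrite derive1E; have [_ ->] := dF t.
Qed.

Lemma ae_neq0 : {ae mu1, forall s : measurableTypeR R, s != 0}.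
Proof.
exists [set 0]; split; [exact: measurable_set1|exact: lebesgue_measure_set1|].
by move=> y /= /negP; rewrite negbK => /eqP.
Qed.

Lemma indic_box (N a b : R) : \1_(box N) (a, b) = \1_`[- N, N] a * \1_`[- N, N] b :> R.
Proof.
rewrite !indicE -natrM mulnb; congr (_ %:R); congr nat_of_bool.
have IE (r : R) : (r \in (`[- N, N]%classic : set R)) = (`|r| <= N).
  by apply/idP/idP => [/set_mem|rN]; [|apply/mem_set]; rewrite /= in_itv/= -ler_norml.
rewrite !IE; apply/idP/andP => [/set_mem|[aN bN]].
  by rewrite /box/= /supn ge_max => /andP.
by apply/mem_set; rewrite /box/= /supn ge_max aN.
Qed.

(** Integration along lines, indexed by [s] and parametrized by [t].  The line
[s = 0] is excluded since it meets the singularity of the kernel. *)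
Section Lines.
Variables (N : R) (F F1 : R -> R -> R) (bd : R -> R).
Hypotheses (N0 : 0 < N) (cbd : continuous bd).
Hypothesis dF : forall s t : R, s != 0 -> is_derive t 1 (F s) (F1 s t).
Hypothesis cF1 : forall s : R, s != 0 -> continuous (F1 s).
Hypothesis Fbd : forall s : R, s != 0 -> F s N - F s (- N) = bd s.
Local Notation I := (`[- N, N]%classic : set R).

Lemma iterated_FTC (g : R -> R -> R) :
  measurable_fun setT (fun s : measurableTypeR R => \int[mu1]_t g s t) ->
  (forall s t, g s t = \1_I s * \1_I t * F1 s t) ->
  \int[mu1]_s \int[mu1]_t g s t = \int[mu1]_(s in I) bd s.
Proof.
move=> mg gE; rewrite [RHS]Rintegral_mkcond; congr fine.
apply: ae_eq_integral => //.
- exact/measurable_EFinP.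
- apply/measurable_EFinP/(measurable_restrictT _ (measurable_itv _)).
  by apply: measurable_funTS; exact: continuous_measurable_fun.
apply: filterS ae_neq0 => s s0 _; congr EFin.
rewrite patchE; case: ifPn => sI; last first.
  transitivity (\int[mu1]_t (0 : R)); last by rewrite /Rintegral integral0.
  by apply: eq_Rintegral => t _; rewrite gE indicE (negbTE sI) !mul0r.
rewrite -(Fbd s0) -(Rintegral_FTC N0 (fun t => @dF s t s0) (@cF1 s s0)) [RHS]Rintegral_mkcond.
congr fine; apply: eq_integral => t _; congr EFin; rewrite gE !indicE sI mul1r patchE.
by case: ifP; rewrite (mul1r, mul0r).
Qed.

Variable G : plane R -> R.
Hypothesis mG : measurable_fun setT G.
Hypothesis G_fin : (\int[mu2]_z `|G z|%:E < +oo)%E.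

Lemma box_FTC1 : (forall s t, G (t, s) = \1_(box N) (t, s) * F1 s t) ->
  \int[mu2]_z G z = \int[mu1]_(s in I) bd s.
Proof.
move=> GE; rewrite (plane_Rintegral2 mG G_fin).
apply: iterated_FTC; first exact: (@measurable_Rintegral_section2 _ _ _ _ _ mu1).
by move=> s t; rewrite GE indic_box mulrC [_ * \1_I t]mulrC mulrC.
Qed.

Lemma box_FTC2 : (forall s t, G (s, t) = \1_(box N) (s, t) * F1 s t) ->
  \int[mu2]_z G z = \int[mu1]_(s in I) bd s.
Proof.
move=> GE; rewrite (plane_Rintegral1 mG G_fin).
apply: iterated_FTC; first exact: (@measurable_Rintegral_section1 _ _ _ _ _ mu1).
by move=> s t; rewrite GE indic_box.
Qed.

End Lines.

(** The flux of [kvec] through two opposite sides of a square. *)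
Lemma arctan_integral (N : R) : 0 < N ->
  \int[mu1]_(s in `[- N, N]) (2 * N / (N ^+ 2 + s ^+ 2)) = pi.
Proof.
move=> N0; have N2 : 0 < N ^+ 2 by rewrite exprn_gt0.
have D0 s : N ^+ 2 + s ^+ 2 != 0 by rewrite gt_eqF// ltr_pwDl// sqr_ge0.
have dF (t : R) : is_derive t 1 (fun s : R => 2 * atan (N^-1 * s)) (2 * N / (N ^+ 2 + t ^+ 2)).
  have d1 : is_derive t 1 (fun s : R => N^-1 * s) (N^-1).
    by apply: is_derive_eq; rewrite /GRing.scale/= mulr1.
  have d2 : is_derive t 1 (atan \o (fun s : R => N^-1 * s)) (N^-1 * (1 + (N^-1 * t) ^+ 2)^-1).
    by apply: is_derive_eq; rewrite /GRing.scale/= mulrC.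
  have D1 : N ^+ 2 + t ^+ 2 != 0 by exact: D0.
  have d3 := @is_deriveZ _ _ _ _ 2 _ _ _ d2.
  apply: (@is_derive_eq _ _ _ _ _ _ _ _ d3).
  rewrite /GRing.scale/= exprMn exprVn; field.
  by rewrite D1 gt_eqF//= expr2 mulf_eq0.
rewrite (Rintegral_FTC N0 dF) => [|t].
  by rewrite mulrN mulVf ?gt_eqF// atanN atan1; field.
apply: cvgM; first exact: cvg_cst.
apply: cvgV; first exact: D0.
by apply: cvgD; [exact: cvg_cst|exact: exprn_continuous].
Qed.

End BoxIntegral.

(** * Restrictions of the kernel to lines *)

Section LineKernels.
Context {R : realType}.

Lemma sum_sqr_neq0 (s t : R) : s != 0 -> t ^+ 2 + s ^+ 2 != 0.
Proof. by move=> s0; rewrite gt_eqF// ltr_wpDl ?sqr_ge0// exprn_even_gt0. Qed.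

Lemma continuous_div (f g : R -> R) : continuous f -> continuous g ->
  (forall t, g t != 0) -> continuous (fun t => f t / g t).
Proof.
by move=> cf cg g0 t; apply: cvgM; [exact: cf|apply: cvgV; [exact: g0|exact: cg]].
Qed.

Lemma is_derive_continuous (f df : R -> R) :
  (forall t : R, is_derive t 1 f (df t)) -> continuous f.
Proof.
by move=> d t; apply: differentiable_continuous; apply/derivable1_diffP; have [] := d t.
Qed.

Lemma continuous_sumsqr (s : R) : continuous (fun t : R => t ^+ 2 + s ^+ 2).
Proof. by move=> t; apply: cvgD; [exact: exprn_continuous|exact: cvg_cst]. Qed.

Lemma is_derive_radial (s t : R) : s != 0 ->
  is_derive t 1 (fun t : R => t / (t ^+ 2 + s ^+ 2))
    ((s ^+ 2 - t ^+ 2) / (t ^+ 2 + s ^+ 2) ^+ 2).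
Proof.
move=> s0; have D0 := sum_sqr_neq0 t s0.
have d1 : is_derive t 1 (fun t : R => t ^+ 2 + s ^+ 2) (2 * t).
  by apply: is_derive_eq; rewrite /GRing.scale/= addr0 mulr1 mulr2n; ring.
have d2 := @is_deriveV _ (fun t : R => t ^+ 2 + s ^+ 2) t _ 1 D0 d1.
have d3 := @is_deriveM _ _ _ _ _ _ _ _ (is_derive_id t 1) d2.
apply: (@is_derive_eq _ _ _ _ _ _ _ _ d3).
by rewrite /GRing.scale/=; field.
Qed.

Lemma is_derive_tangential (s t : R) : s != 0 ->
  is_derive t 1 (fun t : R => s / (t ^+ 2 + s ^+ 2))
    (- (2 * t * s) / (t ^+ 2 + s ^+ 2) ^+ 2).
Proof.
move=> s0; have D0 := sum_sqr_neq0 t s0.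
have d1 : is_derive t 1 (fun t : R => t ^+ 2 + s ^+ 2) (2 * t).
  by apply: is_derive_eq; rewrite /GRing.scale/= addr0 mulr1 mulr2n; ring.
have d2 := @is_deriveV _ (fun t : R => t ^+ 2 + s ^+ 2) t _ 1 D0 d1.
have d3 := @is_deriveM _ _ _ _ _ _ _ _ (is_derive_cst s t 1) d2.
apply: (@is_derive_eq _ _ _ _ _ _ _ _ d3).
by rewrite /GRing.scale/=; field.
Qed.

Lemma continuous_radial1 (s : R) : s != 0 ->
  continuous (fun t : R => (s ^+ 2 - t ^+ 2) / (t ^+ 2 + s ^+ 2) ^+ 2).
Proof.
move=> s0; apply: continuous_div => [t|t|t]; last by rewrite expf_neq0// sum_sqr_neq0.
- by apply: cvgB; [exact: cvg_cst|exact: exprn_continuous].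
- by apply: (@continuous_comp _ _ _ (fun t : R => t ^+ 2 + s ^+ 2) (fun u : R => u ^+ 2)); [exact: continuous_sumsqr|exact: exprn_continuous].
Qed.

Lemma continuous_tangential1 (s : R) : s != 0 ->
  continuous (fun t : R => - (2 * t * s) / (t ^+ 2 + s ^+ 2) ^+ 2).
Proof.
move=> s0; apply: continuous_div => [t|t|t]; last by rewrite expf_neq0// sum_sqr_neq0.
- apply: cvgN; apply: cvgM; last exact: cvg_cst.
  by apply: cvgM; [exact: cvg_cst|exact: cvg_id].
- by apply: (@continuous_comp _ _ _ (fun t : R => t ^+ 2 + s ^+ 2) (fun u : R => u ^+ 2)); [exact: continuous_sumsqr|exact: exprn_continuous].
Qed.

Section Product.
Variables (h h1 k k1 : R -> R) (c0 : R).
Hypotheses (dh : forall t : R, is_derive t 1 h (h1 t)) (ch1 : continuous h1).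
Hypotheses (dk : forall t : R, is_derive t 1 k (k1 t)) (ck1 : continuous k1).

Lemma is_derive_shift_mul (t : R) :
  is_derive t 1 (fun t : R => (h t - c0) * k t) (h1 t * k t + (h t - c0) * k1 t).
Proof.
have d1 := @is_deriveB _ _ _ _ _ _ _ _ _ (dh t) (is_derive_cst c0 t 1).
have d3 := @is_deriveM _ _ _ _ _ _ _ _ d1 (dk t).
apply: (@is_derive_eq _ _ _ _ _ _ _ _ d3).
by rewrite -[(h - cst c0) t]/(h t - c0) /GRing.scale/=; ring.
Qed.

Lemma continuous_shift_mul :
  continuous (fun t : R => h1 t * k t + (h t - c0) * k1 t).
Proof.
have ch := is_derive_continuous dh; have ck := is_derive_continuous dk.
move=> t; apply: cvgD; first by apply: cvgM; [exact: ch1|exact: ck].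
by apply: cvgM; [apply: cvgB; [exact: ch|exact: cvg_cst]|exact: ck1].
Qed.

End Product.
End LineKernels.

(** * Divergence and curl of the kernel at the origin *)

Section FundamentalSolution.
Context {R : realType}.
Local Notation mu1 := (@lebesgue_measure R).
Local Notation mu2 := (@plane_measure R).

Lemma mean_value_bound (h h1 : R -> R) (M t : R) : (forall t : R, is_derive t 1 h (h1 t)) ->
  (forall t, `|h1 t| <= M) -> `|h t - h 0| <= M * `|t|.
Proof.
move=> dh hM; have ch := is_derive_continuous dh.
have key (a b : R) : a <= b -> `|h b - h a| <= M * (b - a).
  move=> ab; have [|c _ ->] := @MVT_segment _ h h1 a b ab (fun u _ => dh u).
  - exact: continuous_subspaceT.
  - by rewrite normrM [`|b - a|]ger0_norm ?subr_ge0// ler_wpM2r// subr_ge0.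
have [t0|/ltW t0] := leP 0 t.
  by have := key 0 t t0; rewrite subr0 (ger0_norm t0).
by have := key t 0 t0; rewrite distrC sub0r (ler0_norm t0).
Qed.

Lemma continuous_section1 (f : R * R -> R) (s : R) :
  continuous f -> continuous (fun t : R => f (t, s)).
Proof.
move=> cf t; apply: (@continuous_comp _ _ _ (fun t : R => (t, s)) f); last exact: cf.
exact: (cvg_pair (F := nbhs t) (G := nbhs t) (H := nbhs s) cvg_id (cvg_cst s)).
Qed.

Lemma continuous_section2 (f : R * R -> R) (s : R) :
  continuous f -> continuous (fun t : R => f (s, t)).
Proof.
move=> cf t; apply: (@continuous_comp _ _ _ (fun t : R => (s, t)) f); last exact: cf.
exact: (cvg_pair (F := nbhs t) (G := nbhs s) (H := nbhs t) (cvg_cst s) cvg_id).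
Qed.

(** A continuously differentiable function supported in the square of radius [N],
with a bound [M] on its partial derivatives [chi1] and [chi2]. *)
Record C1_compact (chi chi1 chi2 : R * R -> R) (N M : R) : Prop := C1Compact {
  C1_gt0 : 0 < N;
  C1_d1 : forall s t : R, is_derive t 1 (fun t => chi (t, s)) (chi1 (t, s));
  C1_d2 : forall s t : R, is_derive t 1 (fun t => chi (s, t)) (chi2 (s, t));
  C1_cont : continuous chi;
  C1_cont1 : continuous chi1;
  C1_cont2 : continuous chi2;
  C1_supp : forall x, N <= supn x -> [/\ chi x = 0, chi1 x = 0 & chi2 x = 0];
  C1_bound : forall x, `|chi1 x| <= M /\ `|chi2 x| <= M }.

Section AtOrigin.
Variables (chi chi1 chi2 : R * R -> R) (N M : R).
Hypothesis C : C1_compact chi chi1 chi2 N M.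
Let c0 := chi (0, 0).
Let q (x : R * R) : R := x.1 ^+ 2 + x.2 ^+ 2.
Let N0 : 0 < N := C1_gt0 C.

Let M0 : 0 <= M.
Proof. by have [+ _] := C1_bound C 0; exact: le_trans. Qed.

Lemma C1_lipschitz (x : R * R) : `|chi x - c0| <= 2 * M * enorm x.
Proof.
case: x => a b; rewrite (_ : chi (a, b) - c0 =
    (chi (a, b) - chi (0, b)) + (chi (0, b) - c0)); last by rewrite addrA subrK.
apply: (le_trans (ler_normD _ _)); rewrite -mulrA mulr_natl mulr2n.
have := supn_le_enorm (a, b); rewrite ge_max /= => /andP[ea eb].
apply: lerD.
  apply: le_trans (ler_wpM2l M0 ea).
  by apply: (mean_value_bound a (C1_d1 C b)) => t; have [] := C1_bound C (t, b).
apply: le_trans (ler_wpM2l M0 eb).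
by apply: (mean_value_bound b (C1_d2 C 0)) => t; have [] := C1_bound C (0, t).
Qed.

(** One of the derivatives of a component of (chi - chi 0) [kvec], by the product
rule.  Both terms are of order |x|^-1: [u / q] is a component of [kvec], and
[w / q ^+ 2], a derivative of such a component, is of order |x|^-2, while
chi - chi 0 is of order |x|. *)
Section Piece.
Variables d u w : plane R -> R.
Hypotheses (md : measurable_fun setT d) (mu : measurable_fun setT u)
  (mw : measurable_fun setT w).
Hypothesis dM : forall x, `|d x| <= M.
Hypothesis uq : forall x, `|u x| <= enorm x.
Hypothesis wq : forall x, `|w x| <= q x.
Let G x := \1_(box N) x * (d x * (u x / q x) + (chi x - c0) * (w x / q x ^+ 2)).

Let mq : measurable_fun setT (fun x : plane R => q x).
Proof.
by apply: measurable_funD; apply: measurable_funX;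
  [exact: measurable_fst_plane|exact: measurable_snd_plane].
Qed.

Lemma measurable_piece : measurable_fun setT G.
Proof.
have q0 x : 0 <= q x by rewrite addr_ge0// sqr_ge0.
apply: measurable_funM; first by apply: measurable_indic; exact: measurable_square.
apply: measurable_funD; apply: measurable_funM => //.
- by apply: measurable_funM => //; exact: measurable_inv_ge0.
- by apply: measurable_funB => //; exact: continuous_measurable_plane (C1_cont C).
- apply: measurable_funM => //; apply: measurable_inv_ge0 => [x|]; first exact: sqr_ge0.
  exact: measurable_funX.
Qed.

Lemma piece_lty : (\int[mu2]_x `|G x|%:E < +oo)%E.
Proof.
have mb := @measurable_inv_enorm_box R N.
apply: (@le_lt_trans _ _ (\int[mu2]_x (3 * M * inv_enorm_box N x)%:E)%E).
  apply: le_integral_real => [||x|x]; first by apply: measurableT_comp => //; exact: measurable_piece.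
  - by apply: measurable_funM.
  - exact: normr_ge0.
  rewrite /G /inv_enorm_box normrM [`|\1_ _ x|]ger0_norm ?indicE// [leRHS]mulrCA ler_wpM2l//.
  have := uq x; have := wq x; have := dM x; have := C1_lipschitz x.
  rewrite /q -sqr_enorm; have := enorm_ge0 x; move: (enorm x) (d x) (u x) (w x) (chi x - c0).
  move=> e dx ux wx fx; rewrite le_eqVlt => /orP[/eqP <-|e0].
    by rewrite expr0n/= expr0n/= !invr0 !mulr0 addr0 normr0.
  move=> fe de we ue; have eN : e != 0 by rewrite gt_eqF.
  apply: (le_trans (ler_normD _ _)).
  have -> : 3 * M * e^-1 = M * (e / e ^+ 2) + 2 * M * e * (e ^+ 2 / (e ^+ 2) ^+ 2) by field.
  have i0 k : 0 <= (e ^+ k)^-1 by rewrite invr_ge0 exprn_ge0// ltW.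
  rewrite !normrM -exprM [`|(e ^+ 2)^-1|]ger0_norm// [`|(e ^+ (2 * 2))^-1|]ger0_norm//.
  by apply: lerD; apply: ler_pM => //; rewrite ?mulr_ge0//; apply: ler_wpM2r.
rewrite integralZl_real//; last exact: inv_enorm_box_ge0.
  by rewrite lte_mul_pinfty ?lee_fin ?mulr_ge0//; exact: inv_enorm_box_lty.
by rewrite mulr_ge0.
Qed.

End Piece.

Let edge1 (t : R) : chi (N, t) = 0 /\ chi (- N, t) = 0.
Proof.
have NN : `|N| = N by rewrite gtr0_norm.
have e (s : R) : `|s| = N -> chi (s, t) = 0.
  by move=> sN; have [] // := C1_supp C (x := (s, t)); rewrite /supn /= sN le_max lexx.
by split; apply: e; rewrite ?normrN.
Qed.

Let edge2 (t : R) : chi (t, N) = 0 /\ chi (t, - N) = 0.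
Proof.
have NN : `|N| = N by rewrite gtr0_norm.
have e (s : R) : `|s| = N -> chi (t, s) = 0.
  by move=> sN; have [] // := C1_supp C (x := (t, s)); rewrite /supn /= sN le_max lexx orbT.
by split; apply: e; rewrite ?normrN.
Qed.

Let c1M x : `|chi1 x| <= M. Proof. by have [] := C1_bound C x. Qed.
Let c2M x : `|chi2 x| <= M. Proof. by have [] := C1_bound C x. Qed.

Let x1e (x : plane R) : `|x.1 : R| <= enorm x.
Proof. by have := supn_le_enorm x; rewrite ge_max => /andP[]. Qed.
Let x2e (x : plane R) : `|x.2 : R| <= enorm x.
Proof. by have := supn_le_enorm x; rewrite ge_max => /andP[]. Qed.

Let diffq (a b : R) : `|a ^+ 2 - b ^+ 2| <= a ^+ 2 + b ^+ 2.
Proof. by rewrite ler_norml; have := sqr_ge0 a; have := sqr_ge0 b; lra. Qed.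

Let prodq (a b : R) : `|- (2 * a * b)| <= a ^+ 2 + b ^+ 2.
Proof. by rewrite ler_norml; have := sqr_ge0 (a + b); have := sqr_ge0 (a - b); nra. Qed.

Let m1 := continuous_measurable_plane (C1_cont1 C).
Let m2 := continuous_measurable_plane (C1_cont2 C).
Let mx1 := @measurable_fst_plane R.
Let mx2 := @measurable_snd_plane R.

Let G11 (x : plane R) := \1_(box N) x *
  (chi1 x * (x.1 / q x) + (chi x - c0) * ((x.2 ^+ 2 - x.1 ^+ 2) / q x ^+ 2)).
Let G22 (x : plane R) := \1_(box N) x *
  (chi2 x * (x.2 / q x) + (chi x - c0) * ((x.1 ^+ 2 - x.2 ^+ 2) / q x ^+ 2)).
Let G12 (x : plane R) := \1_(box N) x *
  (chi1 x * (x.2 / q x) + (chi x - c0) * (- (2 * x.1 * x.2) / q x ^+ 2)).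
Let G21 (x : plane R) := \1_(box N) x *
  (chi2 x * (x.1 / q x) + (chi x - c0) * (- (2 * x.2 * x.1) / q x ^+ 2)).

Let mw12 : measurable_fun setT (fun x : plane R => (x.1 : R) ^+ 2 - x.2 ^+ 2).
Proof. by apply: measurable_funB; exact: measurable_funX. Qed.
Let mw21 : measurable_fun setT (fun x : plane R => (x.2 : R) ^+ 2 - x.1 ^+ 2).
Proof. by apply: measurable_funB; exact: measurable_funX. Qed.
Let mp12 : measurable_fun setT (fun x : plane R => - (2 * (x.1 : R) * x.2)).
Proof. by apply: measurable_funN; apply: measurable_funM => //; exact: measurable_funM. Qed.
Let mp21 : measurable_fun setT (fun x : plane R => - (2 * (x.2 : R) * x.1)).
Proof. by apply: measurable_funN; apply: measurable_funM => //; exact: measurable_funM. Qed.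

Let w12 (x : plane R) : `|(x.1 : R) ^+ 2 - x.2 ^+ 2| <= q x. Proof. exact: diffq. Qed.
Let w21 (x : plane R) : `|(x.2 : R) ^+ 2 - x.1 ^+ 2| <= q x.
Proof. by rewrite /q [leRHS]addrC; exact: diffq. Qed.
Let p12 (x : plane R) : `|- (2 * (x.1 : R) * x.2)| <= q x. Proof. exact: prodq. Qed.
Let p21 (x : plane R) : `|- (2 * (x.2 : R) * x.1)| <= q x.
Proof. by rewrite /q [leRHS]addrC; exact: prodq. Qed.

Let mG11 : measurable_fun setT G11. Proof. exact: measurable_piece. Qed.
Let mG22 : measurable_fun setT G22. Proof. exact: measurable_piece. Qed.
Let mG12 : measurable_fun setT G12. Proof. exact: measurable_piece. Qed.
Let mG21 : measurable_fun setT G21. Proof. exact: measurable_piece. Qed.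
Let fG11 : (\int[mu2]_x `|G11 x|%:E < +oo)%E. Proof. exact: piece_lty. Qed.
Let fG22 : (\int[mu2]_x `|G22 x|%:E < +oo)%E. Proof. exact: piece_lty. Qed.
Let fG12 : (\int[mu2]_x `|G12 x|%:E < +oo)%E. Proof. exact: piece_lty. Qed.
Let fG21 : (\int[mu2]_x `|G21 x|%:E < +oo)%E. Proof. exact: piece_lty. Qed.

Let D0 s : N ^+ 2 + s ^+ 2 != 0.
Proof. by rewrite gt_eqF// ltr_pwDl ?sqr_ge0// exprn_gt0. Qed.

Let bd (s : R) := - c0 * (2 * N / (N ^+ 2 + s ^+ 2)).

Let cden : continuous (fun s : R => 2 * N / (N ^+ 2 + s ^+ 2)).
Proof.
apply: continuous_div => [t|t|t]; [exact: cvg_cst| |exact: D0].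
by apply: cvgD; [exact: cvg_cst|exact: exprn_continuous].
Qed.

Let cbd : continuous bd.
Proof. by move=> t; apply: cvgM; [exact: cvg_cst|exact: cden]. Qed.

Let int_bd : \int[mu1]_(s in `[- N, N]) bd s = - c0 * pi.
Proof.
rewrite RintegralZl//; first by rewrite (arctan_integral N0).
apply: (@continuous_compact_integrable R (fun s : R => 2 * N / (N ^+ 2 + s ^+ 2))).
  exact: segment_compact.
exact: continuous_subspaceT cden.
Qed.

Let int0 : \int[mu1]_(s in `[- N, N]) (0 : R) = 0.
Proof. by rewrite /Rintegral integral0. Qed.

Let I11 : \int[mu2]_x G11 x = - c0 * pi.
Proof.
rewrite -int_bd; apply: (@box_FTC1 _ N (fun s t => (chi (t, s) - c0) * (t / (t ^+ 2 + s ^+ 2)))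
  (fun s t => chi1 (t, s) * (t / (t ^+ 2 + s ^+ 2)) +
     (chi (t, s) - c0) * ((s ^+ 2 - t ^+ 2) / (t ^+ 2 + s ^+ 2) ^+ 2)) bd N0 cbd) => //.
- move=> s t s0; exact: (is_derive_shift_mul c0 (C1_d1 C s) (fun u => is_derive_radial u s0) t).
- move=> s s0; exact: (continuous_shift_mul (C1_d1 C s) (continuous_section1 (C1_cont1 C))
    (fun u => is_derive_radial u s0) (continuous_radial1 s0)).
- move=> s s0; have [-> ->] := edge1 s; rewrite /bd sqrrN.
  by have := D0 s; move: (N ^+ 2 + _) => z z0; field.
Qed.

Let I22 : \int[mu2]_x G22 x = - c0 * pi.
Proof.
rewrite -int_bd; apply: (@box_FTC2 _ N (fun s t => (chi (s, t) - c0) * (t / (t ^+ 2 + s ^+ 2)))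
  (fun s t => chi2 (s, t) * (t / (t ^+ 2 + s ^+ 2)) +
     (chi (s, t) - c0) * ((s ^+ 2 - t ^+ 2) / (t ^+ 2 + s ^+ 2) ^+ 2)) bd N0 cbd) => //.
- move=> s t s0; exact: (is_derive_shift_mul c0 (C1_d2 C s) (fun u => is_derive_radial u s0) t).
- move=> s s0; exact: (continuous_shift_mul (C1_d2 C s) (continuous_section2 (C1_cont2 C))
    (fun u => is_derive_radial u s0) (continuous_radial1 s0)).
- move=> s s0; have [-> ->] := edge2 s; rewrite /bd sqrrN.
  by have := D0 s; move: (N ^+ 2 + _) => z z0; field.
- by move=> s t; rewrite /G22 /q /= [s ^+ 2 + t ^+ 2]addrC.
Qed.

Let I12 : \int[mu2]_x G12 x = 0.
Proof.
rewrite -int0; apply: (@box_FTC1 _ N (fun s t => (chi (t, s) - c0) * (s / (t ^+ 2 + s ^+ 2)))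
  (fun s t => chi1 (t, s) * (s / (t ^+ 2 + s ^+ 2)) +
     (chi (t, s) - c0) * (- (2 * t * s) / (t ^+ 2 + s ^+ 2) ^+ 2)) (fun=> 0) N0) => //.
- by move=> s; exact: cvg_cst.
- move=> s t s0; exact: (is_derive_shift_mul c0 (C1_d1 C s) (fun u => is_derive_tangential u s0) t).
- move=> s s0; exact: (continuous_shift_mul (C1_d1 C s) (continuous_section1 (C1_cont1 C))
    (fun u => is_derive_tangential u s0) (continuous_tangential1 s0)).
- by move=> s s0; have [-> ->] := edge1 s; rewrite sqrrN subrr.
Qed.

Let I21 : \int[mu2]_x G21 x = 0.
Proof.
rewrite -int0; apply: (@box_FTC2 _ N (fun s t => (chi (s, t) - c0) * (s / (t ^+ 2 + s ^+ 2)))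
  (fun s t => chi2 (s, t) * (s / (t ^+ 2 + s ^+ 2)) +
     (chi (s, t) - c0) * (- (2 * t * s) / (t ^+ 2 + s ^+ 2) ^+ 2)) (fun=> 0) N0) => //.
- by move=> s; exact: cvg_cst.
- move=> s t s0; exact: (is_derive_shift_mul c0 (C1_d2 C s) (fun u => is_derive_tangential u s0) t).
- move=> s s0; exact: (continuous_shift_mul (C1_d2 C s) (continuous_section2 (C1_cont2 C))
    (fun u => is_derive_tangential u s0) (continuous_tangential1 s0)).
- by move=> s s0; have [-> ->] := edge2 s; rewrite sqrrN subrr.
- by move=> s t; rewrite /G21 /q /= [s ^+ 2 + t ^+ 2]addrC.
Qed.

Let integrable_piece (G : plane R -> R) : measurable_fun setT G ->
  (\int[mu2]_x `|G x|%:E < +oo)%E -> mu2.-integrable setT (EFin \o G).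
Proof. by move=> mG fG; apply/integrableP; split; [exact/measurable_EFinP|]. Qed.

Let outside (x : plane R) : x \notin box N -> chi1 x = 0 /\ chi2 x = 0.
Proof.
move=> xN; have [] // := C1_supp C (x := x).
by rewrite leNgt; apply: contra xN => /ltW xN; apply/mem_set.
Qed.

(** As [kvec] is divergence free, the integrand is the divergence of
(chi - chi 0) [kvec] in the square.  This field is - chi 0 [kvec] on the
boundary, through which its flux is - 2 pi chi 0. *)
Lemma divergence_at0 :
  \int[mu2]_x (chi1 x * (kvec x).1 + chi2 x * (kvec x).2) = - (2 * pi * chi (0, 0)).
Proof.
have -> : - (2 * pi * chi (0, 0)) = - c0 * pi + - c0 * pi by rewrite /c0; ring.
have e := RintegralD measurableT (integrable_piece mG11 fG11) (integrable_piece mG22 fG22).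
transitivity (\int[mu2]_x G11 x + \int[mu2]_x G22 x); last by rewrite I11 I22.
rewrite -[RHS]e; congr fine; apply: eq_integral => x _; congr EFin; rewrite /G11 /G22 /kvec !sqr_enorm -/(q x) indicE.
case: (boolP (x \in box N)) => [_|/outside[-> ->]] /=; last by rewrite !mul0r addr0.
by rewrite !mul1r; ring.
Qed.

(** As in [divergence_at0] for the curl, but on opposite sides of the square the
boundary terms are now equal and cancel. *)
Lemma curl_at0 :
  \int[mu2]_x (chi1 x * (kvec x).2 - chi2 x * (kvec x).1) = 0.
Proof.
have e := RintegralB measurableT (integrable_piece mG12 fG12) (integrable_piece mG21 fG21).
transitivity (\int[mu2]_x G12 x - \int[mu2]_x G21 x); last by rewrite I12 I21 subr0.
rewrite -[RHS]e; congr fine; apply: eq_integral => x _; congr EFin; rewrite /G12 /G21 /kvec !sqr_enorm -/(q x) indicE.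
case: (boolP (x \in box N)) => [_|/outside[-> ->]] /=; last by rewrite !mul0r subr0.
by rewrite !mul1r; ring.
Qed.

End AtOrigin.
End FundamentalSolution.

(** * Divergence and curl of the kernel against test functions *)

Section TestFunctions.
Context {R : realType}.
Local Notation mu2 := (@plane_measure R).

(** A directional derivative only depends on the restriction to a line.  This
relates partial derivatives, derivatives in one variable and translations. *)
Lemma is_derive_line (V W : normedModType R) (f : V -> R) (g : W -> R)
    (x v : V) (z w : W) (df : R) :
  (forall h : R, f (h *: v + x) = g (h *: w + z)) ->
  is_derive x v f df -> is_derive z w g df.
Proof.
move=> fg [dF DF]; have e : (fun h : R => h^-1 *: ((f \o shift x) (h *: v) - f x)) =
    (fun h : R => h^-1 *: ((g \o shift z) (h *: w) - g z)).
  apply/funext => h /=; rewrite fg; congr (_ *: (_ - _)).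
  by have := fg 0; rewrite !scale0r !add0r.
by split; [move: dF; rewrite /derivable e|rewrite -DF /derive e].
Qed.

Lemma C1_compact_translation (y : R * R) chi chi1 chi2 (N M : R) :
  C1_compact chi chi1 chi2 N M ->
  C1_compact (fun x => chi (x + y)) (fun x => chi1 (x + y)) (fun x => chi2 (x + y))
    (N + supn y) M.
Proof.
move=> C; have cT (f : R * R -> R) : continuous f -> continuous (fun x : R * R => f (x + y)).
  move=> cf x; apply: (@continuous_comp _ _ _ (fun x : R * R => x + y) f); last exact: cf.
  by apply: cvgD; [exact: cvg_id|exact: cvg_cst].
have supnD (a b : R * R) : supn (a + b) <= supn a + supn b.
  rewrite ge_max /=; apply/andP; split; apply: (le_trans (ler_normD _ _));
  by apply: lerD; rewrite le_max lexx ?orbT.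
split.
- by rewrite ltr_pwDl ?(C1_gt0 C)// le_max normr_ge0.
- move=> s t; apply: is_derive_line (C1_d1 C (s + y.2) (t + y.1)) => h.
  by congr chi; apply: (congr2 pair); rewrite /= ?addrA.
- move=> s t; apply: is_derive_line (C1_d2 C (s + y.1) (t + y.2)) => h.
  by congr chi; apply: (congr2 pair); rewrite /= ?addrA.
- by apply: cT; exact: C1_cont C.
- by apply: cT; exact: C1_cont1 C.
- by apply: cT; exact: C1_cont2 C.
- move=> x xN; apply: (C1_supp C); have := supnD (x + y) (- y); rewrite addrK.
  have -> : supn (- y) = supn y by rewrite /supn /= !normrN.
  by move=> h; lra.
- by move=> x; exact: C1_bound C _.
Qed.

Section Kernel.
Variables (chi chi1 chi2 : R * R -> R) (N M : R).
Hypothesis C : C1_compact chi chi1 chi2 N M.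
Variable y : plane R.
Let m1 := continuous_measurable_plane (C1_cont1 C).
Let m2 := continuous_measurable_plane (C1_cont2 C).
Let k1 : measurable_fun setT (fun x : plane R => (kvec (x - y)).1).
Proof. exact: measurableT_comp measurable_kvec1 (measurable_plane_subl y). Qed.
Let k2 : measurable_fun setT (fun x : plane R => (kvec (x - y)).2).
Proof. exact: measurableT_comp measurable_kvec2 (measurable_plane_subl y). Qed.

Let pE (x : plane R) : ptrans y x = x + y :> plane R. Proof. by []. Qed.

Lemma divergence_kernel :
  \int[mu2]_x (chi1 x * (kvec (x - y)).1 + chi2 x * (kvec (x - y)).2) = - (2 * pi * chi y).
Proof.
rewrite -(integral_translation y); last first.
  by apply: measurable_funD; exact: measurable_funM.
have := divergence_at0 (C1_compact_translation y C); rewrite add0r => <-.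
by congr fine; apply: eq_integral => x _; congr EFin; rewrite pE addrK.
Qed.

Lemma curl_kernel :
  \int[mu2]_x (chi1 x * (kvec (x - y)).2 - chi2 x * (kvec (x - y)).1) = 0.
Proof.
rewrite -(integral_translation y); last first.
  by apply: measurable_funB; exact: measurable_funM.
rewrite -[RHS](curl_at0 (C1_compact_translation y C)).
by congr fine; apply: eq_integral => x _; congr EFin; rewrite pE addrK.
Qed.

End Kernel.

Lemma test_function_C1 (phi : R * R -> R) : test_function phi ->
  exists N M, C1_compact phi (partial e1 phi) (partial e2 phi) N M.
Proof.
move=> [sm cK]; set K := closure _ in cK.
have [cphi dphi] := sm [::]; have [c1 _] := sm [:: true]; have [c2 _] := sm [:: false].
have off x : ~ K x -> [/\ phi x = 0, partial e1 phi x = 0 & partial e2 phi x = 0].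
  move=> nK; have oK : open (~` K) by apply: closed_openC; exact: closed_closure.
  have phi0 z : (~` K) z -> phi z = 0.
    move=> nz; apply/eqP; apply: contra_notT nz => h; exact: subset_closure.
  have near0 : \forall z \near x, phi z = cst 0 z.
    by apply: filterS (open_nbhs_nbhs (conj oK nK)) => z /phi0.
  have D0 v : partial v phi x = 0.
    by rewrite /partial (near_eq_derive v near0) derive_cst.
  by split; [exact: phi0|exact: D0|exact: D0].
have [N0 [_ hN0]] := compact_bounded cK.
have bnd (f : R * R -> R) : continuous f -> (forall x, ~ K x -> f x = 0) ->
    exists M, forall x, `|f x| <= M.
  move=> cf f0; have [M0 [_ hM0]] :=
    compact_bounded (continuous_compact (continuous_subspaceT cf) cK).
  exists (Num.max 0 (M0 + 1)) => x; have [Kx|nKx] := pselect (K x); last first.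
    by rewrite f0// normr0 le_max lexx.
  by rewrite le_max; apply/orP; right; apply: hM0; [rewrite ltrDl|exists x].
have [M1 b1] := bnd _ c1 (fun x nK => let: And3 _ h _ := off x nK in h).
have [M2 b2] := bnd _ c2 (fun x nK => let: And3 _ _ h := off x nK in h).
(* only the radii above [N0] are known to bound the support *)
exists (Num.max 1 (N0 + 2)), (Num.max M1 M2); split.
- by rewrite lt_max ltr01.
- move=> s t; have := @DeriveDef _ _ _ (t, s) e1 phi _ (dphi (t, s)).1 erefl.
  apply: is_derive_line => h; congr phi; congr pair => /=.
  by rewrite /GRing.scale/= mulr0 add0r.
- move=> s t; have := @DeriveDef _ _ _ (s, t) e2 phi _ (dphi (s, t)).2 erefl.
  apply: is_derive_line => h; congr phi; congr pair => /=.
  by rewrite /GRing.scale/= mulr0 add0r.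
- exact: cphi.
- exact: c1.
- exact: c2.
- move=> x; rewrite ge_max => /andP[_ xN]; apply: off => Kx.
  have := hN0 (N0 + 1); rewrite ltrDl ltr01 => /(_ isT x Kx).
  by move=> h; have : supn x <= N0 + 1 := h; lra.
- by move=> x; rewrite !le_max b1 b2 orbT.
Qed.

End TestFunctions.

(** * Potentials integrated against a weight *)

Section WeightedPotential.
Context {R : realType}.
Local Notation C := R[i].
Local Notation mu2 := (@plane_measure R).
Variable h : plane R -> 'cV[C]_2.
Hypothesis mh : mxmeas h.
Hypothesis h_lty : (\int[mu2]_x (len (h x))%:E < +oo)%E.
Hypothesis ae_h : {ae mu2, forall x, mxintegrable (fun y => dsym (kvec (x - y)) *m h y)}.
Variables (w : plane R -> R) (A : R).
Hypotheses (mw : measurable_fun setT w) (A0 : 0 <= A).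
Hypothesis w_le : forall x, `|w x| <= A * bracket x `^ (- 2).

Lemma cmod_dsym (k : R * R) i j : cmod (dsym k i j) <= enorm k.
Proof.
have -> : dsym k i j = (dsym k *m delta_mx j (0 : 'I_1)) i 0.
  by rewrite -colE [RHS]mxE.
apply: (le_trans (cmod_le_len _ _)); apply: (le_trans (len_dsym _ _)).
rewrite [X in _ * X](_ : _ = 1) ?mulr1// /len normsqE (bigD1 j)//= big1 => [|l lj].
  by rewrite mxE !eqxx /cmod/= expr1n expr0n/= !addr0 sqrtr1 expr1n sqrtr1.
by rewrite mxE (negbTE lj) /cmod/= expr0n/= addr0 sqrtr0 expr0n.
Qed.

Let g (z : plane R * plane R) : R :=
  A * (bracket z.1 `^ (- 2) * (enorm (z.1 - z.2))^-1 * len (h z.2)).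

Let F (z : plane R * plane R) : 'cV[C]_2 :=
  ((w z.1)%:C *: dsym (kvec (z.1 - z.2))) *m h z.2.

Let mF : mxmeas F.
Proof.
apply: mxmeasM; last exact: (mxmeas_comp measurable_snd mh).
apply: mxmeasZ; last exact: mxmeas_kernel.
by apply: cmeas_real; exact: (measurableT_comp mw measurable_fst).
Qed.

Let mkern : measurable_fun setT (fun z : plane R * plane R => (enorm (z.1 - z.2))^-1).
Proof. exact: measurableT_comp measurable_inv_enorm measurable_plane_sub. Qed.

Let mg : measurable_fun setT g.
Proof.
apply: measurable_funM => //; apply: measurable_funM.
- apply: measurable_funM => //.
  exact: (measurableT_comp (measurable_bracket_powR (- 2)) measurable_fst).
- exact: (measurableT_comp (measurable_len mh) measurable_snd).
Qed.

Let k0 (x y : plane R) : 0 <= bracket x `^ (- 2) * (enorm (x - y))^-1.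
Proof. by rewrite mulr_ge0 ?powR_ge0// invr_ge0 enorm_ge0. Qed.

Let g0 z : 0 <= g z.
Proof. by rewrite mulr_ge0// mulr_ge0 ?len_ge0. Qed.

Let Fg z i j : cmod (F z i j) <= g z.
Proof.
rewrite (ord1 j); apply: (le_trans (cmod_le_len _ _)).
rewrite /F -scalemxAl lenZ cmod_real /g.
apply: (@le_trans _ _ ((A * bracket z.1 `^ (- 2)) * ((enorm (z.1 - z.2))^-1 * len (h z.2)))).
  apply: ler_pM; [exact: normr_ge0|exact: len_ge0|exact: w_le|].
  by apply: (le_trans (len_dsym _ _)); rewrite enorm_kvec.
by rewrite le_eqVlt; apply/orP; left; apply/eqP; rewrite -!mulrA.
Qed.

Let mcol (y : plane R) :
  measurable_fun setT (fun x : plane R => bracket x `^ (- 2) * (enorm (x - y))^-1).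
Proof.
apply: measurable_funM; first exact: measurable_bracket_powR.
exact: measurableT_comp measurable_inv_enorm (measurable_plane_subl y).
Qed.

Let column : exists2 M : R, 0 <= M & forall y,
  (\int[mu2]_x (bracket x `^ (- 2) * (enorm (x - y))^-1)%:E <= M%:E)%E.
Proof.
have [M M0 MP] := @potential_bounded R 2 ltac:(lra).
exists M => // y; apply: le_trans (MP y).
by rewrite le_eqVlt; apply/orP; left; apply/eqP/eq_integral => x _; rewrite mulrC.
Qed.

Let gfin : (\int[mu2]_x \int[mu2]_y (g (x, y))%:E < +oo)%E.
Proof.
have [M M0 MP] := column.
rewrite (@plane_tonelli _ (fun z => (g z)%:E)); first last.
- by move=> z; rewrite lee_fin.
- exact/measurable_EFinP.
have ml := measurable_len mh.
apply: (@le_lt_trans _ _ (\int[mu2]_y (A * M * len (h y))%:E)%E); last first.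
  rewrite integralZl_real//; [|by rewrite mulr_ge0|by move=> y; exact: len_ge0].
  by rewrite lte_mul_pinfty ?lee_fin ?mulr_ge0.
apply: ge0_le_integral => //.
- by move=> y _; apply: integral_ge0 => x _; rewrite lee_fin.
- apply: (@measurable_plane_tonelli2 _ (fun z => (g z)%:E)); first exact/measurable_EFinP.
  by move=> z; rewrite lee_fin.
- by apply/measurable_EFinP; exact: measurable_funM.
move=> y _; rewrite /g /=.
have ringE (s t : R) : A * (s * t) = (A * t) * s by ring.
rewrite (eq_integral (fun x : plane R =>
  (A * len (h y) * (bracket x `^ (- 2) * (enorm (x - y))^-1))%:E)); last first.
  by move=> x _; rewrite ringE.
have Al : 0 <= A * len (h y) by rewrite mulr_ge0// len_ge0.
rewrite (integralZl_real _ Al (mcol y)) => [|x]; last exact: k0.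
have -> : A * M * len (h y) = A * len (h y) * M by ring.
by rewrite [in leRHS]EFinM; apply: lee_wpmul2l => //; rewrite lee_fin.
Qed.

Lemma integrable_bracket_kernel (y : plane R) :
  mu2.-integrable setT (fun x => (A * (bracket x `^ (- 2) * (enorm (x - y))^-1))%:E).
Proof.
have [M M0 MP] := column.
apply: integrable_ge0 => [|x|]; first exact: measurable_funM.
  exact: mulr_ge0.
rewrite integralZl_real//.
by rewrite lte_mul_pinfty ?lee_fin// (le_lt_trans (MP y))// ltry.
Qed.

Lemma mxintegrable_weighted_kernel (y : plane R) :
  mxintegrable (fun x => (w x)%:C *: dsym (kvec (x - y))).
Proof.
apply: (mxintegrable_dom (g := fun x => A * (bracket x `^ (- 2) * (enorm (x - y))^-1))).
- apply: mxmeasZ; first exact: cmeas_real.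
  apply: mxmeas_dsym.
  + exact: measurableT_comp measurable_kvec1 (measurable_plane_subl y).
  + exact: measurableT_comp measurable_kvec2 (measurable_plane_subl y).
- exact: integrable_bracket_kernel.
- move=> x i j; rewrite mxE cmodM cmod_real mulrA.
  by apply: ler_pM => //; rewrite -?enorm_kvec ?cmod_ge0// cmod_dsym.
Qed.

Let sectionE : {ae mu2, forall x,
  mxintegral (fun y => F (x, y)) = (w x)%:C *: G00 h x}.
Proof.
apply: (plane_ae_imply ae_h) => x ix; rewrite G00E -mxintegralZ//.
by congr mxintegral; apply/funext => y; rewrite /F -scalemxAl.
Qed.

Let mG : mxmeas (fun x => (w x)%:C *: G00 h x).
Proof.
apply: mxmeasZ; first exact: cmeas_real.
have mk : mxmeas (fun z : plane R * plane R => dsym (kvec (z.1 - z.2)) *m h z.2).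
  by apply: mxmeasM; [exact: mxmeas_kernel|exact: (mxmeas_comp measurable_snd mh)].
have := mxmeas_section mk.
by rewrite (_ : (fun x => _) = G00 h)//; apply/funext => x; rewrite G00E.
Qed.

Let Kw y : 'M[C]_2 := mxintegral (fun x => (w x)%:C *: dsym (kvec (x - y))).

Let columnE y : mxintegral (fun x => F (x, y)) = Kw y *m h y.
Proof. by rewrite -mxintegral_mulr//; exact: mxintegrable_weighted_kernel. Qed.

(** Fubini moves the weight onto the kernel. *)
Lemma weighted_potential :
  mxintegral (fun x => (w x)%:C *: G00 h x) = mxintegral (fun y => Kw y *m h y).
Proof.
rewrite -(mxintegral_ae (mxmeas_section mF) mG sectionE) (mxintegral_fubini mF mg Fg gfin).
by congr mxintegral; apply/funext => y; exact: columnE.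
Qed.

Lemma mxintegrable_weighted_source : mxintegrable (fun y => Kw y *m h y).
Proof.
pose sw (z : plane R * plane R) := (z.2, z.1).
have msw : measurable_fun setT sw by apply: measurable_fun_pair; [exact: measurable_snd|exact: measurable_fst].
have gfin' : (\int[mu2]_x \int[mu2]_y (g (sw (x, y)))%:E < +oo)%E.
  have := gfin; rewrite (@plane_tonelli _ (fun z => (g z)%:E))//; first exact/measurable_EFinP.
have := mxintegrable_section (mxmeas_comp msw mF) (measurableT_comp mg msw) (fun z => Fg (sw z)) gfin'.
by under [fun x => _]eq_fun do rewrite columnE.
Qed.

End WeightedPotential.

(** * The Dirac equation for potentials *)

Section DiracEquation.
Context {R : realType}.
Local Notation C := R[i].
Local Notation mu2 := (@plane_measure R).

Lemma alpha11 : (alpha1 : 'M[C]_2) *m alpha1 = 1%:M.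
Proof.
apply/matrixP => i j; rewrite [LHS]mxE !big_ord_recl big_ord0 !mxE.
by case: i j => [[|[|//]] hi] [[|[|//]] hj] /=; rewrite ?(mulr0, mul0r, mulr1, addr0, add0r).
Qed.
Lemma alpha22 : (alpha2 : 'M[C]_2) *m alpha2 = 1%:M.
Proof.
apply/matrixP => i j; rewrite [LHS]mxE !big_ord_recl big_ord0 !mxE.
by case: i j => [[|[|//]] hi] [[|[|//]] hj] /=; apply: complex_eq; rewrite ?(cReD, cImD, cReM, cImM) /=; ring.
Qed.
Lemma alpha21 : (alpha2 : 'M[C]_2) *m alpha1 = - (alpha1 *m alpha2).
Proof.
apply/matrixP => i j; rewrite [LHS]mxE [RHS]mxE [in RHS]mxE !big_ord_recl !big_ord0 !mxE.
by case: i j => [[|[|//]] hi] [[|[|//]] hj] /=; rewrite ?(mulr0, mul0r, mulr1, mul1r, addr0, add0r, oppr0, opprK).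
Qed.

Lemma alpha_mul_dot (c1 c2 : R) (k : R * R) :
  c1%:C *: (alpha1 *m alpha_dot k) + c2%:C *: (alpha2 *m alpha_dot k) =
  (c1 * k.1 + c2 * k.2)%:C *: (1%:M : 'M[C]_2) + (c1 * k.2 - c2 * k.1)%:C *: (alpha1 *m alpha2).
Proof.
have rD (a b : R) : (a + b)%:C = a%:C + b%:C :> C by exact: rmorphD.
have rB (a b : R) : (a - b)%:C = a%:C - b%:C :> C by exact: rmorphB.
have rM (a b : R) : (a * b)%:C = a%:C * b%:C :> C by exact: rmorphM.
rewrite /alpha_dot !mulmxDr -!scalemxAr alpha11 alpha22 alpha21 rD rB !rM.
move: (alpha1 *m alpha2) (1%:M) => J I; move: (c1%:C : C) (c2%:C : C) (k.1%:C : C) (k.2%:C : C) => a b c d.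
rewrite !scalerDr !scalerN !scalerA !scalerDl scaleNr.
by rewrite [- _ + _]addrC addrACA.
Qed.

Lemma alpha_mul_dsym (c1 c2 : R) (k : R * R) (q := 'i%C / (2 * pi)%:C : C) :
  alpha1 *m (c1%:C *: dsym k) + alpha2 *m (c2%:C *: dsym k) =
  (c1 * k.1 + c2 * k.2)%:C *: (q *: (1%:M : 'M[C]_2)) +
  (c1 * k.2 - c2 * k.1)%:C *: (q *: (alpha1 *m alpha2)).
Proof.
have AC (a b : C) (B : 'M[C]_2) : a *: (b *: B) = b *: (a *: B) by rewrite !scalerA mulrC.
rewrite /dsym -/q -!scalemxAr ![_ *: (q *: _)]AC -!scalerDr.
by rewrite alpha_mul_dot.
Qed.

Lemma mxintegral_real m n (r : plane R -> R) (A : 'M[C]_(m, n)) :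
  mu2.-integrable setT (EFin \o r) ->
  mxintegral (fun x => (r x)%:C *: A) = (\int[mu2]_x r x)%:C *: A.
Proof.
move=> ir; apply/matrixP => i j; rewrite !mxE.
under [fun x => _]eq_fun do rewrite mxE mulrC.
rewrite cintegralZ; last by split => //=; exact: integrable0.
rewrite mulrC; congr (_ * _); apply: complex_eq => //=.
by rewrite /Rintegral integral0.
Qed.

Section Kernel.
Variables (chi chi1 chi2 : R * R -> R) (N M : R).
Hypothesis CC : C1_compact chi chi1 chi2 N M.

Lemma C1_weight : exists2 A : R, 0 <= A & forall x : plane R,
  `|chi1 x| <= A * bracket x `^ (- 2) /\ `|chi2 x| <= A * bracket x `^ (- 2).
Proof.
have N0 := C1_gt0 CC.
have M0 : 0 <= M by have [+ _] := C1_bound CC 0; exact: le_trans.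
have A0 : 0 <= M * (1 + 2 * N ^+ 2) by rewrite mulr_ge0// addr_ge0// mulr_ge0// sqr_ge0.
exists (M * (1 + 2 * N ^+ 2)) => // x.
have [xN|xN] := leP N (supn x).
  have [_ -> ->] := C1_supp CC xN.
  by rewrite normr0; split; exact: mulr_ge0 (powR_ge0 _ _).
have b0 := bracket_gt0 x.
have key : M <= M * (1 + 2 * N ^+ 2) * bracket x `^ (- 2).
  rewrite powRN powR_mulrn ?(ltW b0)// ler_pdivlMr ?exprn_gt0// ler_wpM2l// sqr_bracket.
  move: xN; rewrite gt_max => /andP[x1 x2].
  have sq (t : R) : `|t| < N -> t ^+ 2 <= N ^+ 2.
    by move=> tN; rewrite -[t ^+ 2]real_normK ?num_real// ler_pXn2r ?nnegrE// ltW.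
  by have := sq _ x1; have := sq _ x2; lra.
by have [c1 c2] := C1_bound CC x; split; apply: le_trans key.
Qed.

(** The operator alpha1 d_1 + alpha2 d_2 applied to [dsym (kvec w)] has the
divergence of [kvec] as its scalar part and the curl as the coefficient of
alpha1 alpha2. *)
Lemma dirac_kernel (y : plane R) :
  alpha1 *m mxintegral (fun x => (chi1 x)%:C *: dsym (kvec (x - y))) +
  alpha2 *m mxintegral (fun x => (chi2 x)%:C *: dsym (kvec (x - y))) =
  (- 'i%C * (chi y)%:C) *: (1%:M : 'M[C]_2).
Proof.
have [A A0 wA] := C1_weight.
have m1 := continuous_measurable_plane (C1_cont1 CC).
have m2 := continuous_measurable_plane (C1_cont2 CC).
have i1 := mxintegrable_weighted_kernel m1 A0 (fun x => (wA x).1) y.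
have i2 := mxintegrable_weighted_kernel m2 A0 (fun x => (wA x).2) y.
have k1 : measurable_fun setT (fun x : plane R => (kvec (x - y)).1).
  exact: measurableT_comp measurable_kvec1 (measurable_plane_subl y).
have k2 : measurable_fun setT (fun x : plane R => (kvec (x - y)).2).
  exact: measurableT_comp measurable_kvec2 (measurable_plane_subl y).
have A20 : 0 <= 2 * A by rewrite mulr_ge0.
have ig := integrable_bracket_kernel A20 y.
have dom (a b c d : R) (x : plane R) : `|a| <= A * bracket x `^ (- 2) ->
    `|b| <= A * bracket x `^ (- 2) -> `|c| <= (enorm (x - y))^-1 -> `|d| <= (enorm (x - y))^-1 ->
    `|a * c + b * d| <= 2 * A * (bracket x `^ (- 2) * (enorm (x - y))^-1).
  move=> ha hb hc hd; apply: (le_trans (ler_normD _ _)); rewrite !normrM.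
  have -> : 2 * A * (bracket x `^ (- 2) * (enorm (x - y))^-1) =
    A * bracket x `^ (- 2) * (enorm (x - y))^-1 + A * bracket x `^ (- 2) * (enorm (x - y))^-1 by ring.
  by apply: lerD; apply: ler_pM.
have ke (x : plane R) : `|(kvec (x - y)).1| <= (enorm (x - y))^-1 /\
    `|(kvec (x - y)).2| <= (enorm (x - y))^-1.
  rewrite -enorm_kvec; have := supn_le_enorm (kvec (x - y)); rewrite ge_max => /andP[? ?].
  by split.
have iD : mu2.-integrable setT
    (EFin \o (fun x => chi1 x * (kvec (x - y)).1 + chi2 x * (kvec (x - y)).2)).
  apply: (le_integrable _ _ _ ig) => //.
    by apply/measurable_EFinP; apply: measurable_funD; exact: measurable_funM.
  move=> x _; rewrite /= lee_fin; apply: le_trans (ler_norm _).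
  by have [? ?] := ke x; have [? ?] := wA x; exact: dom.
have iE : mu2.-integrable setT
    (EFin \o (fun x => chi1 x * (kvec (x - y)).2 - chi2 x * (kvec (x - y)).1)).
  apply: (le_integrable _ _ _ ig) => //.
    by apply/measurable_EFinP; apply: measurable_funB; exact: measurable_funM.
  move=> x _; rewrite /= lee_fin; apply: le_trans (ler_norm _).
  have [? ?] := ke x; have [? ?] := wA x.
  by rewrite -mulrN; apply: dom => //; rewrite normrN.
rewrite -!mxintegral_mull// -mxintegralD; try exact: mxintegrable_mull.
pose q : C := 'i%C / (2 * pi)%:C.
have -> : (fun x => alpha1 *m ((chi1 x)%:C *: dsym (kvec (x - y))) +
    alpha2 *m ((chi2 x)%:C *: dsym (kvec (x - y)))) =
  (fun x : plane R => (chi1 x * (kvec (x - y)).1 + chi2 x * (kvec (x - y)).2)%:C *: (q *: 1%:M) +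
    (chi1 x * (kvec (x - y)).2 - chi2 x * (kvec (x - y)).1)%:C *: (q *: (alpha1 *m alpha2))).
  by apply/funext => x; exact: alpha_mul_dsym.
have real_int (r : plane R -> R) (B : 'M[C]_2) : mu2.-integrable setT (EFin \o r) ->
    mxintegrable (fun x => (r x)%:C *: B).
  move=> ir i j; under [fun x => _]eq_fun do rewrite mxE mulrC.
  by apply: cintegrableZ; split => //=; exact: integrable0.
rewrite mxintegralD; [|exact: real_int|exact: real_int].
rewrite !mxintegral_real// (divergence_kernel CC) (curl_kernel CC) scale0r addr0 scalerA.
congr (_ *: _); rewrite /q.
have p0 : (2 * pi)%:C != 0 :> C.
  by rewrite eq_complex /= eqxx andbT gt_eqF// mulr_gt0// pi_gt0.
have -> : (- (2 * pi * chi y))%:C = - ((2 * pi)%:C * (chi y)%:C) :> C by rewrite rmorphN rmorphM.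
by move: (2 * pi)%:C (chi y)%:C p0 => p c p0; field.
Qed.

Section Equation.
Variable h : plane R -> 'cV[C]_2.
Hypothesis mh : mxmeas h.
Hypothesis h_lty : (\int[mu2]_x (len (h x))%:E < +oo)%E.
Hypothesis ae_h : {ae mu2, forall x, mxintegrable (fun y => dsym (kvec (x - y)) *m h y)}.

Let sourceE y :
  alpha1 *m (mxintegral (fun x => (chi1 x)%:C *: dsym (kvec (x - y))) *m h y) +
  alpha2 *m (mxintegral (fun x => (chi2 x)%:C *: dsym (kvec (x - y))) *m h y) =
  (- 'i%C * (chi y)%:C) *: h y.
Proof. by rewrite !mulmxA -mulmxDl dirac_kernel -scalemxAl mul1mx. Qed.

(** D_0 (G h) = h in the sense of distributions. *)
Lemma dirac_potential :
  mxintegrable (fun y => (- 'i%C * (chi y)%:C) *: h y) /\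
  alpha1 *m mxintegral (fun x => (chi1 x)%:C *: G00 h x) +
  alpha2 *m mxintegral (fun x => (chi2 x)%:C *: G00 h x) =
  mxintegral (fun y => (- 'i%C * (chi y)%:C) *: h y).
Proof.
have [A A0 wA] := C1_weight.
have m1 := continuous_measurable_plane (C1_cont1 CC).
have m2 := continuous_measurable_plane (C1_cont2 CC).
have w1 x := (wA x).1; have w2 x := (wA x).2.
have t1 := mxintegrable_weighted_source mh h_lty m1 A0 w1.
have t2 := mxintegrable_weighted_source mh h_lty m2 A0 w2.
have s1 := mxintegrable_mull alpha1 t1; have s2 := mxintegrable_mull alpha2 t2.
split.
  by have := mxintegrableD s1 s2; under [fun x => _]eq_fun do rewrite sourceE.
rewrite (weighted_potential mh h_lty ae_h m1 A0 w1) (weighted_potential mh h_lty ae_h m2 A0 w2).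
rewrite -(mxintegral_mull alpha1 t1) -(mxintegral_mull alpha2 t2).
by rewrite -mxintegralD//; congr mxintegral; apply/funext => y; exact: sourceE.
Qed.

End Equation.
End Kernel.
End DiracEquation.

(** * Zero energy eigenfunctions *)

Section ZeroEnergy.
Context {R : realType}.
Local Notation C := R[i].
Local Notation mu2 := (@plane_measure R).
Local Notation field := (plane R -> 'cV[C]_2).
Variables (V v U : plane R -> 'M[C]_2) (b K : R).
Hypotheses (mV : mxmeas V) (mv : mxmeas v) (mU : mxmeas U).
Hypotheses (b2 : 2 < b) (b3 : b <= 3) (K0 : 0 <= K).
Hypothesis len_v : forall x u, len (v x *m u) <= K * bracket x `^ (- (b / 2)) * len u.
Hypothesis len_vC : forall x u, len ((v x)^t* *m u) <= K * bracket x `^ (- (b / 2)) * len u.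
Hypothesis U_sqr : forall x, U x *m U x = 1%:M.
Hypothesis VE : forall x, V x = (v x)^t* *m U x *m v x.

Let pot (f : field) : field := G00 (fun y => (v y)^t* *m f y).

Lemma BS_kernel_potential (f : field) : {ae mu2, forall x, BS v U f x = 0} ->
  {ae mu2, forall x, v x *m pot f x = - (U x *m f x)}.
Proof.
move=> f0; apply: (plane_ae_imply f0) => x; rewrite /BS => /eqP.
by rewrite addrC addr_eq0 => /eqP.
Qed.

(** On the kernel of T, V times the potential is minus the source. *)
Lemma potential_zero_eigenspace (f : field) : L2 f ->
  mxintegral (fun y => (v y)^t* *m f y) = 0 ->
  {ae mu2, forall x, BS v U f x = 0} -> zero_eigenspace V (pot f).
Proof.
move=> Lf f0 Bf; split; first exact: (L2_potential mv b2 b3 K0 len_vC).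
move=> phi test; have [N [M CC]] := test_function_C1 test.
set h := fun y => (v y)^t* *m f y.
have mh : mxmeas h by apply: mxmeasM; [exact: mxmeas_conj|exact: L2_meas].
have hl : (\int[mu2]_x (len (h x))%:E < +oo)%E := len_src_lty mv b2 K0 len_vC Lf.
have ah := ae_integrable_potential mv b2 len_vC Lf.
have mp := continuous_measurable_plane (C1_cont CC).
have mpot : mxmeas (pot f) := mxmeas_potential mv Lf.
have [iF e] := dirac_potential CC mh hl ah.
have mch : mxmeas (fun y => (- 'i%C * (phi y)%:C) *: h y).
  by apply: mxmeasZ => //; apply: cmeasM; [exact: cmeas_cst|exact: cmeas_real].
have -> : H_distr V (pot f) phi =
    'i%C *: (alpha1 *m mxintegral (fun x => (partial e1 phi x)%:C *: G00 h x) +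
             alpha2 *m mxintegral (fun x => (partial e2 phi x)%:C *: G00 h x)) +
    mxintegral (fun x => (phi x)%:C *: (V x *m pot f x)).
  by rewrite /H_distr !mulmxN -opprD scaleNr scalerN opprK.
rewrite e -mxintegralZ//.
have iE y : 'i%C *: ((- 'i%C * (phi y)%:C) *: h y) = (phi y)%:C *: h y.
  by rewrite scalerA mulrA mulrN -expr2 sqr_i opprK mul1r.
have ip : mxintegrable (fun y => (phi y)%:C *: h y).
  by have := mxintegrableZ 'i%C iF; under [fun x => _]eq_fun do rewrite iE.
under [fun x => 'i%C *: _]eq_fun do rewrite iE.
rewrite (@mxintegral_ae _ _ _ (fun x => (phi x)%:C *: (V x *m pot f x))
  (fun y => - ((phi y)%:C *: h y))); first last.
- apply: (plane_ae_imply (BS_kernel_potential Bf)) => x vp.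
  have -> : V x *m pot f x = (v x)^t* *m (U x *m (v x *m pot f x)) by rewrite VE !mulmxA.
  by rewrite vp mulmxN [U x *m (U x *m _)]mulmxA U_sqr mul1mx mulmxN scalerN.
- by apply: mxmeasN; exact: mxintegrable_meas.
- by apply: mxmeasZ; [exact: cmeas_real|exact: mxmeasM].
by rewrite mxintegralN// subrr.
Qed.

(** A null vector f of T is recovered from its potential as
- U v (G v^* f). *)
Lemma potential_eq0 n (f : 'I_n -> field) (c : 'I_n -> C) :
  (forall i, {ae mu2, forall x, BS v U (f i) x = 0}) ->
  {ae mu2, forall x, \sum_i c i *: pot (f i) x = 0} ->
  {ae mu2, forall x, \sum_i c i *: f i x = 0}.
Proof.
move=> Bf p0.
have Bf' : {ae mu2, forall x, forall i, v x *m pot (f i) x = - (U x *m f i x)}.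
  by apply: filter_forall => i; exact: BS_kernel_potential.
apply: (plane_ae_imply2 Bf' p0) => x vp s0.
have : U x *m (U x *m \sum_i c i *: f i x) = 0.
  have -> : U x *m \sum_i c i *: f i x = - (v x *m \sum_i c i *: pot (f i) x).
    rewrite !mulmx_sumr -sumrN; apply: eq_bigr => i _.
    by rewrite -!scalemxAr vp scalerN opprK.
  by rewrite s0 mulmx0 oppr0 mulmx0.
by rewrite mulmxA U_sqr mul1mx.
Qed.

(** The coefficients of the combinations of mean zero form the kernel of an
n x 2 matrix, of dimension at least n - 2. *)
Lemma indep_in_kernel n (f : 'I_n -> field) : lin_indep f ->
  (forall i, L2 (f i)) -> (forall i, {ae mu2, forall x, BS v U (f i) x = 0}) ->
  exists m (psi : 'I_m -> field), [/\ (n <= 2 + m)%N, forall k, zero_eigenspace V (psi k) & lin_indep psi].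
Proof.
move=> indf Lf Bf.
pose M : 'M[C]_(n, 2) := \matrix_(i, j) (mxintegral (fun y => (v y)^t* *m f i y)) j 0.
pose a := row_base (kermx M).
have aM : a *m M = 0 by apply/sub_kermxP; rewrite eq_row_base.
exists (\rank (kermx M)).
pose fk k : field := fun x => \sum_i a k i *: f i x.
have Lfk k : L2 (fk k) by exact: L2_sum.
have Bfk k : {ae mu2, forall x, BS v U (fk k) x = 0} := BS_sum mv b2 len_vC (a k) Lf Bf.
exists (fun k => pot (fk k)); split.
- by rewrite mxrank_ker -leq_subLR leq_sub2l// rank_leq_col.
- move=> k; apply: potential_zero_eigenspace => //.
  rewrite (mxintegral_src_sum mv b2 K0 len_vC)//; apply/matrixP => i j; rewrite (ord1 j) summxE.
  have aM0 : (a *m M) k i = 0 by rewrite aM mxE.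
  transitivity (\sum_l a k l * M l i).
    by apply: eq_bigr => l _; rewrite [LHS]mxE [M l i]mxE.
  by move: aM0; rewrite mxE => ->; rewrite mxE.
move=> c c0.
have sum0 := potential_eq0 Bfk c0.
have ca0 : (\row_k c k) *m a = 0.
  have := indf (fun i => ((\row_k c k) *m a) 0 i).
  have h : ae_eq2 (fun x => \sum_i ((\row_k c k) *m a) 0 i *: f i x) (fun=> 0).
    apply: (plane_ae_imply sum0) => x s0; rewrite -[RHS]s0.
    rewrite /fk; under [RHS]eq_bigr do rewrite scaler_sumr.
    rewrite exchange_big /=; apply: eq_bigr => i _ /=; rewrite mxE scaler_suml.
    by apply: eq_bigr => k _; rewrite mxE scalerA.
  by move=> /(_ h) z; apply/matrixP => i j; rewrite (ord1 i) z mxE.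
have /row_freeP[a' aa'] : row_free a := row_base_free _.
move=> k; have := congr1 (mulmx^~ a') ca0; rewrite -mulmxA aa' mulmx1 mul0mx.
by move=> /(congr1 (fun A : 'rV[C]_(\rank (kermx M)) => A 0 k)); rewrite !mxE.
Qed.

End ZeroEnergy.

(** * Factorization of the potential *)

Section Diagonalization.
Context {R : realType}.
Local Notation C := R[i].

Lemma rdiag_mulE (d : 'I_2 -> R) (u : 'cV[C]_2) i : (rdiag d *m u) i 0 = (d i)%:C * u i 0.
Proof. by rewrite /rdiag mul_diag_mx !mxE. Qed.

Lemma rdiag_mul (d e : 'I_2 -> R) :
  rdiag d *m rdiag e = rdiag (fun i => d i * e i) :> 'M[C]_2.
Proof.
rewrite /rdiag mulmx_diag; congr diag_mx; apply/matrixP => i j.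
by rewrite !mxE; apply: complex_eq; rewrite ?cReM ?cImM /=; ring.
Qed.

Lemma rdiag1 : rdiag (fun=> 1) = 1%:M :> 'M[C]_2.
Proof. by apply/matrixP => i j; rewrite !mxE. Qed.

Lemma rdiag_conj (d : 'I_2 -> R) : (rdiag d)^t* = rdiag d.
Proof.
rewrite /rdiag tr_diag_mx map_diag_mx; congr diag_mx; apply/matrixP => i j.
by rewrite !mxE; apply: complex_eq => //=; rewrite oppr0.
Qed.

Lemma len_rdiag (d : 'I_2 -> R) (s : R) (u : 'cV[C]_2) :
  (forall i, `|d i| <= s) -> len (rdiag d *m u) <= s * len u.
Proof.
move=> ds; have s0 : 0 <= s by exact: le_trans (ds 0).
rewrite -(@ler_pXn2r _ 2)// ?nnegrE ?mulr_ge0 ?len_ge0// exprMn !sqr_len !normsqE mulr_sumr.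
apply: ler_sum => i _; rewrite rdiag_mulE cmodM cmod_real exprMn.
by rewrite ler_wpM2r ?sqr_ge0// ler_pXn2r ?nnegrE.
Qed.

Lemma len_rdiag_sign (d : 'I_2 -> R) (u : 'cV[C]_2) :
  (forall i, `|d i| = 1) -> len (rdiag d *m u) = len u.
Proof.
move=> d1; rewrite /len !normsqE; congr Num.sqrt; apply: eq_bigr => i _.
by rewrite rdiag_mulE cmodM cmod_real d1 mul1r.
Qed.

Lemma len_unitary (B : 'M[C]_2) u : B \is unitarymx -> len (B *m u) = len u.
Proof. by move=> uB; rewrite /len normsq_unitary. Qed.

Lemma len_mulmx_le (A : 'M[C]_2) (k : R) (u : 'cV[C]_2) :
  (forall i j, cmod (A i j) <= k) -> len (A *m u) <= 4 * k * len u.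
Proof.
move=> Ak; have k0 : 0 <= k by exact: le_trans (cmod_ge0 _) (Ak 0 0).
have kl : 0 <= k * len u by rewrite mulr_ge0 ?len_ge0.
have key i : cmod ((A *m u) i 0) <= 2 * (k * len u).
  rewrite mxE; apply: (le_trans (cmod_sum _)).
  apply: (@le_trans _ _ (\sum_(j < 2) (k * len u))).
    by apply: ler_sum => j _; rewrite cmodM ler_pM ?cmod_ge0// cmod_le_len.
  by rewrite sumr_const card_ord mulr_natl.
rewrite -mulrA -(@ler_pXn2r _ 2)// ?nnegrE ?mulr_ge0 ?len_ge0// sqr_len normsqE.
apply: (@le_trans _ _ (\sum_(i < 2) (2 * (k * len u)) ^+ 2)).
  by apply: ler_sum => i _; rewrite ler_pXn2r ?nnegrE ?cmod_ge0// mulr_ge0.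
rewrite sumr_const card_ord -mulr_natl !exprMn; have := sqr_ge0 (k * len u).
by rewrite exprMn; move: (k ^+ 2 * _) => t t0; lra.
Qed.

(** [d i] is the eigenvalue of [A] at the image under B^* of the i-th basis
vector, a unit vector. *)
Lemma eigenvalue_bound (A B : 'M[C]_2) (d : 'I_2 -> R) (k : R) i :
  B \is unitarymx -> A = B^t* *m rdiag d *m B -> (forall i j, cmod (A i j) <= k) ->
  `|d i| <= 4 * k.
Proof.
move=> uB AE Ak; pose e : 'cV[C]_2 := delta_mx i 0; pose u := B^t* *m e.
have uB' : B^t* \is unitarymx by rewrite trmxC_unitary.
have Bu : B *m u = e by rewrite mulmxA (unitarymxP _) // mul1mx.
have le1 : len e = 1.
  rewrite /len normsqE (bigD1 i)//= big1 => [|l li].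
    by rewrite mxE !eqxx /cmod/= expr1n expr0n/= !addr0 sqrtr1 expr1n sqrtr1.
  by rewrite mxE (negbTE li) /cmod/= expr0n/= addr0 sqrtr0 expr0n.
have lu : len u = 1 by rewrite /u len_unitary.
have Au : A *m u = B^t* *m (rdiag d *m e) by rewrite AE -!mulmxA Bu.
have de : rdiag d *m e = (d i)%:C *: e.
  apply/matrixP => j l; rewrite (ord1 l) rdiag_mulE !mxE.
  by case: (eqVneq j i) => [->|]; rewrite ?mulr0 ?andbF ?andFb//= mulr0 mulr0.
have := len_mulmx_le u Ak; rewrite lu mulr1 Au len_unitary// de lenZ le1 mulr1.
by rewrite cmod_real.
Qed.

Lemma mxmeas_rdiag d (T : measurableType d) (f : T -> 'I_2 -> R) :
  (forall i, measurable_fun setT (fun x => f x i)) -> mxmeas (fun x => rdiag (f x)).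
Proof.
move=> mf i j; under [fun x => _]eq_fun do rewrite !mxE.
case: (i == j); last by apply: cmeas_cst.
by under [fun x => _]eq_fun do rewrite mulr1n; exact: cmeas_real.
Qed.

Section Factorization.
Variables (V B : plane R -> 'M[C]_2) (zeta : plane R -> 'I_2 -> R) (beta : R).
Hypotheses (beta2 : 2 < beta) (Vdecay : decays V beta) (VB : diagonalizes V B zeta).

(** The exponent 2 - b/2 that occurs for potentials of mean zero has to be
positive, so that the decay is capped, at some exponent between 2 and 4. *)
Let b := Num.min beta 3.

Lemma zeta_decay : exists2 K : R, 0 <= K & forall x i,
  `|zeta x i| <= K * bracket x `^ (- b).
Proof.
have [_ _ uB VE] := VB.
pose k i j : R := projT1 (cid (Vdecay i j)).
have kP i j x : `|V x i j| <= (k i j * bracket x `^ (- beta))%:C := projT2 (cid (Vdecay i j)) x.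
pose K := \sum_i \sum_j `|k i j|.
have K0 : 0 <= K by apply: sumr_ge0 => i _; apply: sumr_ge0 => j _; exact: normr_ge0.
have kK i j : k i j <= K.
  apply: (le_trans (ler_norm _)); rewrite /K (bigD1 i)//= (bigD1 j)//= -addrA lerDl.
  by rewrite addr_ge0 ?sumr_ge0// => l _; rewrite sumr_ge0.
exists (4 * K) => [|x i]; first by rewrite mulr_ge0.
rewrite -mulrA; apply: (eigenvalue_bound i (uB x) (VE x)) => l m.
rewrite -lecR cmodE; apply: (le_trans (kP l m x)); rewrite lecR.
apply: (le_trans (ler_wpM2r (powR_ge0 _ _) (kK l m))); rewrite ler_wpM2l//.
by apply: ler_powR; rewrite ?bracket_ge1// lerN2 ge_min lexx.
Qed.

Let v := vfactor B zeta.
Let U := Usign zeta.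

Lemma vfactor_bound : exists2 K : R, 0 <= K & (forall x u,
   len (v x *m u) <= K * bracket x `^ (- (b / 2)) * len u) /\
  (forall x u, len ((v x)^t* *m u) <= K * bracket x `^ (- (b / 2)) * len u).
Proof.
have [_ _ uB _] := VB; have [K K0 Kz] := zeta_decay.
exists (Num.sqrt K); first exact: sqrtr_ge0.
have sz x i : `|Num.sqrt `|zeta x i| | <= Num.sqrt K * bracket x `^ (- (b / 2)).
  rewrite ger0_norm ?sqrtr_ge0//; apply: (le_trans (ler_wsqrtr (Kz x i))).
  rewrite sqrtrM// -[bracket x `^ (- b)]sqr_sqrtr ?powR_ge0// sqrtr_sqr ger0_norm ?sqrtr_ge0//.
  rewrite ler_wpM2l ?sqrtr_ge0// -powR12_sqrt ?powR_ge0// -powRrM.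
  by rewrite mulNr.
split=> x u; rewrite /v /vfactor.
- rewrite -mulmxA; apply: (le_trans (len_rdiag _ (sz x))).
  by rewrite len_unitary.
- rewrite trmx_mul map_mxM/= rdiag_conj -mulmxA len_unitary ?trmxC_unitary//.
  exact: len_rdiag.
Qed.

Let sgn (r : R) : R := if 0 <= r then 1 else -1.

Let sgn1 r : `|sgn r| = 1.
Proof. by rewrite /sgn; case: ifP; rewrite ?normrN normr1. Qed.

Lemma Usign_sqr x : U x *m U x = 1%:M.
Proof.
rewrite /U /Usign rdiag_mul -rdiag1; congr rdiag; apply/funext => i.
by case: ifP; rewrite ?mulrNN mulr1.
Qed.

Lemma Usign_herm x : (U x)^t* = U x. Proof. exact: rdiag_conj. Qed.

Lemma len_Usign x u : len (U x *m u) = len u.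
Proof. by apply: len_rdiag_sign => i; exact: sgn1. Qed.

Lemma mxmeas_Usign : mxmeas U.
Proof.
have [_ mz _ _] := VB; apply: mxmeas_rdiag => i.
apply: measurable_fun_ifT => //; exact: measurable_fun_ler.
Qed.

Lemma mxmeas_vfactor : mxmeas v.
Proof.
have [mB mz _ _] := VB; apply: mxmeasM => //; apply: mxmeas_rdiag => i.
by apply: measurable_sqrt_ge0 => //; exact: measurableT_comp.
Qed.

Lemma vfactorE x : V x = (v x)^t* *m U x *m v x.
Proof.
have [_ _ _ VE] := VB; rewrite VE /v /vfactor /U /Usign trmx_mul map_mxM/= rdiag_conj.
rewrite !mulmxA -[in RHS](mulmxA _ (rdiag _) (rdiag _)) rdiag_mul.
rewrite -[in RHS](mulmxA _ (rdiag _) (rdiag _)) rdiag_mul.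
congr (_ *m rdiag _ *m _); apply/funext => i.
rewrite mulrCA -expr2 sqr_sqrtr//.
have [z0|z0] := leP 0 (zeta x i); first by rewrite ger0_norm// mul1r.
by rewrite ltr0_norm// mulN1r opprK.
Qed.

End Factorization.
End Diagonalization.

Theorem corollary7p3 (R : realType) (beta : R)
  (V B : plane R -> 'M[complex R]_2) (zeta : plane R -> 'I_2 -> R)
  (S1 : (plane R -> 'cV[complex R]_2) -> (plane R -> 'cV[complex R]_2))
  (hVmeas : mxmeasurable V)
  (hVherm : forall x, V x \is hermsymmx)
  (hbeta : 2 < beta)
  (hVdecay : decays V beta)
  (hdiag : diagonalizes V B zeta)
  (hS1 : riesz_projection_at0 (Top B zeta) S1) :
  (L2rank S1 <= 2%:E + L2dim (zero_eigenspace V))%E.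
Proof.
pose b := Num.min beta 3.
have b2 : 2 < b by rewrite lt_min hbeta; lra.
have b3 : b <= 3 by rewrite ge_min lexx orbT.
have [K K0 [lv lvC]] := vfactor_bound hVdecay hdiag.
have mv := mxmeas_vfactor hdiag; have mU := mxmeas_Usign hdiag.
have LA := L2_BS mv mU b2 K0 lv lvC (len_Usign zeta).
have symA := BS_symmetric mv mU b2 K0 lv lvC (len_Usign zeta) (Usign_herm zeta).
have ker f := riesz_range_kernel LA symA hS1 (f := f).
have [L2S _] := hS1.
apply: ge_ereal_sup => _ [n [phi [Sphi indphi]] <-].
have Lphi i : L2 (phi i) by have [f Lf <-] := Sphi i; exact: L2S.
have Bphi i : {ae (@plane_measure R), forall x, BS (vfactor B zeta) (Usign zeta) (phi i) x = 0}.
  by have [f Lf <-] := Sphi i; exact: ker.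
have [m [psi [nm psi0 indpsi]]] := indep_in_kernel hVmeas mv b2 b3 K0 lvC (Usign_sqr zeta)
  (vfactorE hdiag) indphi Lphi Bphi.
have le1 : (m%:R%:E <= L2dim (zero_eigenspace V))%E.
  by apply: ereal_sup_ubound; exists m => //; exists psi.
apply: (@le_trans _ _ (2%:E + m%:R%:E)%E); last exact: leeD2l.
by rewrite -EFinD lee_fin -natrD ler_nat.
Qed.
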